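(* Let $D\subset\mathbb R^d$ be a bounded open set (not necessarily connected) and let $c:D\to[0,\infty)$ be bounded and Borel measurable. If $u$ is a subsolution of $(-A+c)f=0$ on $D$, then $$\sup_{x\in D}u(x)\le\sup_{y\in(\mathcal S(D)\setminus D)\cup\partial D}u^+(y).$$ Moreover, if $c\equiv0$, then $u^+$ on the right-hand side can be replaced by $u$.
   Context: **Operator.** $Au=Lu+Su$, where $$Lu(x)=\tfrac12\sum_{i,j=1}^d q_{i,j}(x)\partial^2_{x_i,x_j}u(x)+\sum_{i=1}^d b_i(x)\partial_{x_i}u(x),$$ $$Su(x)=\int_{\mathbb R^d}\Big(u(x+y)-u(x)-\sum_{i=1}^d\frac{y_i\partial_{x_i}u(x)}{1+|y|^2}\Big)N(x,dy).$$ Standing assumptions: $q_{i,j},b_i:\mathbb R^d\to\mathbb R$ are bounded and Borel measurable; for every compact $K\subset\mathbb R^d$ there is $\gamma_K>0$ with $\gamma_K|\xi|^2\le\sum_{i,j}q_{i,j}(x)\xi_i\xi_j$ for $x\in K$, $\xi\in\mathbb R^d$; for each $x$, $N(x,\cdot)$ is a $\sigma$-finite Borel measure on $\mathbb R^d$, $x\mapsto N(x,B)$ is Borel for each Borel $B$, and $\sup_x\int\min\{1,|y|^2\}N(x,dy)<\infty$. For $D$ open and $u\in W^{2,p}_{\rm loc}(D)\cap C_b(\mathbb R^d)$ with $p>d$, $Au$ is defined a.e. in $D$ by these formulas. **Subsolution.** $u:\mathbb R^d\to\mathbb R$ is a subsolution of $(-A+c)f=0$ on $D$ if $u\in W^{2,p}_{\rm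 loc}(D)\cap C_b(\mathbb R^d)$ for some $p>d$ and $-Au(x)+c(x)u(x)\le0$ for a.e. $x\in D$. **Notation.** $\mathcal S(D)=\bigcup_{x\in D}\{x+y:\,y\in\operatorname{supp}N(x,\cdot)\}$; $u^+=\max(u,0)$. *)

(* Defs.v *)
From HB Require Import structures.
From mathcomp Require Import all_boot all_order all_algebra.
From mathcomp Require Import all_classical all_reals all_analysis.

Set Implicit Arguments.
Unset Strict Implicit.
Unset Printing Implicit Defensive.

Import Order.TTheory GRing.Theory Num.Theory.
Import numFieldNormedType.Exports.

Local Open Scope classical_set_scope.
Local Open Scope ring_scope.

Definition borel_mx_display : measure_display.
Proof. exact. Qed.

Section borel_mx.
Context (R : realType) (m n : nat).

Let borel_mx : set (set 'M[R]_(m, n)) := <<s [set A | open A] >>.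

Let borel_mx0 : borel_mx set0.
Proof. exact: sigma_algebra0. Qed.

Let borel_mxC A : borel_mx A -> borel_mx (~` A).
Proof. exact: sigma_algebraC. Qed.

Let borel_mx_bigcup (F : _^nat) :
  (forall i, borel_mx (F i)) -> borel_mx (\bigcup_i (F i)).
Proof. exact: sigma_algebra_bigcup. Qed.

HB.instance Definition _ := @isMeasurable.Build borel_mx_display
  'M[R]_(m, n) borel_mx borel_mx0 borel_mxC borel_mx_bigcup.

Lemma open_measurable_mx (A : set 'M[R]_(m, n)) : open A -> measurable A.
Proof. by move=> oA; apply: sub_sigma_algebra. Qed.

Lemma measurable_mxE :
  @measurable _ 'M[R]_(m, n) = <<s [set A : set 'M[R]_(m, n) | open A] >>.
Proof. by []. Qed.

End borel_mx.

Section rV_cons.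
Context (R : realType).

Definition rV_cons n (z : R * 'rV[R]_n) : 'rV[R]_n.+1 :=
  row_mx (z.1)%:M z.2 : 'rV_(1 + n).

Definition rV_uncons n (v : 'rV[R]_n.+1) : R * 'rV[R]_n :=
  (v ord0 ord0, \row_i v ord0 (lift ord0 i)).

Lemma rV_cons0 n (z : R * 'rV[R]_n) : rV_cons z ord0 ord0 = z.1.
Proof.
rewrite /rV_cons (_ : ord0 = lshift n (ord0 : 'I_1)); last exact/val_inj.
by rewrite (row_mxEl z.1%:M z.2) mxE.
Qed.

Lemma rV_consS n (z : R * 'rV[R]_n) i :
  rV_cons z ord0 (lift ord0 i) = z.2 ord0 i.
Proof.
rewrite /rV_cons (_ : lift ord0 i = rshift 1 i); last exact/val_inj.
by rewrite (row_mxEr z.1%:M z.2).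
Qed.

Lemma rV_consK n : cancel (@rV_cons n) (@rV_uncons n).
Proof.
move=> z; rewrite [RHS]surjective_pairing /rV_uncons rV_cons0; congr pair.
by apply/rowP => i; rewrite mxE rV_consS.
Qed.

Lemma rV_unconsK n : cancel (@rV_uncons n) (@rV_cons n).
Proof.
move=> v; apply/rowP => i; case: (unliftP ord0 i) => [j|] ->.
  by rewrite rV_consS mxE.
by rewrite rV_cons0.
Qed.

Lemma open_rV_bigcup n (O : set 'rV[R]_n) : open O ->
  O = \bigcup_(qk in [set qk : 'rV[rat]_n * nat |
        ball (map_mx ratr qk.1 : 'rV[R]_n) qk.2.+1%:R^-1 `<=` O])
      ball (map_mx ratr qk.1 : 'rV[R]_n) qk.2.+1%:R^-1.
Proof.
move=> oO; apply/seteqP; split => [x Ox|x [qk /= qkO] /qkO//].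
have /nbhs_ballP[e /= e0 eO] := open_nbhs_nbhs (conj oO Ox).
have /ltr_add_invr[k ke] : 0 < e / 2 :> R by rewrite divr_gt0.
rewrite add0r in ke.
have k0 : 0 < k.+1%:R^-1 :> R by rewrite invr_gt0.
have qP i : {q : rat | `|ratr q - x ord0 i| < k.+1%:R^-1}.
  apply: cid.
  have /rat_in_itvoo[q] : x ord0 i - k.+1%:R^-1 < x ord0 i + k.+1%:R^-1.
    by rewrite ltrD2l gtrN.
  by rewrite in_itv/= => qx; exists q; rewrite ltr_distl.
pose q : 'rV[rat]_n := \row_i sval (qP i).
have qx : ball (map_mx ratr q : 'rV[R]_n) k.+1%:R^-1 x.
  by split=> // i j; rewrite (ord1 i) /ball/= !mxE; exact: svalP (qP j).
exists (q, k) => //= y qy; apply: eO.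
apply: (@le_ball _ _ _ (k.+1%:R^-1 + k.+1%:R^-1)).
  by rewrite [leRHS]splitr; apply: lerD; exact: ltW.
by apply: ball_triangle qy; exact: ball_sym.
Qed.

Lemma ball_rV_cons n (v : 'rV[R]_n.+1) (e : R) :
  (@rV_cons n) @^-1` (ball v e) =
  ball (rV_uncons v).1 e `*` ball (rV_uncons v).2 e.
Proof.
apply/seteqP; split => [z /= [e0 vz]|z /= [v1 [e0 v2]]].
  split => /=; first by have := vz ord0 ord0; rewrite rV_cons0.
  split=> // i j; rewrite (ord1 i) mxE.
  by have := vz ord0 (lift ord0 j); rewrite rV_consS.
split => // i j; rewrite (ord1 i); case: (unliftP ord0 j) => [k|] ->.
  by rewrite rV_consS; have := v2 ord0 k; rewrite mxE.
by rewrite rV_cons0.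
Qed.

Lemma measurable_rV_cons n : measurable_fun setT (@rV_cons n).
Proof.
apply: (measurability _ (measurable_mxE R _ _)) => //.
move=> _ [U oU <-]; rewrite setTI (open_rV_bigcup oU) preimage_bigcup.
rewrite bigcup_mkcond.
apply: countable_bigcupT_measurable => [|qk]; first exact: countableP.
case: ifPn => [_|_]; last exact: measurable0.
rewrite ball_rV_cons; apply: measurableX.
  exact: measurable_realfun.measurable_ball.
by apply: open_measurable_mx; exact: ball_open.
Qed.

Lemma measurable_coord m n i j :
  measurable_fun setT (fun A : 'M[R]_(m, n) => A i j).
Proof.
apply: (measurability _ (measurable_realfun.RGenOpens.measurableE R)).
move=> _ [_ [a [b ->] <-]]; rewrite setTI; apply: open_measurable_mx.
apply: open_comp; last exact: interval_open.
by move=> v _; exact: coord_continuous.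
Qed.

Lemma measurable_rV_uncons n : measurable_fun setT (@rV_uncons n).
Proof.
apply: measurable_fun_pair; first exact: measurable_coord.
apply: (measurability _ (measurable_mxE R _ _)) => //.
move=> _ [U oU <-]; rewrite setTI; apply: open_measurable_mx.
rewrite openE => v /= Uv.
have /nbhs_ballP[e /= e0 eU] := open_nbhs_nbhs (conj oU Uv).
apply/nbhs_ballP; exists e => //= w [_ vw]; apply: eU; split => // i j.
by rewrite !mxE; exact: vw.
Qed.

End rV_cons.

Section lebesgue_cons.
Context (R : realType) (n : nat).
Variable mu : {sigma_finite_measure set 'rV[R]_n -> \bar R}.

Definition lebesgue_cons : set 'rV[R]_n.+1 -> \bar R :=
  pushforward (lebesgue_measure \x mu)%E (@rV_cons R n).

Let mcons := @measurable_rV_cons R n.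

Let lebesgue_cons0 : lebesgue_cons set0 = 0%E.
Proof. exact: measure0. Qed.

Let lebesgue_cons_ge0 A : (0 <= lebesgue_cons A)%E.
Proof. exact: measure_ge0. Qed.

Let lebesgue_cons_sigma_additive : semi_sigma_additive lebesgue_cons.
Proof. exact: measure_semi_sigma_additive. Qed.

HB.instance Definition _ := isMeasure.Build _ _ _ lebesgue_cons
  lebesgue_cons0 lebesgue_cons_ge0 lebesgue_cons_sigma_additive.

Let sigma_finite_lebesgue_cons : sigma_finite setT lebesgue_cons.
Proof.
have /sigma_finiteP[F [TF ndF Foo]] := sigma_finiteT (@lebesgue_measure R).
have /sigma_finiteP[G [TG ndG Goo]] := sigma_finiteT mu.
exists (fun i => (@rV_uncons R n) @^-1` (F i `*` G i)).
  rewrite -preimage_bigcup (_ : \bigcup_i _ = setT) ?preimage_setT//.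
  apply/seteqP; split => // -[x y] _.
  have [i _ Fx] : (\bigcup_i F i) x by rewrite -TF.
  have [j _ Gy] : (\bigcup_i G i) y by rewrite -TG.
  exists (maxn i j) => //; split.
    by move: Fx; exact/subsetPset/ndF/leq_maxl.
  by move: Gy; exact/subsetPset/ndG/leq_maxr.
move=> i; have [mFi Fioo] := Foo i; have [mGi Gioo] := Goo i; split.
  rewrite -[X in measurable X]setTI.
  by apply: measurable_rV_uncons => //; exact: measurableX.
rewrite /lebesgue_cons /pushforward -comp_preimage.
rewrite (_ : _ \o _ = id) ?preimage_id; last exact/funext/rV_consK.
by rewrite product_measure1E// lte_mul_pinfty// ge0_fin_numE.
Qed.

HB.instance Definition _ := Measure_isSigmaFinite.Build _ _ _ lebesgue_cons
  sigma_finite_lebesgue_cons.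

End lebesgue_cons.

(* Lebesgue measure on R^n, as an iterated product; see lebesgue_rV_box *)
Fixpoint lebesgue_rV (R : realType) (n : nat) :
    {sigma_finite_measure set 'rV[R]_n -> \bar R} :=
  match n with
  | 0 => \d_(0 : 'rV[R]_0)
  | n'.+1 => lebesgue_cons (lebesgue_rV R n')
  end.


Lemma lebesgue_rV_box (R : realType) (n : nat) (A : 'I_n -> set R) :
  (forall i, measurable (A i)) ->
  lebesgue_rV R n [set v | forall i, A i (v ord0 i)] =
  (\prod_(i < n) lebesgue_measure (A i))%E.
Proof.
elim: n A => [|n ih] A mA.
  rewrite big_ord0 /= diracE (_ : _ \in _ = true)//.
  by apply/mem_set => -[].
rewrite big_ord_recl -ih//.
pose C := [set v : 'rV[R]_n | forall i, A (lift ord0 i) (v ord0 i)].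
have mC : measurable C.
  rewrite (_ : C = \bigcap_i (fun v : 'rV[R]_n => v ord0 i) @^-1`
      A (lift ord0 i)); last by apply/seteqP; split => v Cv i; [move=> _|];
      exact: Cv.
  rewrite -[X in measurable X]setCK setC_bigcap; apply: measurableC.
  apply: countable_bigcupT_measurable => [|i]; first exact: countableP.
  apply: measurableC; rewrite -[X in measurable X]setTI.
  by apply: measurable_coord.
have consC : (@rV_cons R n) @^-1` [set v | forall i, A i (v ord0 i)] =
    A ord0 `*` C.
  apply/seteqP; split => [[a v] /= Aav|[a v] /= [Aa Av] i].
    split => [|i]; first by have := Aav ord0; rewrite rV_cons0.
    by have := Aav (lift ord0 i); rewrite rV_consS.
  by case: (unliftP ord0 i) => [j|] ->; rewrite ?rV_consS ?rV_cons0.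
rewrite [LHS]/= /lebesgue_cons /pushforward consC.
by rewrite product_measure1E /C; [| exact: mA | exact: mC].
Qed.

Section differential_operators.
Context (R : realType) (d : nat).
Implicit Types (D : set 'rV[R]_d) (u f g phi : 'rV[R]_d -> R) (p : R).

(* The squared Euclidean norm: the norm `|y| of 'rV[R]_d is the sup norm *)
Definition sqnorm (y : 'rV[R]_d) : R := \sum_(i < d) y ord0 i ^+ 2.

Definition partial (i : 'I_d) f : 'rV[R]_d -> R := 'D_(delta_mx ord0 i) f.

Definition partials (s : seq 'I_d) f : 'rV[R]_d -> R := foldr partial f s.

(* All iterated partial derivatives exist and are continuous *)
Definition smooth f := forall s : seq 'I_d,
  continuous (partials s f) /\
  forall i x, derivable (partials s f) x (delta_mx ord0 i).

(* The functions of class C^oo with compact support in D *)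
Definition test_function D phi :=
  [/\ smooth phi,
      compact (closure [set x | phi x != 0]) &
      closure [set x | phi x != 0] `<=` D].

Definition weak_partials D (s : seq 'I_d) f g :=
  forall phi, test_function D phi ->
    \int[lebesgue_rV R d]_(x in D) (f x * partials s phi x) =
    (-1) ^+ size s * \int[lebesgue_rV R d]_(x in D) (g x * phi x).

Definition Lp_loc D p f := forall K, compact K -> K `<=` D ->
  (f \* \1_K) \in Lfun (lebesgue_rV R d) p%:E.

(* [u] is in W^{2,p}_loc(D), with weak gradient [Du] and Hessian [D2u]; these
   are determined by [u] up to a null subset of [D] *)
Definition W2p_loc D p u (Du : 'I_d -> 'rV[R]_d -> R)
    (D2u : 'I_d -> 'I_d -> 'rV[R]_d -> R) :=
  [/\ Lp_loc D p u,
      forall i, Lp_loc D p (Du i) /\ weak_partials D [:: i] u (Du i) &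
      forall i j, Lp_loc D p (D2u i j) /\
                  weak_partials D [:: i; j] u (D2u i j)].

Variables (q : 'I_d -> 'I_d -> 'rV[R]_d -> R) (b : 'I_d -> 'rV[R]_d -> R).
Variable N : R.-ker 'rV[R]_d ~> 'rV[R]_d.

Definition local_operator (Du : 'I_d -> 'rV[R]_d -> R)
    (D2u : 'I_d -> 'I_d -> 'rV[R]_d -> R) (x : 'rV[R]_d) : R :=
  2^-1 * (\sum_(i < d) \sum_(j < d) q i j x * D2u i j x) +
  \sum_(i < d) b i x * Du i x.

Definition jump_operator u (Du : 'I_d -> 'rV[R]_d -> R) (x : 'rV[R]_d) :
    \bar R :=
  (\int[N x]_y (u (x + y) - u x -
     \sum_(i < d) (y ord0 i * Du i x) / (1 + sqnorm y))%:E)%E.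

(* For [u] bounded and in W^{2,p}_loc(D) with p > d, the integrand is
   [N x]-integrable for a.e. x in D, so that no convention on divergent
   integrals is involved in [subsolution] below *)
Definition levy_operator u Du D2u x : \bar R :=
  ((local_operator Du D2u x)%:E + jump_operator u Du x)%E.

Definition subsolution D (c u : 'rV[R]_d -> R) :=
  [/\ continuous u, bounded_fun u &
      exists p Du D2u, [/\ d%:R < p, W2p_loc D p u Du D2u &
        {ae lebesgue_rV R d, forall x, D x ->
          (- levy_operator u Du D2u x + (c x * u x)%:E <= 0)%E}]].

Definition locally_elliptic :=
  forall K : set 'rV[R]_d, compact K ->
    exists2 gamma : R, 0 < gamma &
      forall x xi : 'rV[R]_d, K x ->
        gamma * sqnorm xi <=
        \sum_(i < d) \sum_(j < d) q i j x * xi ord0 i * xi ord0 j.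

Definition measure_support (m : set 'rV[R]_d -> \bar R) : set 'rV[R]_d :=
  [set y | forall U, open U -> U y -> (0 < m U)%E].

Definition jump_range D : set 'rV[R]_d :=
  \bigcup_(x in D) [set x + y | y in measure_support (N x)].

End differential_operators.

(* Main.v *)
Require Import Defs.
From HB Require Import structures.
From mathcomp Require Import all_boot all_order all_algebra.
From mathcomp Require Import all_classical all_reals all_analysis.
From mathcomp Require Import measurable_realfun.
From mathcomp Require Import ring lra.

Set Implicit Arguments.
Unset Strict Implicit.
Unset Printing Implicit Defensive.

Import Order.TTheory GRing.Theory Num.Theory.
Import numFieldNormedType.Exports.

Local Open Scope classical_set_scope.
Local Open Scope ring_scope.

(** The right-hand side bounds [u] on [D] because, at a point where [u] is larger,
one could bend [u] slightly upwards into a function that has a maximum inside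
[D], and at a maximum the operator is too negative for a subsolution.  As [u]
only has second derivatives almost everywhere, one maximum point is not
enough; Bony's maximum principle provides one outside any given null set.  It
is proved here by the contact set method of Alexandrov, Bakelman and Pucci.

Let [u <= m] on the exterior set and [u x0 = m + g] with [g > 0] for some [x0]
in [D].  Add to [u] a small barrier [w = eps * exp (lam * x_1)].  Then
[v = u + w] exceeds [m + g / 2] only in a compact part [K] of [D].

For the mollification [v_h] of [v] (where only [u] is mollified), every affine
function with slope in the cube of radius [eta], lowered from above, touches
the graph over [closure D] first at a point of [K] ([contact_onto]): the
gradient of [v_h] maps the contact set onto that cube.  Hence [(2 * eta) ^ d]
is at most a constant times the integral of the [d]-th power of the Hessian
over the contact set ([area_bound]).  Since [u] lies in W^(2,p) with [p > d],
these Hessians are mollifications of functions in L^d, so that the [d]-th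
powers are equi-integrable, and the measures of the contact sets stay above
some [kappa > 0] as [h] tends to zero ([mollify_sum_measure_lower]).

Mollifications of an integrable function converge to it in mean
([osc_vanishes_integrable]), thus to any given accuracy outside sets of measure
at most [kappa / 2].  Infinitely many contact sets therefore share a point of [K],
outside any prescribed null set, at which the derivatives converge
([contact_point]): there [v] lies below its tangent plane over [closure D],
its slope is at most [eta] and its second derivatives form a nonpositive
symmetric matrix.

At such a point ellipticity makes the second-order part at most
[- gamma * lam ^ 2 / 2 * w], up to the drift ([local_operator_le], by
[mdot_le0]).  A jump that lands in [D] is controlled by the tangent plane
([jump_inside_le]); one that leaves [D] lands in the exterior set, where [u]
is smaller by [g / 4], which pays for the compensator ([jump_outside_le]).
Drift and jumps thus cost a multiple of [(1 + lam) * w] plus a multiple of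
[eta].  For [lam] large and then [eta] small the operator is negative, whereas
for a subsolution it is at least [c * u >= 0]: this is
[maximum_principle_level].  The theorem takes for [m] the supremum on the
right-hand side; it is not [-oo], as [D] has boundary points
([boundary_nonempty]). *)

(** * A one-dimensional mollifier *)
Section ebump.
Context (R : realType).
Implicit Types (h t : R) (pk : {poly R} * nat).

(** For [pk = (P, k)] and [W = h^2 - t^2] this is [P t * W^-k * exp (- 1 / W)],
extended by zero: a class of functions that is stable under differentiation,
so that one computation yields all derivatives of the standard bump. *)
Definition ebump h pk t : R :=
  if `|t| < h then
    pk.1.[t] * (h ^+ 2 - t ^+ 2) ^- pk.2 * expR (- (h ^+ 2 - t ^+ 2)^-1)
  else 0.

(** Numerator and exponent of the derivative of [P * W^-k * exp (- 1 / W)], over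
the common denominator [W^(k + 2)]. *)
Definition bump_next h pk : {poly R} * nat :=
  let W := (h ^+ 2)%:P - 'X ^+ 2 in
  (pk.1^`() * W ^+ 2 + (2 * pk.2%:R) *: ('X * pk.1 * W) - 2 *: ('X * pk.1),
   pk.2.+2).

(** [1 + y <= exp y] at [y = 1 / ((n + 1) s)], raised to the power [n + 1]. *)
Lemma expRNV_le (n : nat) (s : R) : 0 < s ->
  expR (- s^-1) <= (n.+1%:R * s) ^+ n.+1.
Proof.
move=> s0; have ns : 0 < n.+1%:R * s by rewrite mulr_gt0.
rewrite expRN invf_ple ?posrE ?expR_gt0 ?exprn_gt0// -exprVn.
have -> : s^-1 = n.+1%:R * (n.+1%:R * s)^-1.
  by rewrite invfM mulrA mulfV ?mul1r// pnatr_eq0.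
rewrite expRM_natl lerXn2r ?nnegrE ?expR_ge0 ?invr_ge0 ?(ltW ns)//.
by rewrite (le_trans _ (expR_ge1Dx _))// lerDr.
Qed.

Lemma sqr_lt_abs h t : `|t| < h -> 0 < h ^+ 2 - t ^+ 2.
Proof.
move=> th; rewrite subr_gt0 -(real_normK (num_real t)).
by rewrite ltrXn2r// nnegrE (ltW (le_lt_trans _ th)).
Qed.

(** Vanishing to second order at the edge [|t| = h], whatever the negative power
of [h^2 - t^2] in front of the exponential; this is what makes the derivative
there equal to zero. *)
Lemma bump_bound h pk : exists2 C, 0 <= C &
  forall t, `|ebump h pk t| <= C * `|h ^+ 2 - t ^+ 2| ^+ 2.
Proof.
case: pk => P k.
have [h0|h0] := leP h 0.
  exists 0 => // t; rewrite /ebump ltNge (le_trans h0)//= normr0.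
  by rewrite mul0r.
have hh : - h <= h by rewrite ge0_cp// ltW.
have cP : {within `[- h, h], continuous (fun t => `|P.[t]|)}.
  apply: continuous_subspaceT => t; apply: continuous_comp.
    exact: continuous_horner.
  exact: norm_continuous.
have [c _ cmax] := EVT_max hh cP.
pose n : R := k.+2%:R ^+ k.+2.
exists (`|P.[c]| * n) => [|t].
  by rewrite mulr_ge0// exprn_ge0.
rewrite /ebump /=; case: ifPn => th; last first.
  rewrite normr0; apply: mulr_ge0; last exact: exprn_ge0.
  by rewrite mulr_ge0// exprn_ge0.
have W0 := sqr_lt_abs th; set W := h ^+ 2 - t ^+ 2 in W0 *.
rewrite !normrM normrV ?unitfE ?gt_eqF ?exprn_gt0// normrX.
rewrite !(ger0_norm (ltW W0)) (ger0_norm (expR_ge0 _)) -mulrA -[leRHS]mulrA.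
apply: ler_pM => //.
- by rewrite mulr_ge0 ?expR_ge0// invr_ge0 exprn_ge0// ltW.
- by apply: (cmax t); rewrite in_itv/= -ler_norml; exact: ltW.
rewrite mulrC ler_pdivrMr ?exprn_gt0// (le_trans (expRNV_le k.+1 W0))// exprMn -/n.
rewrite -[leRHS]mulrA -exprD; apply: ler_wpM2l => //.
exact: exprn_ge0.
Qed.

Lemma bump_out h pk t : h <= `|t| -> ebump h pk t = 0.
Proof. by rewrite /ebump ltNge => ->. Qed.

Lemma is_derive_bump h pk t :
  is_derive t 1 (ebump h pk) (ebump h (bump_next h pk) t).
Proof.
have [th|th|th] := ltgtP `|t| h.
- case: pk => P k.
  have W0 := sqr_lt_abs th.
  pose W (s : R) := h ^+ 2 - s ^+ 2.
  have dW : is_derive t 1 W (- (2 * t)).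
    have := is_deriveB (is_derive_cst (h ^+ 2) t 1) (is_deriveX 2 (is_derive_id t 1)).
    by move/is_derive_eq; apply; rewrite /= sub0r expr1 /GRing.scale/= mulr1.
  have W0' : W t != 0 by rewrite gt_eqF.
  have dV := is_deriveV W0' dW.
  have dVk := is_deriveX k dV.
  have dE := @is_derive1_comp _ expR (- (fun y => (W y)^-1)) t _ _
    (is_derive_expR _) (is_deriveN dV).
  rewrite [ebump h (bump_next _ _) t]/ebump th/=.
  apply: (@near_eq_is_derive _ _ _
    (horner P * (fun y => (W y)^-1) ^+ k * (expR \o - (fun y => (W y)^-1)))).
    near=> s; rewrite /ebump/= ifT; last first.
      near: s; apply: (cvgr_lt `|t|) => //.
      by apply: cvg_norm; exact: cvg_id.
    by rewrite !fctE exprVn.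
  have dP := @is_derive_poly _ P t.
  apply: (is_derive_eq (is_deriveM (is_deriveM dP dVk) dE)).
  rewrite /= !fctE /= /GRing.scale/= !hornerE /= -/(W t).
  case: k {dVk} => [|k].
    rewrite !expr0 /=; field.
    exact: W0'.
  rewrite -!pred_Sn -!exprVn !exprS.
  move: (expR _) ((W t)^-1 ^+ k) => E V.
  by field.
- rewrite [ebump h (bump_next _ _) t]bump_out ?(ltW th)//.
  apply: (@near_eq_is_derive _ _ _ (cst 0)).
  near=> s; rewrite /= bump_out// ltW//.
  near: s; apply: (cvgr_gt `|t|) => //.
  by apply: cvg_norm; exact: cvg_id.
(* At the edge the difference quotient is of order [s], by [bump_bound]. *)
- rewrite [ebump h (bump_next _ _) t]bump_out ?th//.
  have [C C0 bC] := bump_bound h pk.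
  suff H : (fun s => s^-1 *: ((ebump h pk \o shift t) (s *: 1) - ebump h pk t))
      @ 0^' --> (0 : R).
    by apply: DeriveDef; [exact: cvgP H|exact/cvg_lim].
  rewrite [ebump h pk t]bump_out ?th//.
  pose B := C * (h *+ 2 + 1) ^+ 2.
  have B0 : 0 <= B by rewrite mulr_ge0// sqr_ge0.
  apply/cvgrPdist_le => e e0; near=> s.
  rewrite sub0r normrN subr0 /= /GRing.scale/= mulr1 normrM normfV.
  have s0 : s != 0 by near: s; exact: nbhs_dnbhs_neq.
  rewrite mulrC ler_pdivrMr ?normr_gt0// (le_trans (bC _))//.
  have -> : h ^+ 2 - (s + t) ^+ 2 = - (s * (s + t *+ 2)).
    by rewrite -th real_normK ?num_real//; ring.
  rewrite normrN normrM exprMn mulrCA expr2 -mulrA (mulrC e).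
  rewrite ler_wpM2l// (@le_trans _ _ (`|s| * B))//.
    rewrite /B ler_wpM2l// ler_wpM2l// lerXn2r ?nnegrE//.
      by rewrite addr_ge0// mulrn_wge0// -th.
    rewrite addrC (le_trans (ler_normD _ _))// lerD//.
      by rewrite normrMn th.
    near: s; apply: dnbhs0_le; exact: ltr01.
  rewrite (@le_trans _ _ (`|s| * (B + 1)))// ?ler_wpM2l// ?lerDl//.
  rewrite -ler_pdivlMr ?ltr_wpDl//.
  near: s; apply: dnbhs0_le; rewrite divr_gt0// ltr_wpDl//.
Unshelve. all: by end_near. Qed.

Lemma continuous_bump h pk : continuous (ebump h pk).
Proof.
move=> t; apply/differentiable_continuous/derivable1_diffP.
by have [] := is_derive_bump h pk t.
Qed.

Lemma bump_le h pk : exists2 C, 0 <= C & forall t, `|ebump h pk t| <= C.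
Proof.
have [C C0 bC] := bump_bound h pk.
exists (C * (h ^+ 2) ^+ 2) => [|t]; first by rewrite mulr_ge0// exprn_ge0// sqr_ge0.
have [ht|th] := leP h `|t|.
  by rewrite bump_out// normr0 mulr_ge0// exprn_ge0// sqr_ge0.
rewrite (le_trans (bC t))// ler_wpM2l// lerXn2r// ?nnegrE ?sqr_ge0//.
by rewrite ger0_norm ?gerBl ?sqr_ge0// ltW// sqr_lt_abs.
Qed.

Local Notation bump0 h := (ebump h (1, 0%N)).

Lemma bump0E h t : bump0 h t =
  if `|t| < h then expR (- (h ^+ 2 - t ^+ 2)^-1) else 0.
Proof. by rewrite /ebump/= hornerC expr0 invr1 !mul1r. Qed.

Lemma bump0_ge0 h t : 0 <= bump0 h t.
Proof. by rewrite bump0E; case: ifP => // _; exact: expR_ge0. Qed.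

Lemma measurable_bump h pk : measurable_fun setT (ebump h pk).
Proof. apply: continuous_measurable_fun; exact: continuous_bump. Qed.

Lemma integral_bump0 h : 0 < h -> exists2 z, 0 < z &
  (\int[lebesgue_measure]_t (bump0 h t)%:E = z%:E)%E.
Proof.
move=> h0; pose I : \bar R := (\int[lebesgue_measure]_t (bump0 h t)%:E)%E.
have mb : measurable_fun setT (fun t : R => (bump0 h t)%:E).
  by apply/measurable_EFinP; exact: measurable_bump.
have I0 : (0 < I)%E.
  pose e := expR (- (3 / 4 * h ^+ 2)^-1) : R.
  apply: (@lt_le_trans _ _ (\int[lebesgue_measure]_(t in `[0%R, (h / 2)%R]) (cst e%:E) t)%E).
    rewrite integral_cst//= lebesgue_measure_itv/= lte_fin divr_gt0//.
    by rewrite sube0 mule_gt0 ?lte_fin ?expR_gt0 ?divr_gt0.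
  apply: (@le_trans _ _ (\int[lebesgue_measure]_(t in `[0%R, (h / 2)%R]) (bump0 h t)%:E)%E).
    apply: ge0_le_integral => //=.
    - by move=> t _; rewrite lee_fin expR_ge0.
    - exact: measurable_funTS.
    move=> t; rewrite in_itv/= => /andP[t0 th].
    have th' : `|t| < h.
      by rewrite ger0_norm// (le_lt_trans th)// ltr_pdivrMr// mulr_natr mulr2n ltrDl.
    rewrite lee_fin bump0E th' ler_expR lerN2 lef_pV2 ?posrE ?sqr_lt_abs//.
      rewrite lerBrDl -lerBrDr (_ : _ - _ = (h / 2) ^+ 2); last by field.
      by rewrite lerXn2r// nnegrE ?divr_ge0// ltW.
    by rewrite mulr_gt0// exprn_gt0.
  apply: ge0_subset_integral => //.
  by move=> t _; rewrite lee_fin bump0_ge0.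
have Ioo : (I < +oo)%E.
  have [C C0 bC] := bump_le h (1, 0%N).
  apply: (@le_lt_trans _ _ (\int[lebesgue_measure]_(t in `[(- h)%R, h]) (cst C%:E) t)%E); last first.
    rewrite integral_cst//= lebesgue_measure_itv/=; case: ifP => _.
      by rewrite -EFinB -EFinM ltry.
    by rewrite mule0 ltry.
  rewrite /I integral_mkcond/=.
  rewrite [leRHS]integral_mkcond/=; apply: ge0_le_integral => //.
  - by move=> t _; rewrite patchE in_setT lee_fin bump0_ge0.
  - by rewrite patch_setT.
  - by apply/(measurable_restrictT _ _).1 => //; exact: measurable_cst.
  move=> t _; rewrite !patchE in_setT; case: ifPn.
    by rewrite lee_fin => _; exact: le_trans (ler_norm _) (bC t).
  rewrite notin_setE/= in_itv/= -ler_norml => /negP; rewrite -ltNge => /ltW ht.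
  by rewrite bump_out.
exists (fine I).
  by rewrite fine_gt0// I0.
by rewrite fineK// ge0_fin_numE// ltW.
Qed.

End ebump.

Section theta.
Context (R : realType).
Implicit Types (h t : R) (n : nat).

(** The [n]-th derivative of the bump normalised to have integral one. *)
Definition theta h n t : R :=
  (fine (\int[lebesgue_measure]_s (ebump h (1, 0%N) s)%:E)%E)^-1 *
  ebump h (iter n (bump_next h) (1, 0%N)) t.

Lemma is_derive_theta h n t : is_derive t 1 (theta h n) (theta h n.+1 t).
Proof.
rewrite {2}/theta iterS.
exact: is_deriveZ (is_derive_bump h (iter n (bump_next h) (1, 0%N)) t).
Qed.

Lemma continuous_theta h n : continuous (theta h n).
Proof.
move=> t; apply/differentiable_continuous/derivable1_diffP.
by have [] := is_derive_theta h n t.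
Qed.

Lemma theta_out h n t : h <= `|t| -> theta h n t = 0.
Proof. by move=> ht; rewrite /theta bump_out// mulr0. Qed.

Lemma theta0_ge0 h t : 0 <= theta h 0 t.
Proof.
rewrite mulr_ge0 ?bump0_ge0// invr_ge0 fine_ge0// integral_ge0// => s _.
by rewrite lee_fin bump0_ge0.
Qed.

Lemma theta0N h t : theta h 0 (- t) = theta h 0 t.
Proof. by rewrite /theta/= !bump0E normrN sqrrN. Qed.

Lemma theta_le h n : exists2 C, 0 <= C & forall t, `|theta h n t| <= C.
Proof.
have [C C0 bC] := bump_le h (iter n (bump_next h) (1, 0%N)).
rewrite /theta; set z := (X in X^-1).
exists (`|z^-1| * C) => [|t]; first exact: mulr_ge0.
by rewrite normrM ler_wpM2l.
Qed.

(** The image of Lebesgue measure under a translation agrees with it on intervals. *)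
Lemma ge0_integral_shift (f : R -> \bar R) a : measurable_fun setT f ->
  (forall t, 0 <= f t)%E ->
  (\int[lebesgue_measure]_t f (t - a)%R = \int[lebesgue_measure]_t f t)%E.
Proof.
move=> mf f0.
pose phi (t : measurableTypeR R) : measurableTypeR R := t - a.
have ms : measurable_fun setT phi by exact: measurable_funB.
pose P := measure_function_pushforward__canonical__measure_function_Measure
  (@lebesgue_measure R) ms.
rewrite -[LHS](@ge0_integral_pushforward _ _ _ _ R _ ms lebesgue_measure setT f
   measurableT mf (fun y _ => f0 y)).
apply: (@eq_measure_integral _ _ _ _ (@lebesgue_measure R) P) => A mA _.
apply/esym/lebesgue_measure_unique => //= _ [[x y] /= _ <-].
rewrite /P/= /pushforward.
rewrite (_ : phi @^-1` _ = `]x + a, y + a]%classic); last first.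
  by apply/seteqP; split => t; rewrite /phi/= !in_itv/= ltrBrDr lerBlDr.
rewrite !lebesgue_measure_itv/= !lte_fin ltrD2r.
by case: ifP => // _; rewrite -!EFinB; congr EFin; ring.
Qed.

Lemma integral_theta h a : 0 < h ->
  (\int[lebesgue_measure]_t (theta h 0 (t - a))%:E = 1)%E.
Proof.
move=> h0.
rewrite (@ge0_integral_shift (EFin \o theta h 0)); last 2 first.
- apply/measurable_EFinP; apply: continuous_measurable_fun.
  exact: continuous_theta.
- by move=> t; rewrite /= lee_fin theta0_ge0.
have [z z0 Iz] := integral_bump0 h0.
under eq_integral do rewrite /= /theta /= Iz /= EFinM.
rewrite ge0_integralZl//.
- by rewrite Iz -EFinM mulVf// gt_eqF.
- by apply/measurable_EFinP; exact: measurable_bump.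
- by move=> t _; rewrite lee_fin bump0_ge0.
- by rewrite lee_fin invr_ge0 ltW.
Qed.

End theta.

(** * The product mollifier on row vectors *)
Section rV_facts.
Context (R : realType) (d : nat).
Implicit Types (x y z xi : 'rV[R]_d).

Lemma coord_le_norm y i : `|y ord0 i| <= `|y|.
Proof.
rewrite [leRHS]/Num.norm/= mx_normrE.
by apply/bigmax_geP; right => /=; exists (ord0, i).
Qed.

Lemma rV_norm_le y (a : R) : 0 <= a -> (forall i, `|y ord0 i| <= a) -> `|y| <= a.
Proof.
move=> a0 ya; rewrite [leLHS]/Num.norm/= mx_normrE.
by apply/bigmax_leP; split => //= -[i j] _ /=; rewrite (ord1 i).
Qed.

Lemma continuous_coord_rV i : continuous (fun y : 'rV[R]_d => y ord0 i).
Proof. by move=> y; exact: coord_continuous. Qed.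

Lemma continuous_rV_subr x : continuous (fun z : 'rV[R]_d => z - x).
Proof. by move=> z; apply: (@cvgB _ _ _ (nbhs z) _ id (cst x)); [exact: cvg_id|exact: cvg_cst]. Qed.

End rV_facts.

Section is_derive_prod.
Context (R : realType).

Lemma is_derive_prod n (f : 'I_n -> R -> R) (df : 'I_n -> R) (t : R) :
  (forall i, is_derive t 1 (f i) (df i)) ->
  is_derive t 1 (fun s => \prod_i f i s)
    (\sum_j \prod_i (if i == j then df i else f i t)).
Proof.
elim: n f df => [|n ih] f df fdf.
  rewrite big_ord0; under eq_fun do rewrite big_ord0.
  exact: is_derive_cst.
rewrite big_ord_recl; under eq_fun do rewrite big_ord_recl.
have := is_deriveM (fdf ord0) (ih _ _ (fun i => fdf (lift ord0 i))).
move/is_derive_eq; apply; rewrite addrC; congr +%R.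
  rewrite /GRing.scale/= big_ord_recl eqxx mulrC; congr (_ * _).
rewrite scaler_sumr; apply: eq_bigr => j _.
rewrite big_ord_recl/= /GRing.scale/=; congr (_ * _).
Qed.

(** All differentiation of functions of several variables below is along lines;
this brings it back to directional derivatives. *)
Lemma is_derive_along (V : normedModType R) (f : V -> R) x v (df : R) :
  is_derive (0 : R) (1 : R) (fun t : R => f (x + t *: v)) df -> is_derive x v f df.
Proof.
move=> [dg gE].
have H : (fun h => h^-1 *: (((fun t : R => f (x + t *: v)) \o shift 0) (h *: 1)
   - f (x + 0 *: v))) = (fun h => h^-1 *: ((f \o shift x) (h *: v) - f x)).
  apply/funext => h /=.
  by rewrite scale0r !addr0 [h%:A]mulr1 [x + _]addrC.
by apply: DeriveDef; [rewrite /derivable -H|rewrite /derive -H].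
Qed.

End is_derive_prod.

Section mbump.
Context (R : realType) (d : nat).
Implicit Types (h : R) (m : 'I_d -> nat) (x y z xi : 'rV[R]_d).

(** The mixed partial derivative of order [m i] in the coordinate [i] of the
product of one-dimensional mollifiers. *)
Definition mbump h m y : R := \prod_i theta h (m i) (y ord0 i).

Definition mincr m (j : 'I_d) : 'I_d -> nat := fun i => (m i + (i == j))%N.

Lemma is_derive_mbump h m x xi (t : R) :
  is_derive t 1 (fun s => mbump h m (x + s *: xi))
    (\sum_j xi ord0 j * mbump h (mincr m j) (x + t *: xi)).
Proof.
have H i : is_derive t 1 (fun s => theta h (m i) ((x + s *: xi) ord0 i))
   (xi ord0 i * theta h (m i).+1 ((x + t *: xi) ord0 i)).
  pose g : R -> R := cst (x ord0 i) + xi ord0 i *: id.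
  have gE s : g s = (x + s *: xi) ord0 i.
    by rewrite !mxE /g !fctE/= [_ *: s]mulrC.
  have Dg : is_derive t 1 g (xi ord0 i).
    apply: is_derive_eq (is_deriveD (is_derive_cst _ t 1)
      (is_deriveZ (xi ord0 i) (is_derive_id t 1))) _.
    by rewrite add0r [LHS]mulr1.
  have := is_derive1_comp (is_derive_theta h (m i) (g t)) Dg.
  rewrite (_ : _ \o g = (fun s => theta h (m i) ((x + s *: xi) ord0 i))).
    by move=> /is_derive_eq; apply; rewrite mulrC gE.
  by apply/funext => s /=; rewrite gE.
apply: is_derive_eq (is_derive_prod H) _.
apply: eq_bigr => j _; rewrite /mbump (bigD1 j)//= eqxx [in RHS](bigD1 j)//=.
rewrite /mincr eqxx addn1 -[LHS]mulrA; congr (_ * (_ * _)).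
by apply: eq_bigr => i /negbTE ->; rewrite addn0.
Qed.

Lemma continuous_mbump h m : continuous (mbump h m).
Proof.
apply: continuous_big => [|i _]; first exact: mul_continuous.
by move=> y; apply: continuous_comp; [exact: coord_continuous|exact: continuous_theta].
Qed.

Lemma mbump_out h m y i : h <= `|y ord0 i| -> mbump h m y = 0.
Proof. by move=> hy; rewrite /mbump (bigD1 i)//= theta_out// mul0r. Qed.

Lemma mbump_out_norm h m y : 0 < h -> h <= `|y| -> mbump h m y = 0.
Proof.
move=> h0 hy; have [[i yi]|ny] := pselect (exists i, h <= `|y ord0 i|).
  exact: mbump_out yi.
have yh i : `|y ord0 i| < h by rewrite ltNge; apply/negP => ?; apply: ny; exists i.
exfalso; move: hy; apply/negP; rewrite -ltNge.
rewrite [ltLHS]/Num.norm/= mx_normrE.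
by apply/bigmax_ltP; split => //= -[i j] _ /=; rewrite (ord1 i).
Qed.

Lemma mbump0_ge0 h y : 0 <= mbump h (fun=> 0%N) y.
Proof. by apply: prodr_ge0 => i _; exact: theta0_ge0. Qed.

Lemma mbump0N h y : mbump h (fun=> 0%N) (- y) = mbump h (fun=> 0%N) y.
Proof. by apply: eq_bigr => i _; rewrite mxE theta0N. Qed.

Lemma mbump_le h m : exists2 C, 0 <= C & forall y, `|mbump h m y| <= C.
Proof.
have /choice[C CP] : forall i, exists C, 0 <= C /\ forall t, `|theta h (m i) t| <= C.
  by move=> i; have [C C0 bC] := theta_le h (m i); exists C.
exists (\prod_i C i) => [|y]; first by apply: prodr_ge0 => i _; have [] := CP i.
rewrite /mbump normr_prod; apply: ler_prod => i _.
by rewrite normr_ge0 (CP i).2.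
Qed.

Lemma partial_mbump h m x i :
  partial i (fun z => mbump h m (z - x)) = (fun z => mbump h (mincr m i) (z - x)).
Proof.
apply/funext => z; rewrite /partial.
suff H : is_derive z (delta_mx ord0 i) (fun z => mbump h m (z - x))
    (mbump h (mincr m i) (z - x)) by exact: derive_val.
apply: is_derive_along.
have := is_derive_mbump h m (z - x) (delta_mx ord0 i) 0.
under eq_fun do rewrite addrAC.
move=> /is_derive_eq; apply.
rewrite scale0r addr0 (bigD1 i)//= mxE !eqxx mul1r big1 ?addr0// => j /negbTE ji.
by rewrite mxE ji andbF mul0r.
Qed.

Lemma derivable_mbump h m x i z :
  derivable (fun z => mbump h m (z - x)) z (delta_mx ord0 i).
Proof.
suff [] : is_derive z (delta_mx ord0 i) (fun z => mbump h m (z - x))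
    (\sum_j (delta_mx ord0 i : 'rV[R]_d) ord0 j *
      mbump h (mincr m j) (z - x + 0 *: delta_mx ord0 i)) by [].
apply: is_derive_along.
under eq_fun do rewrite addrAC.
exact: is_derive_mbump.
Qed.

Lemma partials_mbump h m x s :
  partials s (fun z => mbump h m (z - x)) =
  (fun z => mbump h (foldr (fun i m => mincr m i) m s) (z - x)).
Proof. by elim: s => // i s ih; rewrite /= ih partial_mbump. Qed.

Lemma mincrC m i j : mincr (mincr m i) j = mincr (mincr m j) i.
Proof. by apply/funext => k; rewrite /mincr addnAC. Qed.

(** This allows the kernel itself to be inserted in the definition of weak
derivatives. *)
Lemma test_function_mbump h x (D : set 'rV[R]_d) : 0 < h ->
  (forall z, `|z - x| <= h -> D z) ->
  test_function D (fun z => mbump h (fun=> 0%N) (z - x)).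
Proof.
move=> h0 hD.
have cn : closed [set z : 'rV[R]_d | `|z - x| <= h].
  rewrite (_ : [set _ | _] = (fun z => `|z - x|) @^-1` [set t : R | t <= h])//.
  apply: closed_comp; last exact: closed_le.
  move=> z _; apply: continuous_comp; last exact: norm_continuous.
  exact: continuous_rV_subr.
have sub : closure [set z | mbump h (fun=> 0%N) (z - x) != 0] `<=`
    [set z : 'rV[R]_d | `|z - x| <= h].
  rewrite closureE; apply: smallest_sub => // z /=; apply: contra_neqT; rewrite -ltNge.
  by move=> /ltW; exact: mbump_out_norm.
split.
- move=> s; rewrite partials_mbump; split; last by move=> i z; exact: derivable_mbump.
  move=> z; apply: continuous_comp; last exact: continuous_mbump.
  exact: continuous_rV_subr.
- apply: bounded_closed_compact; last exact: closed_closure.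
  exists (`|x| + h); split => [|M hM]; first exact: num_real.
  move=> z /sub/= zx.
  rewrite ltW// (le_lt_trans _ hM)// -(subrK x z) addrC (le_trans (ler_normD _ _))//.
  by rewrite lerD.
- by move=> z /sub; exact: hD.
Qed.

End mbump.

(** * Integrals against the mollifier *)
Section integral_prod.
Context (R : realType).

Lemma measurable_fun_continuous_rV d (f : 'rV[R]_d -> R) :
  continuous f -> measurable_fun setT f.
Proof.
move=> cf; apply: (measurability _ (RGenOpens.measurableE R)).
move=> _ [_ [a [b ->] <-]]; rewrite setTI; apply: open_measurable_mx.
by apply: open_comp; [move=> v _; exact: cf|exact: interval_open].
Qed.

(** Tonelli's theorem along the recursive construction of [lebesgue_rV]. *)
Lemma ge0_integral_rV_prod n (f : 'I_n -> R -> R) :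
  (forall i, measurable_fun setT (f i)) -> (forall i t, 0 <= f i t) ->
  (\int[lebesgue_rV R n]_v (\prod_i f i (v ord0 i))%:E =
   \prod_i \int[lebesgue_measure]_t (f i t)%:E)%E.
Proof.
elim: n f => [|n ih] f mf f0.
  rewrite big_ord0 /=.
  under eq_integral do rewrite big_ord0.
  by rewrite [LHS]integral_cst//= mul1e [LHS]diracT.
have mF : measurable_fun setT (fun v : 'rV[R]_n.+1 => (\prod_i f i (v ord0 i))%:E).
  apply/measurable_EFinP; apply: measurable_prod => i _.
  by apply: measurableT_comp => //; exact: measurable_coord.
rewrite big_ord_recl -ih//=.
pose phi : (measurableTypeR R * 'rV[R]_n)%type -> 'rV[R]_n.+1 := @rV_cons R n.
have mphi : measurable_fun setT phi by exact: measurable_rV_cons.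
pose P := measure_function_pushforward__canonical__measure_function_Measure
  (lebesgue_measure \x lebesgue_rV R n)%E mphi.
rewrite (@eq_measure_integral _ _ _ _ P)//.
have F0 (v : 'rV[R]_n.+1) : (0 <= (\prod_(i < n.+1) f i (v ord0 i))%:E)%E.
  by rewrite lee_fin; apply: prodr_ge0.
rewrite [LHS](@ge0_integral_pushforward _ _ _ _ R _ mphi
  (lebesgue_measure \x lebesgue_rV R n)%E setT _ measurableT mF (fun v _ => F0 v)).
rewrite preimage_setT fubini_tonelli1//=; last exact: measurableT_comp mF mphi.
rewrite /fubini_F/=.
have mG : measurable_fun setT (fun v : 'rV[R]_n => (\prod_(i < n) f (lift ord0 i) (v ord0 i))%:E).
  apply/measurable_EFinP; apply: measurable_prod => i _.
  by apply: measurableT_comp => //; exact: measurable_coord.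
have G0 (v : 'rV[R]_n) : (0 <= (\prod_(i < n) f (lift ord0 i) (v ord0 i))%:E)%E.
  by rewrite lee_fin; apply: prodr_ge0.
transitivity (\int[lebesgue_measure]_t ((f ord0 t)%:E *
   \int[lebesgue_rV R n]_v (\prod_(i < n) f (lift ord0 i) (v ord0 i))%:E))%E.
  apply: eq_integral => t _; rewrite -ge0_integralZl//; last by rewrite lee_fin.
  apply: eq_integral => v _.
  rewrite big_ord_recl /phi rV_cons0 EFinM; congr (_ * _%:E)%E.
  by apply: eq_bigr => i _; rewrite rV_consS.
rewrite ge0_integralZr//=.
- by apply/measurable_EFinP; exact: mf.
- by move=> t _; rewrite lee_fin.
- exact: integral_ge0.
Qed.
End integral_prod.

Section osc.
Context (R : realType) (d : nat).
Local Notation mu := (lebesgue_rV R d).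
Local Notation k h x z := (mbump h (fun=> 0%N) (z - x)).
Implicit Types (h : R) (f g : 'rV[R]_d -> R) (x z : 'rV[R]_d).

Lemma measurable_theta h n : measurable_fun setT (theta h n).
Proof. by apply: continuous_measurable_fun; exact: continuous_theta. Qed.

Lemma integral_mbump h x : 0 < h -> (\int[mu]_z (k h x z)%:E = 1)%E.
Proof.
move=> h0.
have mt i : measurable_fun setT (fun t : R => theta h 0 (t - x ord0 i)).
  apply: (measurableT_comp (measurable_theta h 0)).
  exact: measurable_funB.
transitivity (\prod_(i < d) \int[lebesgue_measure]_t (theta h 0 (t - x ord0 i))%:E)%E.
  rewrite -(@ge0_integral_rV_prod _ _ (fun i t => theta h 0 (t - x ord0 i)));
    [|exact: mt|by move=> i t; exact: theta0_ge0].
  apply: eq_integral => z _; rewrite /mbump; congr EFin.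
  by apply: eq_bigr => i _; rewrite !mxE.
by rewrite big1// => i _; rewrite integral_theta.
Qed.

Lemma measurable_mbump_sub h m :
  measurable_fun setT (fun p : 'rV[R]_d * 'rV[R]_d => mbump h m (p.2 - p.1)).
Proof.
apply: measurable_prod => i _.
rewrite (_ : (fun _ => _) =
    theta h (m i) \o (fun p : 'rV[R]_d * 'rV[R]_d => p.2 ord0 i - p.1 ord0 i)).
  apply: measurableT_comp.
    exact: measurable_theta.
  apply: measurable_funB.
    exact: (measurableT_comp (measurable_coord _ _)).
  exact: (measurableT_comp (measurable_coord _ _)).
by apply/funext => p /=; rewrite !mxE.
Qed.

Lemma kernelC h x z : k h x z = k h z x.
Proof. by rewrite -mbump0N opprB. Qed.

(** Mean oscillation at scale [h].  It dominates the L^1 distance from [f] to its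
mollification; being subadditive and bounded by the L^1 norm, it is suited to
density arguments. *)
Definition osc h f : \bar R := (\int[mu]_x \int[mu]_z (`|f z - f x| * k h x z)%:E)%E.

Lemma measurable_osc h f : measurable_fun setT f ->
  measurable_fun setT (fun p : 'rV[R]_d * 'rV[R]_d => (`|f p.2 - f p.1| * k h p.1 p.2)%:E).
Proof.
move=> mf; apply/measurable_EFinP; apply: measurable_funM; last exact: measurable_mbump_sub.
apply: measurableT_comp => //; apply: measurable_funB.
  exact: (measurableT_comp mf).
exact: (measurableT_comp mf).
Qed.

Lemma measurable_osc1 h f x : measurable_fun setT f ->
  measurable_fun setT (fun z => (`|f z - f x| * k h x z)%:E).
Proof.
move=> mf; exact: (measurableT_comp (measurable_osc h mf) (pair1_measurable x)).
Qed.

Lemma measurable_osc2 h f : measurable_fun setT f ->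
  measurable_fun setT (fun x => \int[mu]_z (`|f z - f x| * k h x z)%:E)%E.
Proof.
move=> mf; apply: (measurable_fun_fubini_tonelli_F _ (measurable_osc h mf)).
by move=> p; rewrite lee_fin mulr_ge0 ?mbump0_ge0.
Qed.

(** Comparing the integrals over the product space avoids any question about the
finiteness of the inner ones. *)
Lemma iterated_integral_le_add (F A B : 'rV[R]_d * 'rV[R]_d -> R) :
  measurable_fun setT F -> measurable_fun setT A -> measurable_fun setT B ->
  (forall p, 0 <= F p) -> (forall p, 0 <= A p) -> (forall p, 0 <= B p) ->
  (forall p, F p <= A p + B p) ->
  (\int[mu]_x \int[mu]_z (F (x, z))%:E <=
   \int[mu]_x \int[mu]_z (A (x, z))%:E + \int[mu]_x \int[mu]_z (B (x, z))%:E)%E.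
Proof.
move=> mF mA mB F0 A0 B0 FAB.
have mE (f : 'rV[R]_d * 'rV[R]_d -> R) : measurable_fun setT f ->
  measurable_fun setT (fun p => (f p)%:E) by move=> ?; exact/measurable_EFinP.
have ge0 (f : 'rV[R]_d * 'rV[R]_d -> R) : (forall p, 0 <= f p) ->
  forall p, (0 <= (f p)%:E)%E by move=> f0 p; rewrite lee_fin.
have tonelli (f : 'rV[R]_d * 'rV[R]_d -> R) :
    measurable_fun setT f -> (forall p, 0 <= f p) ->
    (\int[mu]_x \int[mu]_z (f (x, z))%:E = \int[mu \x mu]_p (f p)%:E)%E.
  by move=> mf f0; exact: esym (fubini_tonelli1 _ (mE _ mf) (ge0 _ f0)).
rewrite (tonelli F mF F0) (tonelli A mA A0) (tonelli B mB B0).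
rewrite -ge0_integralD; [|exact: measurableT|by move=> p _; exact: ge0|
  exact: mE|by move=> p _; exact: ge0|exact: mE].
apply: ge0_le_integral; [exact: measurableT|by move=> p _; exact: ge0|exact: mE|
  by apply: emeasurable_funD; exact: mE|].
by move=> p _; rewrite -EFinD lee_fin.
Qed.

Lemma measurable_norm_sub_kernel h f : measurable_fun setT f ->
  measurable_fun setT (fun p : 'rV[R]_d * 'rV[R]_d => `|f p.2 - f p.1| * k h p.1 p.2).
Proof. by move=> mf; apply/measurable_EFinP; exact: measurable_osc. Qed.

Lemma norm_kernel_ge0 h (a : R) x z : 0 <= `|a| * k h x z.
Proof. by rewrite mulr_ge0 ?mbump0_ge0. Qed.

Lemma oscD h f g : measurable_fun setT f -> measurable_fun setT g ->
  (osc h (f \+ g)%R <= osc h f + osc h g)%E.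
Proof.
move=> mf mg.
have := @iterated_integral_le_add _ _ _ (measurable_norm_sub_kernel h (measurable_funD mf mg))
  (measurable_norm_sub_kernel h mf) (measurable_norm_sub_kernel h mg).
apply=> p; try exact: norm_kernel_ge0.
rewrite -mulrDl ler_wpM2r ?mbump0_ge0//.
by rewrite opprD addrACA ler_normD.
Qed.

(** The kernel is symmetric and has integral one, so that averaging preserves
integrals. *)
Lemma integral_kernel_swap h (F : 'rV[R]_d -> R) : 0 < h -> measurable_fun setT F ->
  (forall x, 0 <= F x) ->
  (\int[mu]_x \int[mu]_z (F z * k h x z)%:E = \int[mu]_x (F x)%:E)%E.
Proof.
move=> h0 mF F0.
have mA : measurable_fun setT (fun p : 'rV[R]_d * 'rV[R]_d => (F p.2 * k h p.1 p.2)%:E).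
  apply/measurable_EFinP; apply: measurable_funM; last exact: measurable_mbump_sub.
  exact: (measurableT_comp mF).
have A0 (p : 'rV[R]_d * 'rV[R]_d) : (0 <= (F p.2 * k h p.1 p.2)%:E)%E.
  by rewrite lee_fin mulr_ge0 ?mbump0_ge0.
rewrite (fubini_tonelli _ mA A0)/=.
apply: eq_integral => z _.
have mk : measurable_fun setT (fun x => (k h z x)%:E).
  apply/measurable_EFinP.
  exact: (measurableT_comp (measurable_mbump_sub h (fun=> 0%N)) (pair1_measurable z)).
under eq_integral do rewrite EFinM kernelC.
rewrite ge0_integralZl; [|exact: measurableT|exact: mk|
  by move=> x _; rewrite lee_fin mbump0_ge0|by rewrite lee_fin].
by rewrite integral_mbump// mule1.
Qed.

Lemma integral_kernel h x (a : R) : 0 < h -> 0 <= a ->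
  (\int[mu]_z (a * k h x z)%:E = a%:E)%E.
Proof.
move=> h0 a0; under eq_integral do rewrite EFinM.
rewrite ge0_integralZl; [by rewrite integral_mbump ?mule1|exact: measurableT| |
  by move=> z _; rewrite lee_fin mbump0_ge0|by rewrite lee_fin].
apply/measurable_EFinP.
exact: (measurableT_comp (measurable_mbump_sub h (fun=> 0%N)) (pair1_measurable x)).
Qed.

(** [|f z - f x| <= |f z| + |f x|], and both terms have the same integral against
the kernel. *)
Lemma osc_le h f : 0 < h -> measurable_fun setT f ->
  (osc h f <= 2%:E * \int[mu]_x `|f x|%:E)%E.
Proof.
move=> h0 mf.
have mn : measurable_fun setT (fun x => `|f x|) by exact: measurableT_comp.
have mA : measurable_fun setT (fun p : 'rV[R]_d * 'rV[R]_d => `|f p.2| * k h p.1 p.2).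
  apply: measurable_funM; last exact: measurable_mbump_sub.
  exact: (measurableT_comp mn).
have mB : measurable_fun setT (fun p : 'rV[R]_d * 'rV[R]_d => `|f p.1| * k h p.1 p.2).
  apply: measurable_funM; last exact: measurable_mbump_sub.
  exact: (measurableT_comp mn).
rewrite (_ : 2%:E * _ = \int[mu]_x \int[mu]_z (`|f z| * k h x z)%:E +
   \int[mu]_x \int[mu]_z (`|f x| * k h x z)%:E)%E; last first.
  rewrite (@integral_kernel_swap _ (fun z => `|f z|))//.
  under [X in (_ + X)%E]eq_integral do rewrite integral_kernel//.
  by rewrite -mule2n mule_natl.
have := @iterated_integral_le_add _ _ _ (measurable_norm_sub_kernel h mf) mA mB.
apply=> p; try exact: norm_kernel_ge0.
by rewrite -mulrDl ler_wpM2r ?mbump0_ge0// ler_normB.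
Qed.

End osc.

(** * Mean oscillations vanish *)
Section vanish.
Context (R : realType) (d : nat).
Local Notation mu := (lebesgue_rV R d).
Local Notation h_ n := (n.+1%:R^-1)%R.
Local Notation k h x z := (mbump h (fun=> 0%N) (z - x)).
Implicit Types (h : R) (f g : 'rV[R]_d -> R) (x z : 'rV[R]_d).

(** Convergence along the scales [1 / (n + 1)], as a sequence is what dominated
convergence and the extraction of contact sets call for. *)
Definition osc_vanishes f := forall e : R, 0 < e ->
  \forall n \near \oo, (osc (h_ n) f <= e%:E)%E.

(** By symmetry of the kernel, the oscillation of the indicator of [U] is twice the
mass carried by the kernel from [U] to its complement, and a point of the open
set [U] sends no mass out once the scale is below its distance to the
complement. *)
Lemma osc_vanishes_open (U : set 'rV[R]_d) : open U -> (mu U < +oo)%E ->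
  osc_vanishes \1_U.
Proof.
move=> oU Uoo; have mU : measurable U by exact: open_measurable_mx.
pose G h x := (\int[mu]_z (\1_U x * (1 - \1_U z) * k h x z)%:E)%E.
have mA h : measurable_fun setT (fun p : 'rV[R]_d * 'rV[R]_d =>
    (\1_U p.1 * (1 - \1_U p.2) * k h p.1 p.2)%:E).
  apply/measurable_EFinP; apply: measurable_funM; last exact: measurable_mbump_sub.
  apply: measurable_funM.
    exact: (measurableT_comp (measurable_indic mU)).
  apply: measurable_funB => //.
  exact: (measurableT_comp (measurable_indic mU)).
have i01 x : 0 <= 1 - \1_U x :> R.
  by rewrite subr_ge0 indicE; case: (_ \in _).
have A0 h (p : 'rV[R]_d * 'rV[R]_d) :
    (0 <= (\1_U p.1 * (1 - \1_U p.2) * k h p.1 p.2)%:E)%E.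
  by rewrite lee_fin !mulr_ge0 ?mbump0_ge0 ?i01.
have mG h : measurable_fun setT (G h).
  exact: (measurable_fun_fubini_tonelli_F _ (mA h) (A0 h)).
have G0 h x : (0 <= G h x)%E by apply: integral_ge0 => z _; exact: (A0 h (x, z)).
have oscE h : 0 < h -> (osc h \1_U <= 2%:E * \int[mu]_x G h x)%E.
  move=> h0.
  pose A (p : 'rV[R]_d * 'rV[R]_d) := \1_U p.1 * (1 - \1_U p.2) * k h p.1 p.2.
  pose B (p : 'rV[R]_d * 'rV[R]_d) := \1_U p.2 * (1 - \1_U p.1) * k h p.1 p.2.
  have mA' : measurable_fun setT A by apply/measurable_EFinP; exact: mA.
  have mB : measurable_fun setT B.
    apply: measurable_funM; last exact: measurable_mbump_sub.
    apply: measurable_funM.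
      exact: (measurableT_comp (measurable_indic mU)).
    apply: measurable_funB; first exact: measurable_cst.
    exact: (measurableT_comp (measurable_indic mU)).
  have A0' p : 0 <= A p by rewrite !mulr_ge0 ?mbump0_ge0 ?i01.
  have B0 p : 0 <= B p by rewrite !mulr_ge0 ?mbump0_ge0 ?i01.
  have IB : (\int[mu]_x \int[mu]_z (B (x, z))%:E = \int[mu]_x G h x)%E.
    have mBE : measurable_fun setT (fun p => (B p)%:E).
      by apply/measurable_EFinP; exact: mB.
    have B0E p : (0 <= (B p)%:E)%E by rewrite lee_fin.
    rewrite (fubini_tonelli _ mBE B0E).
    by apply: eq_integral => x _; apply: eq_integral => z _; rewrite /B kernelC.
  rewrite (_ : 2%:E * _ = \int[mu]_x \int[mu]_z (A (x, z))%:E +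
      \int[mu]_x \int[mu]_z (B (x, z))%:E)%E; last by rewrite IB -mule2n mule_natl.
  have := @iterated_integral_le_add _ _ _ _ _
    (measurable_norm_sub_kernel h (measurable_indic mU)) mA' mB.
  apply=> p; [exact: norm_kernel_ge0|exact: A0'|exact: B0|].
  rewrite -mulrDl; apply: ler_wpM2r; [exact: mbump0_ge0|rewrite !indicE].
  case: (p.1 \in U); case: (p.2 \in U) => /=;
    by rewrite ?subrr ?normr0 ?sub0r ?subr0 ?normrN ?normr1 ?mulr0 ?mul0r ?mul1r ?addr0 ?add0r ?mulr1.
have mi : measurable_fun setT (fun x => (\1_U x)%:E : \bar R).
  by apply/measurable_EFinP; exact: measurable_indic.
have cvG : (fun n => \int[mu]_x G (h_ n) x)%E @ \oo --> 0%E.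
  have := @dominated_convergence _ _ R mu setT measurableT
    (fun n => G (h_ n)) (cst 0%E) (fun x => (\1_U x)%:E).
  case => //.
  - apply: aeW => x _.
    have [Ux|nUx] := pselect (U x); last first.
      apply: cvg_near_cst; apply: nearW => n; rewrite /G.
      under eq_integral do rewrite indicE memNset// !mul0r.
      by rewrite integral0.
    have /nbhs_ballP[e /= e0 eU] := open_nbhs_nbhs (conj oU Ux).
    apply: cvg_near_cst; near=> n.
    rewrite /G; under eq_integral => z _.
      have -> : \1_U x * (1 - \1_U z) * k (h_ n) x z = 0.
        have [xz|xz] := ltP `|z - x| (h_ n).
          rewrite [\1_U z]indicE mem_set ?subrr ?mulr0 ?mul0r//.
          apply: eU; rewrite -ball_normE/= distrC (lt_le_trans xz)//.
          rewrite ltW//; near: n; exact: near_infty_natSinv_lt (PosNum e0).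
        by rewrite mbump_out_norm ?mulr0// invr_gt0.
      over.
    by rewrite integral0.
  - apply/integrableP; split => //.
    under eq_integral do rewrite /= ger0_norm//.
    by rewrite integral_indic// setIT.
  - apply: aeW => x n _; rewrite gee0_abs//.
    rewrite (@le_trans _ _ (\int[mu]_z ((\1_U x)%:E * (k (h_ n) x z)%:E))%E)//.
      apply: ge0_le_integral => //.
      + by move=> z _; exact: (A0 _ (x, z)).
      + exact: (measurableT_comp (mA _) (pair1_measurable x)).
      + apply: measurable_funeM; apply/measurable_EFinP.
        exact: (measurableT_comp (measurable_mbump_sub _ _) (pair1_measurable x)).
      move=> z _; rewrite -EFinM lee_fin ler_wpM2r ?mbump0_ge0// ler_piMr//.
    rewrite ge0_integralZl//.
    + by rewrite integral_mbump ?mule1// invr_gt0.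
    + apply/measurable_EFinP.
      exact: (measurableT_comp (measurable_mbump_sub _ _) (pair1_measurable x)).
    + by move=> z _; rewrite lee_fin mbump0_ge0.
  by move=> _ _; rewrite integral0.
move=> e e0.
have e20 : 0 < e / 2 by rewrite divr_gt0.
have := cvG; move/fine_cvgP => [fG /cvgrPdist_le/(_ _ e20) cG].
near=> n.
rewrite (le_trans (oscE _ _))// ?invr_gt0//.
have fn : (\int[mu]_x G (h_ n) x)%E \is a fin_num by near: n.
rewrite -(fineK fn) -EFinM lee_fin mulrC -ler_pdivlMr//.
rewrite (le_trans (ler_norm _))//.
have : `|0 - fine (\int[mu]_x G (h_ n) x)%E| <= e / 2 by near: n.
by rewrite sub0r normrN.
Unshelve. all: by end_near. Qed.

Lemma osc_vanishesD f g : measurable_fun setT f -> measurable_fun setT g ->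
  osc_vanishes f -> osc_vanishes g -> osc_vanishes (f \+ g).
Proof.
move=> mf mg vf vg e e0; have e20 : 0 < e / 2 by rewrite divr_gt0.
apply: filterS2 (vf _ e20) (vg _ e20) => n fn gn.
apply: (le_trans (oscD _ mf mg)); rewrite (splitr e) EFinD; exact: leeD fn gn.
Qed.

Lemma oscZ h c f : measurable_fun setT f ->
  osc h (fun x => c * f x) = (`|c|%:E * osc h f)%E.
Proof.
move=> mf; rewrite /osc -ge0_integralZl; [|exact: measurableT|exact: measurable_osc2| |by []].
  apply: eq_integral => x _.
  rewrite -ge0_integralZl; [|exact: measurableT|exact: measurable_osc1| |by []].
    by apply: eq_integral => z _; rewrite -mulrBr normrM -EFinM mulrA.
  by move=> z _; rewrite lee_fin norm_kernel_ge0.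
by move=> x _; apply: integral_ge0 => z _; rewrite lee_fin norm_kernel_ge0.
Qed.

Lemma osc_vanishesZ c f : measurable_fun setT f ->
  osc_vanishes f -> osc_vanishes (fun x => c * f x).
Proof.
move=> mf vf e e0; have ec : 0 < e / (`|c| + 1) by rewrite divr_gt0// ltr_wpDl.
apply: filterS (vf _ ec) => n fn; rewrite oscZ//.
rewrite (@le_trans _ _ (`|c|%:E * (e / (`|c| + 1))%:E)%E)//.
  by apply: lee_wpmul2l; [rewrite lee_fin|exact: fn].
by rewrite -EFinM lee_fin mulrCA ler_piMr ?(ltW e0)// ler_pdivrMr ?mul1r ?lerDl// ltr_wpDl.
Qed.

(** Stability under approximation in L^1, a consequence of [osc_le]. *)
Lemma osc_vanishes_approx f : measurable_fun setT f ->
  (forall e : R, 0 < e -> exists g, [/\ measurable_fun setT g, osc_vanishes g &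
    (\int[mu]_x `|f x - g x|%:E <= e%:E)%E]) ->
  osc_vanishes f.
Proof.
move=> mf fP e e0; have e20 : 0 < e / 2 by rewrite divr_gt0.
have e40 : 0 < e / 4 by rewrite divr_gt0.
have [g [mg vg fg]] := fP _ e40.
have mfg : measurable_fun setT (f \- g) by exact: measurable_funB.
apply: filterS (vg _ e20) => n gn.
have -> : f = (f \- g) \+ g by apply/funext => x /=; rewrite subrK.
rewrite (le_trans (oscD _ mfg mg))// (splitr e) EFinD; apply: leeD; last exact: gn.
rewrite (le_trans (osc_le _ mfg))// ?invr_gt0//.
rewrite (@le_trans _ _ (2%:E * (e / 4)%:E)%E)//.
  by apply: lee_wpmul2l => //; rewrite lee_fin.
by rewrite -EFinM lee_fin le_eqVlt; apply/orP; left; apply/eqP; field.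
Qed.

(** Open sets form a pi-system that generates the Borel sets, and the sets for
which the conclusion holds form a Dynkin class; the intersection with [Q]
keeps measures finite. *)
Lemma osc_vanishes_setI (Q A : set 'rV[R]_d) : open Q -> (mu Q < +oo)%E ->
  measurable A -> osc_vanishes \1_(A `&` Q).
Proof.
move=> oQ Qoo; have mQ : measurable Q by exact: open_measurable_mx.
rewrite measurable_mxE.
have vQ : osc_vanishes \1_Q by exact: osc_vanishes_open.
apply: (@dynkin_induction _ 'rV[R]_d [set U | open U]
  (fun A => osc_vanishes \1_(A `&` Q))).
- exact: measurable_mxE.
- by move=> U V /= oU oV; exact: openI.
- by rewrite setTI.
- move=> U /= oU; apply: osc_vanishes_open; first exact: openI.
  rewrite (le_lt_trans _ Qoo)// le_measure ?inE//.
  by apply: measurableI => //; exact: open_measurable_mx.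
- move=> S mS vS.
  have -> : \1_(~` S `&` Q) = \1_Q \+ (fun x => (-1) * \1_(S `&` Q) x) :> ('rV[R]_d -> R).
    apply/funext => x /=; rewrite !indicE !in_setI in_setC mulN1r.
    by case: (x \in S); case: (x \in Q) => /=; rewrite ?subrr ?subr0.
  have mSQ : measurable_fun setT (\1_(S `&` Q) : 'rV[R]_d -> R).
    by apply: measurable_indic; exact: measurableI.
  apply: osc_vanishesD; [exact: measurable_indic|exact: measurable_funM|exact: vQ|].
  exact: osc_vanishesZ mSQ vS.
move=> F mF tF vF; apply: osc_vanishes_approx.
  by apply: measurable_indic; apply: measurableI => //; exact: bigcup_measurable.
move=> e e0.
(* Finite unions approximate the countable one in measure, hence in L^1. *)
pose B n := \big[setU/set0]_(i < n) F i `&` Q.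
have mB n : measurable (B n) by apply: measurableI => //; exact: bigsetU_measurable.
have vB n : osc_vanishes \1_(B n).
  elim: n => [|n ih].
    move=> r r0; apply: nearW => n; rewrite /B big_ord0 set0I /osc.
    under eq_integral do under eq_integral do rewrite !indicE !in_set0 subrr normr0 mul0r.
    by under eq_integral do rewrite integral0; rewrite integral0 lee_fin ltW.
  have -> : \1_(B n.+1) = \1_(B n) \+ \1_(F n `&` Q) :> ('rV[R]_d -> R).
    apply/funext => x /=; rewrite /B big_ord_recr/= !indicE !in_setI in_setU.
    have [Fx|] := boolP (x \in F n); last by rewrite orbF addr0.
    have -> /= : x \in \big[setU/set0]_(i < n) F i = false.
      apply/negbTE; rewrite notin_setE -bigcup_mkord => -[i /= ni Fi].
      move/trivIsetP : tF => /(_ i n I I); rewrite neq_ltn ni => /(_ isT).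
      by move=> /disjoints_subset /(_ x Fi); apply; rewrite inE in Fx.
    by rewrite add0r.
  apply: osc_vanishesD; [apply: measurable_indic; exact: mB| |exact: ih|exact: vF].
  by apply: measurable_indic; apply: measurableI; [exact: mF|exact: mQ].
have cB : mu (B n) @[n --> \oo] --> mu (\bigcup_n B n).
  apply: nondecreasing_cvg_mu => //; first exact: bigcup_measurable.
  move=> n m nm; apply/subsetPset => x [+ Qx]; rewrite -bigcup_mkord => -[i /= ni Fi].
  split=> //; rewrite -bigcup_mkord; exists i => //=; exact: leq_trans ni nm.
have UB : \bigcup_n B n = \bigcup_n F n `&` Q.
  apply/seteqP; split => x; first move=> [n _].
    by move=> [/=]; rewrite -bigcup_mkord => -[i _ Fi] Qx; split=> //; exists i.
  by move=> [[n _ Fx] Qx]; exists n.+1 => //; split => //; rewrite big_ord_recr; right.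
rewrite UB in cB.
have mU : measurable (\bigcup_n F n `&` Q).
  by apply: measurableI => //; exact: bigcup_measurable.
have Uoo : (mu (\bigcup_n F n `&` Q) < +oo)%E.
  by rewrite (le_lt_trans _ Qoo)// le_measure ?inE.
have fU : mu (\bigcup_n F n `&` Q) \is a fin_num by rewrite ge0_fin_numE.
move: cB; rewrite -(fineK fU) => /fine_cvgP[fB /cvgrPdist_le/(_ _ e0) cB].
near \oo => n.
exists \1_(B n); split; [exact: measurable_indic|exact: vB|].
rewrite [leLHS](_ : _ = \int[mu]_x (\1_((\bigcup_n F n `&` Q) `\` B n) x)%:E)%E; last first.
  apply: eq_integral => x _; congr EFin.
  have BU : B n x -> (\bigcup_n F n `&` Q) x by rewrite -UB => Bx; exists n.
  rewrite !indicE in_setD; case: (boolP (x \in B n)) => [|xB] /=.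
    by rewrite inE => /BU/mem_set ->; rewrite subrr normr0.
  by rewrite andbT subr0 ger0_norm.
rewrite integral_indic ?setIT//; last exact: measurableD.
rewrite measureD//; last first.
have -> : (\bigcup_n F n `&` Q) `&` B n = B n.
  by apply/setIidr; rewrite -UB; exact: bigcup_sup.
have fBn : mu (B n) \is a fin_num by near: n.
have H : fine (mu (\bigcup_n F n `&` Q)) - fine (mu (B n)) <= e.
  by apply: le_trans (ler_norm _) _; near: n; exact: cB.
by move: H; rewrite -lee_fin EFinB (fineK fU) (fineK fBn).
Unshelve. all: by end_near. Qed.

Lemma osc_vanishes_sum (I : Type) (s : seq I) (F : I -> 'rV[R]_d -> R) :
  (forall i, measurable_fun setT (F i)) -> (forall i, osc_vanishes (F i)) ->
  osc_vanishes (fun x => \sum_(i <- s) F i x).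
Proof.
move=> mF vF; elim: s => [|i s ih].
  move=> e e0; apply: nearW => n; rewrite /osc.
  under eq_integral do under eq_integral do rewrite !big_nil subrr normr0 mul0r.
  by under eq_integral do rewrite integral0; rewrite integral0 lee_fin ltW.
rewrite (_ : (fun x => _) = F i \+ (fun x => \sum_(i <- s) F i x)); last first.
  by apply/funext => x; rewrite big_cons.
apply: osc_vanishesD; [exact: mF| |exact: vF|exact: ih].
by apply: measurable_sum.
Qed.

Import HBSimple.

(** Finite combinations of indicators are dense in L^1. *)
Theorem osc_vanishes_integrable (Q : set 'rV[R]_d) f : open Q -> (mu Q < +oo)%E ->
  mu.-integrable Q (EFin \o f) -> measurable_fun setT f ->
  (forall x, ~ Q x -> f x = 0) -> osc_vanishes f.
Proof.
move=> oQ Qoo intf mf f0; have mQ : measurable Q by exact: open_measurable_mx.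
apply: osc_vanishes_approx => // e e0.
have [g [intg _ cg]] := approximation_sfun_integrable mQ intf.
move: cg => /fine_cvgP[fg /cvgrPdist_le/(_ _ e0) cg].
near \oo => n.
have mg : measurable_fun setT (g n) by exact: measurable_funP.
exists (fun x => g n x * \1_Q x); split.
- by apply: measurable_funM => //; exact: measurable_indic.
- rewrite (_ : (fun x => _) = (fun x => \sum_(y <- finmap.enum_fset (fset_set (range (g n))))
      y * \1_(g n @^-1` [set y] `&` Q) x)).
    apply: osc_vanishes_sum => y.
      apply: measurable_funM => //; apply: measurable_indic.
      exact: measurableI.
    apply: osc_vanishesZ; first by apply: measurable_indic; exact: measurableI.
    exact: osc_vanishes_setI.
  apply/funext => x; rewrite fimfunE fsbig_finite//= mulr_suml.
  by apply: eq_bigr => y _; rewrite indicI/= mulrA.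
have -> : (\int[mu]_x `|f x - g n x * \1_Q x|%:E =
    \int[mu]_(x in Q) `|(EFin \o f) x - (g n x)%:E|)%E.
  rewrite [RHS]integral_mkcond; apply: eq_integral => x _.
  rewrite patchE indicE; have [xQ|xQ] := boolP (x \in Q).
    by rewrite mulr1.
  by rewrite notin_setE in xQ; rewrite f0// mulr0 subr0 normr0.
have fgn : (\int[mu]_(x in Q) `|(EFin \o f) x - (g n x)%:E|)%E \is a fin_num by near: n.
rewrite -(fineK fgn) lee_fin (le_trans (ler_norm _))//.
rewrite -normrN -sub0r.
by near: n; exact: cg.
Unshelve. all: by end_near. Qed.

End vanish.

(** * Continuity and compactness in row vectors *)
Section continuity.
Context (R : realType) (d : nat).
Implicit Types f g : 'rV[R]_d -> R.

Lemma rV_continuousD f g : continuous f -> continuous g ->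
  continuous (fun x => f x + g x).
Proof. by move=> cf cg x; apply: (@cvgD _ _ _ (nbhs x)); [exact: cf|exact: cg]. Qed.

Lemma rV_continuousB f g : continuous f -> continuous g ->
  continuous (fun x => f x - g x).
Proof. by move=> cf cg x; apply: (@cvgB _ _ _ (nbhs x)); [exact: cf|exact: cg]. Qed.

Lemma rV_continuousM f g : continuous f -> continuous g ->
  continuous (fun x => f x * g x).
Proof. by move=> cf cg x; apply: (@cvgM _ _ (nbhs x)); [exact: cf|exact: cg]. Qed.

Lemma rV_continuous_sum (I : Type) (s : seq I) (F : I -> 'rV[R]_d -> R) :
  (forall i, continuous (F i)) -> continuous (fun x => \sum_(i <- s) F i x).
Proof. by move=> cF; apply: continuous_big => [|i _]; [exact: add_continuous|exact: cF]. Qed.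

Lemma rV_continuous_cst (c : R) : continuous (fun _ : 'rV[R]_d => c).
Proof. by move=> x; exact: cst_continuous. Qed.

End continuity.

Section compact_sets.
Context (R : realType) (d : nat).
Implicit Types (K D : set 'rV[R]_d).

Lemma compact_measurable_rV K : compact K -> measurable K.
Proof.
move=> cK; rewrite -(setCK K); apply: measurableC; apply: open_measurable_mx.
by apply: closed_openC; apply: compact_closed => //; exact: norm_hausdorff.
Qed.

Lemma compact_bound_rV K : compact K ->
  exists2 r : R, 0 < r & forall x, K x -> `|x| < r.
Proof.
move=> cK; have [M [_ MG]] := compact_bounded cK.
exists (`|M| + 2) => [|x Gx]; first by rewrite ltr_wpDl.
rewrite (le_lt_trans (MG (`|M| + 1) _ x Gx))//.
  by rewrite ltr_pwDr// ler_norm.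
by rewrite ltrD2l ltr1n.
Qed.

(** Room around [K], inside a compact part of [D], for the support of the
mollifier. *)
Lemma compact_fatten K D : compact K -> open D -> K `<=` D ->
  exists rho K', [/\ 0 < rho :> R, compact K', K' `<=` D &
    forall x z, K x -> `|z - x| <= rho -> K' z].
Proof.
move=> cK oD KD.
have [r r0 rP] : exists2 r : R, 0 < r & forall x z, K x -> `|z - x| <= r -> D z.
  have := (compact_near_coveringP K).1 cK R (0^'+)%R
    (fun s y => forall z, `|z - y| <= s -> D z) _.
  case=> //.
    move=> x Kx; have /nbhs_ballP[e /= e0 eD] := open_nbhs_nbhs (conj oD (KD _ Kx)).
    have e20 : 0 < e / 2 by rewrite divr_gt0.
    near=> y s => z /= zy.
    have xy : `|x - y| < e / 2.
      by near: y; apply/nbhs_ballP; exists (e / 2) => //= y'; rewrite -ball_normE.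
    have se : s < e / 2 by near: s; exact: nbhs_right_lt.
    apply: eD; rewrite -ball_normE/= (splitr e) -(subrKA y).
    rewrite (le_lt_trans (ler_normD _ _))// ltrD//.
    by rewrite distrC (le_lt_trans zy).
  move=> s /= s0 sP; exists (s / 2); first by rewrite divr_gt0.
  move=> x z Kx zx; apply: (sP (s / 2)) zx => //=.
    by rewrite sub0r normrN gtr0_norm ?divr_gt0// ltr_pdivrMr// ltr_pMr// ltr1n.
  by rewrite divr_gt0.
pose A := [set z | exists2 x, K x & `|z - x| <= r / 2].
have r20 : 0 < r / 2 by rewrite divr_gt0.
have clA z : closure A z -> exists2 x, K x & `|z - x| <= r.
  move=> /(_ (ball z (r / 2)) (nbhsx_ballx _ _ r20))[y [[x Kx yx]]].
  rewrite -ball_normE/= => zy; exists x => //.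
  rewrite (splitr r) -(subrKA y) (le_trans (ler_normD _ _))// lerD//.
  exact: ltW.
exists (r / 2), (closure A); split => //.
- apply: bounded_closed_compact; last exact: closed_closure.
  have [M M0 MK] := compact_bound_rV cK.
  exists (M + r); split => [|L ML z /clA[x Kx zx]]; first exact: num_real.
  rewrite /= ltW// (le_lt_trans _ ML)// -(subrK x z) addrC (le_trans (ler_normD _ _))//.
  by rewrite lerD// ltW// MK.
- by move=> z /clA[x Kx zx]; exact: rP Kx zx.
- by move=> x z Kx zx; apply: subset_closure; exists x.
Unshelve. all: by end_near. Qed.

Lemma closure_bound D : bounded_set D ->
  exists2 r, 1 <= r & forall x, closure D x -> `|x| <= r.
Proof.
move=> [M [_ MD]]; exists (`|M| + 1); first by rewrite lerDr.
pose S := [set z : 'rV[R]_d | `|z| <= `|M| + 1].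
have cl : closed S.
  by apply: (@closed_comp _ _ (fun z : 'rV[R]_d => `|z|) [set t : R | t <= `|M| + 1]);
    [move=> z _; exact: norm_continuous|exact: closed_le].
have DS : D `<=` S by move=> x Dx; apply: MD Dx; rewrite (le_lt_trans (ler_norm M))// ltrDl.
by move=> x /(closure_subset DS); rewrite -(iffLR (closure_id S)).
Qed.

Lemma compact_closure_le (r : R) D : (forall x, closure D x -> `|x| <= r) ->
  compact (closure D).
Proof.
move=> Dr; apply: bounded_closed_compact; last exact: closed_closure.
by exists r; split => [|L rL x Cx]; [exact: num_real|rewrite /= (le_trans (Dr x Cx))// ltW].
Qed.

End compact_sets.

(** * The area inequality *)
Section area.
Context (R : realType) (d : nat).
Local Notation mu := (lebesgue_rV R d).
Implicit Types (x y z xi : 'rV[R]_d) (K Gam : set 'rV[R]_d).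

(** Heine's theorem with only one of the two points in [K]: the grid cubes that
meet [K] stick out of it. *)
Lemma compact_unif_continuous K (f : 'rV[R]_d -> R) : compact K -> continuous f ->
  forall e : R, 0 < e -> exists2 s : R, 0 < s &
    forall y z, K y -> `|z - y| <= s -> `|f z - f y| <= e.
Proof.
move=> cK cf e e0; have e20 : 0 < e / 2 by rewrite divr_gt0.
have := (compact_near_coveringP K).1 cK R (0^'+)%R
  (fun s y => forall z, `|z - y| <= s -> `|f z - f y| <= e) _.
case=> //.
  move=> x Kx; have /cvgrPdist_le/(_ _ e20)/nbhs_ballP[r /= r0 rf] := cf x.
  have r20 : 0 < r / 2 by rewrite divr_gt0.
  near=> y s => z /= zy.
  have xy : `|x - y| < r / 2.
    by near: y; apply/nbhs_ballP; exists (r / 2) => //= y'; rewrite -ball_normE.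
  have sr : s < r / 2 by near: s; exact: nbhs_right_lt.
  have xz : `|x - z| < r.
    rewrite (splitr r) -(subrKA y) (le_lt_trans (ler_normD _ _))// ltrD//.
    by rewrite distrC (le_lt_trans zy).
  have := rf z; rewrite -ball_normE/= => /(_ xz) fz.
  have := rf y; rewrite -ball_normE/= => /(_ (lt_trans xy _)) fy.
  rewrite (splitr e) -(subrKA (f x)) (le_trans (ler_normD _ _))// lerD//.
    by rewrite distrC.
  by rewrite fy// ltr_pdivrMr// ltr_pMr// ltr1n.
move=> s /= s0 sP; exists (s / 2); first by rewrite divr_gt0.
move=> y z Ky zy; apply: (sP (s / 2)) zy => //=.
  by rewrite sub0r normrN gtr0_norm ?divr_gt0// ltr_pdivrMr// ltr_pMr// ltr1n.
by rewrite divr_gt0.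
Unshelve. all: by end_near. Qed.

Lemma segment_le (f : 'rV[R]_d -> R) (df : R -> R) x xi (c : R) :
  (forall t : R, is_derive t 1 (fun s : R => f (x + s *: xi)) (df t)) ->
  (forall t : R, 0 <= t <= 1 -> `|df t| <= c) ->
  `|f (x + xi) - f x| <= c.
Proof.
move=> fdf dfc.
have cf : {within `[0, 1], continuous (fun s : R => f (x + s *: xi))}.
  apply: continuous_subspaceT => t; apply/differentiable_continuous/derivable1_diffP.
  by have [] := fdf t.
have [t t01] := MVT_segment ler01 (fun t _ => fdf t) cf.
rewrite scale1r scale0r addr0 subr0 mulr1 => ->.
by apply: dfc; move: t01; rewrite in_itv.
Qed.

Definition gcube (r s : R) n (k : {ffun 'I_d -> 'I_n}) : set 'rV[R]_d :=
  [set x | forall i, x ord0 i \in `[- r + s * (k i)%:R, - r + s * (k i).+1%:R[ ].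

Definition cbox (c : 'rV[R]_d) (a : R) : set 'rV[R]_d :=
  [set x | forall i, x ord0 i \in `[c ord0 i - a, c ord0 i + a] ].

Lemma measurable_rV_box (A : 'I_d -> set R) : (forall i, measurable (A i)) ->
  measurable [set v : 'rV[R]_d | forall i, A i (v ord0 i)].
Proof.
move=> mA.
rewrite (_ : [set _ | _] = \bigcap_(i in [set: 'I_d]) ((fun v : 'rV[R]_d => v ord0 i) @^-1` A i)).
  apply: fin_bigcap_measurable => // i _.
  by rewrite -[X in measurable X]setTI; apply: measurable_coord.
by apply/seteqP; split => v /= vA i; [move=> _; exact: vA|exact: vA].
Qed.

Lemma measurable_gcube r s n k : measurable (@gcube r s n k).
Proof.
apply: (@measurable_rV_box (fun i => `[- r + s * (k i)%:R, - r + s * (k i).+1%:R[%classic)) => i.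
exact: measurable_itv.
Qed.

Lemma measurable_cbox c a : measurable (cbox c a).
Proof.
apply: (@measurable_rV_box (fun i => `[c ord0 i - a, c ord0 i + a]%classic)) => i.
exact: measurable_itv.
Qed.

Lemma lebesgue_gcube r s n k : 0 < s -> mu (@gcube r s n k) = (s ^+ d)%:E.
Proof.
move=> s0; rewrite (@lebesgue_rV_box _ _ (fun i => `[- r + s * (k i)%:R, - r + s * (k i).+1%:R[%classic)); last first.
  by move=> i; exact: measurable_itv.
rewrite (eq_bigr (fun=> s%:E)); last first.
  move=> i _; rewrite lebesgue_measure_itv/= lte_fin ltrD2l ltr_pM2l// ltr_nat ltnSn.
  by rewrite -EFinB; congr EFin; rewrite opprD addrACA subrr add0r -mulrBr -natrB// subSnn mulr1.
by rewrite prodEFin prodr_const card_ord.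
Qed.

Lemma lebesgue_cbox c a : 0 <= a -> mu (cbox c a) = ((2 * a) ^+ d)%:E.
Proof.
move=> a0; rewrite (@lebesgue_rV_box _ _ (fun i => `[c ord0 i - a, c ord0 i + a]%classic)); last first.
  by move=> i; exact: measurable_itv.
rewrite (eq_bigr (fun=> (2 * a)%:E)); last first.
  move=> i _; rewrite lebesgue_measure_itv/= lte_fin.
  case: ltP => [_|]; first by rewrite -EFinB; congr EFin; ring.
  rewrite -subr_ge0 opprD addrA; have -> : c ord0 i - a - c ord0 i - a = - (2 * a) by ring.
  by rewrite oppr_ge0 => aa; congr EFin; apply/eqP; rewrite eq_le aa mulr_ge0.
by rewrite prodEFin prodr_const card_ord.
Qed.

Lemma gcube_dist r s n k x y : 0 < s -> @gcube r s n k x -> gcube r s k y -> `|x - y| <= s.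
Proof.
move=> s0 kx ky; apply: rV_norm_le; first exact: ltW.
move=> i; rewrite !mxE; move: (kx i) (ky i); rewrite !in_itv/= => /andP[x1 x2] /andP[y1 y2].
rewrite -natr1 mulrDr mulr1 in x2 y2; rewrite ler_norml.
by apply/andP; split; lra.
Qed.

Lemma gcube_cover r s n x : 0 < s -> 2 * r <= s * n%:R -> (forall i, `|x ord0 i| < r) ->
  exists k, @gcube r s n k x.
Proof.
move=> s0 rn xr.
have x0 i : 0 <= (x ord0 i + r) / s.
  by rewrite divr_ge0 ?(ltW s0)//; have := xr i; rewrite ltr_norml => /andP[]; lra.
have kn i : (Num.truncn ((x ord0 i + r) / s) < n)%N.
  rewrite -(ltr_nat R); have /andP[+ _] := Num.Theory.truncn_itv (x0 i).
  move=> /le_lt_trans; apply; rewrite ltr_pdivrMr//.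
  by have := xr i; rewrite ltr_norml => /andP[]; lra.
exists [ffun i => Ordinal (kn i)] => i; rewrite ffunE/= in_itv/=.
have /andP[k1 k2] := Num.Theory.truncn_itv (x0 i).
rewrite ler_pdivlMr// in k1; rewrite ltr_pdivrMr// in k2.
by apply/andP; split; rewrite mulrC; lra.
Qed.

Lemma gcube_disj r s n k l x : 0 < s -> @gcube r s n k x -> gcube r s l x -> k = l.
Proof.
move=> s0 kx lx; apply/ffunP => i; apply/val_inj/eqP.
move: (kx i) (lx i); rewrite !in_itv/= => /andP[k1 k2] /andP[l1 l2].
have kl : s * (k i)%:R < s * (l i).+1%:R by lra.
have lk : s * (l i)%:R < s * (k i).+1%:R by lra.
rewrite ltr_pM2l// ltr_nat ltnS in kl; rewrite ltr_pM2l// ltr_nat ltnS in lk.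
by rewrite eqn_leq kl lk.
Qed.

Lemma le_measure_bigsetU (I : Type) (S : seq I) (A : I -> set 'rV[R]_d) :
  (forall i, measurable (A i)) ->
  (mu (\big[setU/set0]_(i <- S) A i) <= \sum_(i <- S) mu (A i))%E.
Proof.
move=> mA; elim: S => [|i S ih]; first by rewrite !big_nil measure0.
rewrite !big_cons; apply: le_trans (measureU2 _ _ _) _ => //.
  exact: bigsetU_measurable.
by rewrite leeD2l.
Qed.

Lemma in_bigsetU (I : eqType) (S : seq I) (A : I -> set 'rV[R]_d) x :
  (\big[setU/set0]_(i <- S) A i) x <-> exists2 i, i \in S & A i x.
Proof.
elim: S => [|j S ih]; first by rewrite big_nil; split => // -[].
rewrite big_cons; split=> [[Ax|/ih[i iS Ai]]|[i]].
- by exists j => //; rewrite mem_head.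
- by exists i => //; rewrite inE iS orbT.
- rewrite inE => /orP[/eqP ->|iS] Ai; first by left.
  by right; apply/ih; exists i.
Qed.

Variables (G : 'I_d -> 'rV[R]_d -> R) (H : 'I_d -> 'I_d -> 'rV[R]_d -> R).
Hypothesis dG : forall i x xi (t : R),
  is_derive t 1 (fun s : R => G i (x + s *: xi))
    (\sum_j xi ord0 j * H i j (x + t *: xi)).
Hypothesis cH : forall i j, continuous (H i j).

Let phi x : R := \sum_i \sum_j `|H i j x|.

Let phi_ge0 x : 0 <= phi x.
Proof. by apply: sumr_ge0 => i _; apply: sumr_ge0. Qed.

Let cphi : continuous phi.
Proof.
apply: continuous_big => [|i _]; first exact: add_continuous.
apply: continuous_big => [|j _]; first exact: add_continuous.
by move=> x; apply: continuous_comp; [exact: cH|exact: norm_continuous].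
Qed.

(** The mean value inequality for the sup norm, where the rows of [H] are bounded
by [phi]. *)
Lemma gradient_segment_le i x y (s a : R) : `|y - x| <= s -> 0 <= s ->
  (forall z, `|z - x| <= s -> phi z <= a) -> `|G i y - G i x| <= s * a.
Proof.
move=> yx s0 phia.
have -> : y = x + (y - x) by rewrite addrC subrK.
apply: (@segment_le _ (fun t => \sum_j (y - x) ord0 j * H i j (x + t *: (y - x)))).
move=> t /andP[t0 t1]; rewrite (le_trans (ler_norm_sum _ _ _))//.
apply: (@le_trans _ _ (\sum_j s * `|H i j (x + t *: (y - x))|)).
  apply: ler_sum => j _; rewrite normrM ler_wpM2r//.
  by rewrite (le_trans _ yx)// coord_le_norm.
rewrite -mulr_sumr ler_wpM2l// (le_trans _ (phia (x + t *: (y - x)) _))//.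
  by rewrite [leRHS](bigD1 i)//= lerDl; apply: sumr_ge0 => k _; exact: sumr_ge0.
by rewrite addrAC subrr add0r normrZ ger0_norm// (le_trans _ yx)// ler_piMl.
Qed.

(** On a grid of mesh [s], the map [G] sends the part of [Gam] in one cube into a
cube of radius [s] times a local bound of [phi], that is of volume at most [2^d]
times the integral of the [d]-th power of this bound.  These images cover the
cube of slopes; [W] is the union of the grid cubes that meet [Gam]. *)
Lemma area_grid Gam (r s delta eta : R) n : 0 < s -> 2 * r <= s * n%:R ->
  0 <= delta -> 0 <= eta ->
  (forall x, Gam x -> forall i, `|x ord0 i| < r) ->
  (forall x z, Gam x -> `|z - x| <= s -> `|phi z - phi x| <= delta) ->
  (forall p : 'rV[R]_d, (forall i, `|p ord0 i| <= eta) ->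
    exists2 x, Gam x & forall i, G i x = p ord0 i) ->
  exists W : set 'rV[R]_d, [/\ measurable W, Gam `<=` W,
    (forall x, W x -> exists2 y, Gam y & `|x - y| <= s) &
    (((2 * eta) ^+ d)%:E <=
     (2 ^+ d)%:E * \int[mu]_(x in W) ((phi x + 2 * delta) ^+ d)%:E)%E].
Proof.
move=> s0 rn delta0 eta0 Gamr unif onto.
pose P (k : {ffun 'I_d -> 'I_n}) := `[< exists x, Gam x /\ gcube r s k x >].
pose S := [seq k <- enum {ffun 'I_d -> 'I_n} | P k].
have /choice[c cP] : forall k : {ffun 'I_d -> 'I_n}, exists x,
    k \in S -> Gam x /\ gcube r s k x.
  move=> k; have [|kS] := boolP (k \in S); last by exists 0.
  by rewrite mem_filter => /andP[/asboolP[x xP] _]; exists x.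
pose a k := phi (c k) + delta.
have a0 k : 0 <= a k by rewrite addr_ge0.
have phia k z : k \in S -> `|z - c k| <= s -> phi z <= a k.
  move=> kS zc; have := unif _ _ (cP k kS).1 zc.
  by rewrite ler_norml /a => /andP[_]; lra.
have aphi k z : k \in S -> `|z - c k| <= s -> a k <= phi z + 2 * delta.
  move=> kS zc; have := unif _ _ (cP k kS).1 zc.
  by rewrite ler_norml /a => /andP[+ _]; lra.
pose W := \big[setU/set0]_(k <- S) gcube r s k.
have mW : measurable W by apply: bigsetU_measurable => k _; exact: measurable_gcube.
have mf : measurable_fun setT (fun x => ((phi x + 2 * delta) ^+ d)%:E : \bar R).
  apply/measurable_EFinP; apply: measurable_funX; apply: measurable_funD => //.
  exact: measurable_fun_continuous_rV.
have f0 x : (0 <= ((phi x + 2 * delta) ^+ d)%:E)%E.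
  by rewrite lee_fin exprn_ge0// addr_ge0// mulr_ge0.
exists W; split => //.
    move=> x Gx; have [k kx] := gcube_cover s0 rn (Gamr x Gx).
    by apply/in_bigsetU; exists k => //; rewrite mem_filter mem_enum andbT; apply/asboolP; exists x.
  move=> x /in_bigsetU[k kS kx]; exists (c k); first exact: (cP k kS).1.
  exact: gcube_dist kx (cP k kS).2.
rewrite -(lebesgue_cbox 0 eta0).
pose p k : 'rV[R]_d := \row_i G i (c k).
apply: (@le_trans _ _ (mu (\big[setU/set0]_(k <- S) cbox (p k) (s * a k)))).
  apply: le_measure; rewrite ?inE//.
  - exact: measurable_cbox.
  - by apply: bigsetU_measurable => k _; exact: measurable_cbox.
  move=> q qB.
  have [|x Gx xq] := onto q.
    by move=> i; have := qB i; rewrite mxE in_itv/= sub0r add0r -ler_norml.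
  have [k kx] := gcube_cover s0 rn (Gamr x Gx).
  have kS : k \in S by rewrite mem_filter mem_enum andbT; apply/asboolP; exists x.
  apply/in_bigsetU; exists k => // i; rewrite in_itv/= -ler_distl -xq mxE.
  apply: gradient_segment_le => //; last by move=> z; exact: phia.
    exact: gcube_dist kx (cP k kS).2.
  exact: ltW.
apply: (le_trans (le_measure_bigsetU _ _)); first by move=> k; exact: measurable_cbox.
rewrite /W ge0_integral_bigsetU//; first last.
- exact: measurable_funTS.
- move=> k l _ _ [x [kx lx]]; exact: gcube_disj kx lx.
- by rewrite filter_uniq// enum_uniq.
- by move=> k; exact: measurable_gcube.
rewrite ge0_sume_distrr; last by move=> k _; apply: integral_ge0.
rewrite big_seq [leRHS]big_seq; apply: lee_sum => k kS.
rewrite lebesgue_cbox; last by rewrite mulr_ge0// ltW.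
rewrite exprMn EFinM; apply: lee_wpmul2l; first by rewrite lee_fin exprn_ge0.
apply: (@le_trans _ _ (\int[mu]_(x in gcube r s k) (cst ((a k) ^+ d)%:E) x)%E).
  rewrite integral_cst; last exact: measurable_gcube.
  by rewrite [X in (_ * X)%E]lebesgue_gcube// -EFinM exprMn mulrC.
apply: ge0_le_integral => //.
- exact: measurable_gcube.
- by move=> x _; rewrite lee_fin exprn_ge0.
- exact: measurable_funTS.
move=> x kx; rewrite lee_fin lerXn2r ?nnegrE//.
  by rewrite addr_ge0// mulr_ge0.
by apply: aphi => //; exact: gcube_dist kx (cP k kS).2.
Qed.

(** A crude form of the area formula, with a power of the entries of the
derivative in place of its determinant: it will only serve to bound the
measure of [Gam] from below.  As the mesh tends to zero the unions of grid
cubes shrink to the compact set [Gam]. *)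
Lemma area_bound Gam (eta : R) : compact Gam -> 0 <= eta ->
  (forall p : 'rV[R]_d, (forall i, `|p ord0 i| <= eta) ->
    exists2 x, Gam x & forall i, G i x = p ord0 i) ->
  (((2 * eta) ^+ d)%:E <= (2 ^+ d)%:E * \int[mu]_(x in Gam) ((phi x) ^+ d)%:E)%E.
Proof.
move=> cG eta0 onto.
have clG : closed Gam by apply: compact_closed => //; exact: norm_hausdorff.
have mG := compact_measurable_rV cG.
have [r r0 rG] := compact_bound_rV cG.
have rGi x : Gam x -> forall i, `|x ord0 i| < r.
  by move=> Gx i; exact: le_lt_trans (coord_le_norm _ _) (rG x Gx).
pose de (j : nat) : R := j.+1%:R^-1.
have de0 j : 0 < de j by rewrite invr_gt0.
have de1 j : de j <= 1 by rewrite invf_le1// ler1n.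
have /choice[W WP] : forall j, exists W : set 'rV[R]_d, [/\ measurable W, Gam `<=` W,
    (forall x, W x -> exists2 y, Gam y & `|x - y| <= de j) &
    (((2 * eta) ^+ d)%:E <=
     (2 ^+ d)%:E * \int[mu]_(x in W) ((phi x + 2 * de j) ^+ d)%:E)%E].
  move=> j; have [s s0 sP] := compact_unif_continuous cG cphi (de0 j).
  pose s' := Num.min s (de j).
  have s'0 : 0 < s' by rewrite lt_min s0 de0.
  pose n := (Num.truncn (2 * r / s')).+1.
  have rn : 2 * r <= s' * n%:R.
    have /andP[_] := Num.Theory.truncn_itv (divr_ge0 (mulr_ge0 (ler0n R 2) (ltW r0)) (ltW s'0)).
    by rewrite ltr_pdivrMr// -/n => /ltW; rewrite [leRHS]mulrC.
  have [|W [mW GW Wd WI]] := area_grid s'0 rn (ltW (de0 j)) eta0 rGi _ onto.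
    by move=> x z Gx zx; apply: sP => //; rewrite (le_trans zx)// ge_min lexx.
  exists W; split => // x /Wd[y Gy xy]; exists y => //.
  by rewrite (le_trans xy)// ge_min lexx orbT.
have [C C0 CP] : exists2 C, 0 <= C & forall x, cbox 0 (r + 1) x -> phi x + 2 <= C.
  have cB : compact (cbox 0 (r + 1)).
    have := @rV_compact R d (fun=> `[- (r + 1), r + 1]%classic)
      (fun=> @segment_compact R _ _).
    rewrite (_ : [set _ | _] = cbox 0 (r + 1))//.
    by apply/seteqP; split => x xB i; have := xB i; rewrite /= mxE sub0r add0r.
  have [] := @compact_EVT_max _ _ phi _ _ cB _.
  - by exists 0 => i; rewrite !mxE in_itv/= sub0r add0r oppr_le0 andbb addr_ge0// ltW.
  - exact: continuous_subspaceT.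
  move=> c _ cmax; exists (phi c + 2) => [|x Bx]; first by rewrite addr_ge0.
  by rewrite lerD2r; apply: cmax; rewrite inE.
have WB j x : W j x -> cbox 0 (r + 1) x.
  have [_ _ Wd _] := WP j; move=> /Wd[y Gy xy] i.
  rewrite mxE sub0r add0r in_itv/= -ler_norml.
  rewrite (le_trans (coord_le_norm _ _))// -(subrK y x) addrC (le_trans (ler_normD _ _))//.
  by rewrite lerD ?(ltW (rG y Gy))// (le_trans xy).
(* Dominated convergence: outside the closed set [Gam] the [f_ j] vanish eventually. *)
pose f_ j := (fun x => ((phi x + 2 * de j) ^+ d)%:E : \bar R) \_ (W j).
pose f := (fun x => (phi x ^+ d)%:E : \bar R) \_ Gam.
have mphi (c : R) : measurable_fun setT (fun x => ((phi x + c) ^+ d)%:E : \bar R).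
  apply/measurable_EFinP; apply: measurable_funX; apply: measurable_funD => //.
  exact: measurable_fun_continuous_rV.
have mf : measurable_fun setT f.
  apply/(measurable_restrictT _ _).1 => //; apply: measurable_funTS.
  by have := mphi 0; under eq_fun do rewrite addr0.
have mf_ j : measurable_fun setT (f_ j).
  have [mW _ _ _] := WP j.
  by apply/(measurable_restrictT _ _).1 => //; apply: measurable_funTS; exact: mphi.
pose g := (cst (C ^+ d)%:E : 'rV[R]_d -> \bar R) \_ (cbox 0 (r + 1)).
have f_f x : f_ ^~ x @ \oo --> f x.
  rewrite /f /f_ patchE; have [xG|xG] := boolP (x \in Gam).
    rewrite (_ : (fun j => _) = (fun j => ((phi x + 2 * de j) ^+ d)%:E)); last first.
      apply/funext => j; rewrite patchE mem_set//.
      by have [_ GW _ _] := WP j; apply: GW; rewrite inE in xG.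
    apply: cvg_EFin; first exact: nearW.
    apply: (@cvg_comp _ _ _ (fun j => phi x + 2 * de j) (fun t : R => t ^+ d) _ (nbhs (phi x))); last first.
      exact: exprn_continuous.
    have H0 : (fun j => phi x + 2 * de j) @ \oo --> phi x + 2 * 0.
      apply: cvgD; first exact: cvg_cst.
      apply: cvgM; [exact: cvg_cst|exact: cvg_harmonic].
    by rewrite mulr0 addr0 in H0.
  rewrite notin_setE in xG.
  have oG : open (~` Gam) by exact: closed_openC.
  have /nbhs_ballP[e /= e0 eG] := open_nbhs_nbhs (conj oG xG).
  apply: cvg_near_cst; near=> j; rewrite patchE memNset// => Wx.
  have [_ _ Wd _] := WP j; have [y Gy xy] := Wd x Wx.
  apply: (eG y) => //; rewrite -ball_normE/= (le_lt_trans xy)//.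
  by near: j; exact: (near_infty_natSinv_lt (PosNum e0)).
have ig : mu.-integrable setT g.
  apply/integrable_restrict => //; first exact: measurable_cbox.
  rewrite setTI; apply/integrableP; split; first exact: measurable_cst.
  rewrite [X in (X < _)%E](_ : _ =
      \int[mu]_(x in cbox 0 (r + 1)) (cst (C ^+ d)%:E) x)%E; last first.
    by apply: eq_integral => x _; rewrite gee0_abs// lee_fin exprn_ge0.
  rewrite integral_cst; last exact: measurable_cbox.
  by rewrite [X in (_ * X)%E]lebesgue_cbox ?addr_ge0 ?(ltW r0)// -EFinM ltry.
have f_g j x : (`|f_ j x| <= g x)%E.
  rewrite /f_ /g !patchE; case: ifPn => [|_].
    rewrite inE => Wx; rewrite mem_set; last exact: WB Wx.
    rewrite lee_fin ger0_norm ?exprn_ge0 ?addr_ge0// ?mulr_ge0 ?(ltW (de0 j))//.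
    rewrite lerXn2r ?nnegrE// ?addr_ge0// ?mulr_ge0 ?(ltW (de0 j))//.
    rewrite (le_trans _ (CP x (WB _ _ Wx)))// lerD2l ler_piMr//.
  by rewrite abse0; case: ifP => // _; rewrite lee_fin exprn_ge0.
have [intf _ cvf] := dominated_convergence measurableT mf_ mf
  (aeW _ (fun x _ => f_f x)) ig (aeW _ (fun x j _ => f_g j x)).
have IE : (\int[mu]_(x in Gam) ((phi x) ^+ d)%:E = \int[mu]_x f x)%E.
  by rewrite integral_mkcond.
have IjE j : (((2 * eta) ^+ d)%:E <= (2 ^+ d)%:E * \int[mu]_x f_ j x)%E.
  by have [_ _ _ ] := WP j; rewrite integral_mkcond.
rewrite IE.
have cv2 : (fun j => (2 ^+ d)%:E * \int[mu]_x f_ j x)%E @ \oo -->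
   ((2 ^+ d)%:E * \int[mu]_x f x)%E by apply: cvgeZl.
by apply: (cvge_ge _ cv2); apply: nearW.
Unshelve. all: by end_near. Qed.

End area.

(** * Mollification *)
Section mollify.
Context (R : realType) (d : nat).
Local Notation mu := (lebesgue_rV R d).
Implicit Types (h : R) (f g : 'rV[R]_d -> R) (x z xi : 'rV[R]_d) (m : 'I_d -> nat).

Lemma integrable_bounded_support f (c : 'rV[R]_d) (a C : R) :
  measurable_fun setT f -> 0 <= a -> (forall z, `|f z| <= C) ->
  (forall z, ~ cbox c a z -> f z = 0) -> mu.-integrable setT (EFin \o f).
Proof.
move=> mf a0 fC f0.
have := @measurable_bounded_integrable _ _ R mu f (cbox c a) (measurable_cbox c a).
move=> H; have {H} H : mu.-integrable (cbox c a) (EFin \o f).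
  apply: H; first by rewrite [ltLHS]lebesgue_cbox// ltry.
    exact: measurable_funTS.
  exists C; split; [exact: num_real|move=> M CM z _].
  exact: le_trans (fC z) (ltW CM).
have mE : measurable_fun setT (EFin \o f) by exact/measurable_EFinP.
rewrite (_ : EFin \o f = (EFin \o f) \_ (cbox c a)).
  by apply/integrable_restrict => //; [exact: measurable_cbox|rewrite setTI].
apply/funext => z; rewrite patchE; case: ifPn => //; rewrite notin_setE => /f0.
by rewrite /= => ->.
Qed.

Lemma mbump_support h m x z : 0 < h -> ~ cbox x h z -> mbump h m (z - x) = 0.
Proof.
move=> h0 zB; have [[i hi]|nh] := pselect (exists i, h <= `|(z - x) ord0 i|).
  exact: mbump_out hi.
exfalso; apply: zB => i; rewrite in_itv/= -ler_distl; apply/ltW; rewrite ltNge.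
by apply/negP => hi; apply: nh; exists i; rewrite !mxE.
Qed.

Lemma measurable_mbump_shift h m x : measurable_fun setT (fun z => mbump h m (z - x)).
Proof. exact: (measurableT_comp (measurable_mbump_sub h m) (pair1_measurable x)). Qed.

Definition mollify h m f x : R := \int[mu]_z (f z * mbump h m (z - x)).

Lemma integrable_mollify h m f x (M : R) : 0 < h -> measurable_fun setT f ->
  (forall z, `|f z| <= M) ->
  mu.-integrable setT (EFin \o (fun z => f z * mbump h m (z - x))).
Proof.
move=> h0 mf fM; have [C C0 bC] := @mbump_le R d h m.
apply: (@integrable_bounded_support _ x h (M * C)).
- by apply: measurable_funM => //; exact: measurable_mbump_shift.
- exact: ltW.
- by move=> z; rewrite normrM ler_pM.
- by move=> z zB; rewrite mbump_support// mulr0.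
Qed.

Lemma mollify_le h m f (M : R) : 0 < h -> measurable_fun setT f ->
  (forall z, `|f z| <= M) -> exists2 C, 0 <= C & forall x, `|mollify h m f x| <= C.
Proof.
move=> h0 mf fM; have [C C0 bC] := @mbump_le R d h m.
have M0 : 0 <= M by exact: le_trans (fM 0).
exists (M * C * (2 * h) ^+ d) => [|x].
  by rewrite !mulr_ge0// exprn_ge0// mulr_ge0// ltW.
have int := integrable_mollify m x h0 mf fM.
rewrite (le_trans (le_normr_Rintegral _ int))//.
rewrite -lee_fin /Rintegral fineK; last first.
  by apply: integrable_fin_num => //; exact: integrable_norm.
rewrite [leRHS](_ : _ = \int[mu]_(z in cbox x h) (cst (M * C)%:E) z)%E; last first.
  rewrite integral_cst; last exact: measurable_cbox.
  by rewrite [X in (_ * X)%E]lebesgue_cbox ?ltW// EFinM.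
rewrite [leRHS]integral_mkcond; apply: ge0_le_integral => //.
- by apply/measurable_EFinP; apply: measurableT_comp => //; apply: measurable_funM => //;
    exact: measurable_mbump_shift.
- apply/(measurable_restrictT _ _).1; first exact: measurable_cbox.
  exact: measurable_cst.
move=> z _; rewrite patchE; case: ifPn => [_|].
  by rewrite lee_fin normrM ler_pM.
by rewrite notin_setE => /(mbump_support m h0) ->; rewrite mulr0 normr0.
Qed.

Lemma Rintegral_sum (I : Type) (s : seq I) (F : I -> 'rV[R]_d -> R) :
  (forall i, mu.-integrable setT (EFin \o F i)) ->
  \int[mu]_z (\sum_(i <- s) F i z) = \sum_(i <- s) \int[mu]_z F i z.
Proof.
move=> intF; elim: s => [|i s ih].
  rewrite big_nil /Rintegral; under eq_integral do rewrite big_nil.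
  by rewrite integral0.
rewrite big_cons -ih -RintegralD//; first by apply: eq_Rintegral => z _; rewrite big_cons.
rewrite (_ : EFin \o _ = (fun z => \sum_(i <- s) (EFin \o F i) z)%E); last first.
  by apply/funext => z /=; rewrite sumEFin.
exact: integrable_sum.
Qed.

(** Differentiation under the integral; the sign is that of [x] in [z - x]. *)
Lemma is_derive_mollify h m f (M : R) x xi (t : R) : 0 < h -> measurable_fun setT f ->
  (forall z, `|f z| <= M) ->
  is_derive t (1 : R) (fun s : R => mollify h m f (x + s *: xi))
    (\sum_j xi ord0 j * - mollify h (mincr m j) f (x + t *: xi)).
Proof.
move=> h0 mf fM.
have M0 : 0 <= M by exact: le_trans (fM 0).
pose F (s : R) z := f z * mbump h m (z - (x + s *: xi)).
pose dF (s : R) z := \sum_j xi ord0 j * - (f z * mbump h (mincr m j) (z - (x + s *: xi))).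
have FdF (s : R) z : is_derive s (1 : R) (F ^~ z) (dF s z).
  have := is_derive_mbump h m (z - x) (- xi) s.
  move=> /(is_deriveZ (f z)); rewrite /F.
  rewrite (_ : _ \*: _ = (fun s : R => f z * mbump h m (z - (x + s *: xi)))); last first.
    by apply/funext => r /=; rewrite scalerN opprD addrA.
  move=> /is_derive_eq; apply.
  rewrite /dF [LHS]mulr_sumr; apply: eq_bigr => j _.
  by rewrite mxE scalerN opprD addrA; ring.
have /choice[C CP] : forall j, exists C, 0 <= C /\ forall y : 'rV[R]_d, `|mbump h (mincr m j) y| <= C.
  by move=> j; have [C C0 bC] := @mbump_le R d h (mincr m j); exists C.
pose c := \sum_j `|xi ord0 j| * (M * C j).
have c0 : 0 <= c by apply: sumr_ge0 => j _; rewrite !mulr_ge0//; have [] := CP j.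
pose rho := h + (`|t| + 1) * `|xi|.
have rho0 : 0 <= rho.
  by apply: addr_ge0; [exact: ltW|apply: mulr_ge0 => //; exact: addr_ge0].
pose G z : R := c * \1_(cbox x rho) z.
have G0 z : 0 <= G z by rewrite mulr_ge0.
have intG : mu.-integrable setT (EFin \o G).
  apply: (@integrable_bounded_support _ x rho c) => //.
  - by apply: measurable_funM => //; apply: measurable_indic; exact: measurable_cbox.
  - move=> z; rewrite /G normrM (ger0_norm c0) ler_piMr// indicE.
    by case: (_ \in _); rewrite ?normr1 ?normr0.
  - by move=> z zB; rewrite /G indicE memNset// mulr0.
have Itt : `]t - 1, t + 1[%classic t.
  by rewrite /= in_itv/= ltrBlDr ltrDl ltr01.
have derF : forall s z, `]t - 1, t + 1[%classic s -> setT z -> derivable (F ^~ z) s 1.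
  by move=> s z _ _; have [] := FdF s z.
have d1E s z : partial1of2 F s z = dF s z.
  by rewrite partial1of2E; have [_ ->] := FdF s z.
have Gub : forall s z, `]t - 1, t + 1[%classic s -> setT z -> `|partial1of2 F s z| <= G z.
  move=> s z; rewrite /= in_itv/= => /andP[ts st] _; rewrite d1E.
  have s1 : `|s| <= `|t| + 1.
    rewrite -(subrK t s) addrC (le_trans (ler_normD _ _))// lerD2l ler_norml.
    by apply/andP; split; lra.
  rewrite /G indicE; have [zB|zB] := boolP (z \in cbox x rho).
    rewrite mulr1 /dF (le_trans (ler_norm_sum _ _ _))//; apply: ler_sum => j _.
    by rewrite normrM normrN normrM ler_wpM2l// ler_pM// (CP j).2.
  rewrite mulr0 /dF big1 ?normr0// => j _.
  rewrite mbump_support ?mulr0 ?oppr0 ?mulr0// => zB'.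
  rewrite notin_setE in zB; apply: zB => i; have := zB' i.
  rewrite !in_itv/= -!ler_distl !mxE => zi.
  have -> : z ord0 i - x ord0 i = (z ord0 i - (x ord0 i + s * xi ord0 i)) + s * xi ord0 i.
    by ring.
  rewrite (le_trans (ler_normD _ _))// /rho lerD// normrM ler_pM//.
  exact: coord_le_norm.
have intF s : `]t - 1, t + 1[%classic s -> mu.-integrable setT (EFin \o F s).
  by move=> _; exact: integrable_mollify h0 mf fM.
have D := derivable_under_integral measurableT Itt intF derF G0 intG Gub.
have E := differentiation_under_integral measurableT Itt intF derF G0 intG Gub.
apply: DeriveDef; first exact: D.
rewrite derive1E in E; rewrite [LHS]E.
under eq_Rintegral do rewrite d1E.
rewrite /dF Rintegral_sum; last first.
  move=> j; have := integrable_mollify (mincr m j) (x + t *: xi) h0 mf fM.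
  move=> /(integrableZl measurableT (- xi ord0 j)); apply: eq_integrable => // z _ /=.
  by rewrite -EFinM; congr EFin; ring.
apply: eq_bigr => j _; rewrite /mollify mulrN -mulNr.
rewrite -RintegralZl//; last exact: integrable_mollify h0 mf fM.
by apply: eq_Rintegral => z _; rewrite mulNr mulrN.
Qed.

(** The first derivatives being bounded, the mollification is Lipschitz. *)
Lemma continuous_mollify h m f (M : R) : 0 < h -> measurable_fun setT f ->
  (forall z, `|f z| <= M) -> continuous (mollify h m f).
Proof.
move=> h0 mf fM.
have /choice[C CP] : forall j, exists C, 0 <= C /\ forall x, `|mollify h (mincr m j) f x| <= C.
  by move=> j; have [C C0 bC] := mollify_le (mincr m j) h0 mf fM; exists C.
have C0 : 0 <= \sum_j C j by apply: sumr_ge0 => j _; have [] := CP j.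
have lip x y : `|mollify h m f y - mollify h m f x| <= `|y - x| * \sum_j C j.
  have -> : y = x + (y - x) by rewrite addrC subrK.
  apply: (@segment_le _ _ _ (fun t => \sum_j (y - x) ord0 j * - mollify h (mincr m j) f (x + t *: (y - x)))).
    by move=> t; exact: is_derive_mollify h0 mf fM.
  move=> t _; rewrite (le_trans (ler_norm_sum _ _ _))// addrAC subrr add0r mulr_sumr.
  by apply: ler_sum => j _; rewrite normrM normrN ler_pM ?coord_le_norm// (CP j).2.
move=> x; apply: (@cvgrPdist_le _ _ _ (nbhs x) _ (mollify h m f) (mollify h m f x)).2 => e e0.
have eC : 0 < e / (\sum_j C j + 1) by rewrite divr_gt0// ltr_wpDl.
near=> y; rewrite distrC; apply: le_trans (lip x y) _.
apply: (@le_trans _ _ (e / (\sum_j C j + 1) * \sum_j C j)); last first.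
  by rewrite mulrAC -mulrA ler_piMr ?(ltW e0)// ler_pdivrMr ?mul1r ?lerDl// ltr_wpDl.
apply: ler_wpM2r; first exact: C0.
rewrite distrC ltW//.
Unshelve. all: by end_near. Qed.

Local Notation k h x z := (mbump h (fun=> 0%N) (z - x)).
Local Notation m0 := (fun=> 0%N).

Lemma integrable_mul_mbump h m f x : mu.-integrable setT (EFin \o f) ->
  mu.-integrable setT (EFin \o (fun z => f z * mbump h m (z - x))).
Proof.
move=> intf; have [C C0 bC] := @mbump_le R d h m.
have mf : measurable_fun setT f by apply/measurable_EFinP; exact: measurable_int intf.
apply: (le_integrable measurableT _ _ (integrableZl measurableT C intf)).
  by apply/measurable_EFinP; apply: measurable_funM => //; exact: measurable_mbump_shift.
move=> z _; rewrite /= lee_fin normrM mulrC normrM ler_wpM2r//.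
by rewrite (le_trans (bC _))// ler_norm.
Qed.

Lemma mollify_norm_le h f x : measurable_fun setT f ->
  mu.-integrable setT (EFin \o (fun z => f z * k h x z)) ->
  (`|mollify h m0 f x|%:E <= \int[mu]_z (`|f z| * k h x z)%:E)%E.
Proof.
move=> mf int; have := le_normr_Rintegral measurableT int.
rewrite -lee_fin => /le_trans; apply.
rewrite /Rintegral fineK; last first.
  by apply: integrable_fin_num => //; exact: integrable_norm.
rewrite le_eqVlt; apply/orP; left; apply/eqP.
by apply: eq_integral => z _; rewrite normrM (ger0_norm (mbump0_ge0 _ _)).
Qed.

(** As the kernel has integral one, [f x] is its own average. *)
Lemma mollify_dist_le h f x : 0 < h -> measurable_fun setT f ->
  mu.-integrable setT (EFin \o (fun z => f z * k h x z)) ->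
  (`|mollify h m0 f x - f x|%:E <= \int[mu]_z (`|f z - f x| * k h x z)%:E)%E.
Proof.
move=> h0 mf int.
have int2 : mu.-integrable setT (EFin \o (fun z => f x * k h x z)).
  by apply: (integrable_mollify _ _ h0 (@measurable_cst _ _ _ _ _ (f x)) (M := `|f x|)).
have E : mollify h m0 (fun z => f z - f x) x = mollify h m0 f x - f x.
  rewrite /mollify; under eq_Rintegral do rewrite mulrBl.
  rewrite RintegralB//; congr (_ - _).
  have [fx0|fx0] := leP 0 (f x).
    by rewrite /Rintegral integral_kernel.
  transitivity (- \int[mu]_z (- f x * k h x z)).
    rewrite -mulN1r -RintegralZl//; first by apply: eq_Rintegral => z _; ring.
    have := integrableN int2; apply: eq_integrable => // z _ /=.
    by rewrite mulNr.
  by rewrite /Rintegral integral_kernel ?opprK// oppr_ge0 ltW.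
rewrite -E; apply: mollify_norm_le; first exact: measurable_funB.
have := integrableB measurableT int int2; apply: eq_integrable => // z _ /=.
by rewrite mulrBl.
Qed.

Lemma mollify_near h f (M e : R) x : 0 < h -> measurable_fun setT f ->
  (forall z, `|f z| <= M) -> 0 <= e ->
  (forall z, `|z - x| <= h -> `|f z - f x| <= e) ->
  `|mollify h m0 f x - f x| <= e.
Proof.
move=> h0 mf fM e0 fe; rewrite -lee_fin.
apply: le_trans (mollify_dist_le h0 mf (integrable_mollify _ _ h0 mf fM)) _.
rewrite -[leRHS](integral_kernel x h0 e0); apply: ge0_le_integral => //.
- by move=> z _; rewrite lee_fin norm_kernel_ge0.
- exact: measurable_osc1.
- apply/measurable_EFinP; apply: measurable_funM => //.
  exact: measurable_mbump_shift.
move=> z _; rewrite lee_fin; have [zx|zx] := leP `|z - x| h.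
  by apply: ler_wpM2r; [exact: mbump0_ge0|exact: fe].
by rewrite mbump_out_norm ?mulr0// ltW.
Qed.

(** Convexity of the power [n.+1] in the form of the tangent line inequality. *)
Lemma pow_tangent (n : nat) (a g : R) : 0 <= a -> 0 <= g ->
  n.+1%:R * a ^+ n * g <= g ^+ n.+1 + n%:R * a ^+ n.+1.
Proof.
move=> a0 g0; elim: n => [|n ih]; first by rewrite mul0r addr0 expr0 expr1 !mul1r.
have := ler_wpM2r g0 ih; have := mulr_ge0 (mulr_ge0 (ler0n R n.+1) (exprn_ge0 n a0)) (sqr_ge0 (g - a)).
rewrite !exprS -!natr1 expr0 mulr1; move: (a ^+ n) (g ^+ n) => A B H1 H2.
by rewrite -subr_ge0; apply: le_trans (addr_ge0 H1 (etrans (subr_ge0 _ _) H2)) _;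
  rewrite le_eqVlt; apply/orP; left; apply/eqP; ring.
Qed.

(** Jensen's inequality for the probability kernel, for a lower bound [a] of an
average that may be infinite: integrate [pow_tangent]. *)
Lemma kernel_jensen n h (g : 'rV[R]_d -> R) x (a : R) : 0 < h -> 0 <= a ->
  measurable_fun setT g -> (forall z, 0 <= g z) ->
  (a%:E <= \int[mu]_z (g z * k h x z)%:E)%E ->
  ((a ^+ n)%:E <= \int[mu]_z (g z ^+ n * k h x z)%:E)%E.
Proof.
move=> h0 a0 mg g0 ag; case: n => [|n].
  by under eq_integral do rewrite expr0; rewrite integral_kernel// expr0.
have mk := measurable_mbump_shift h m0 x.
have mgk : measurable_fun setT (fun z => (g z * k h x z)%:E).
  by apply/measurable_EFinP; exact: measurable_funM.
have mgnk : measurable_fun setT (fun z => (g z ^+ n.+1 * k h x z)%:E).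
  by apply/measurable_EFinP; apply: measurable_funM => //; exact: measurable_funX.
have mak : measurable_fun setT (fun z => (n%:R * a ^+ n.+1 * k h x z)%:E).
  by apply/measurable_EFinP; exact: measurable_funM.
have c0 : 0 <= n.+1%:R * a ^+ n by rewrite mulr_ge0// exprn_ge0.
have ca0 : 0 <= n%:R * a ^+ n.+1 by rewrite mulr_ge0// exprn_ge0.
have H : ((n.+1%:R * a ^+ n)%:E * a%:E <=
    \int[mu]_z (g z ^+ n.+1 * k h x z)%:E + (n%:R * a ^+ n.+1)%:E)%E.
  apply: (@le_trans _ _ ((n.+1%:R * a ^+ n)%:E * \int[mu]_z (g z * k h x z)%:E)%E).
    by apply: lee_wpmul2l.
  rewrite -ge0_integralZl//; last by move=> z _; rewrite lee_fin mulr_ge0 ?mbump0_ge0.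
  rewrite -[X in (_ + X)%E](integral_kernel x h0 ca0) -ge0_integralD//; last 2 first.
  - by move=> z _; rewrite lee_fin mulr_ge0 ?mbump0_ge0// exprn_ge0.
  - by move=> z _; rewrite lee_fin mulr_ge0 ?mbump0_ge0.
  apply: ge0_le_integral => //.
  - by move=> z _; rewrite -EFinM lee_fin !mulr_ge0 ?mbump0_ge0// exprn_ge0.
  - exact: measurable_funeM.
  - exact: emeasurable_funD.
  move=> z _; rewrite -EFinM -EFinD lee_fin -mulrDl mulrA.
  by apply: ler_wpM2r; [exact: mbump0_ge0|exact: pow_tangent].
rewrite -(@leeD2rE _ (n%:R * a ^+ n.+1)%:E)// (le_trans _ H)//.
rewrite -EFinD -EFinM lee_fin -mulrA -exprSr -[n.+1%:R]natr1.
by rewrite mulrDl mul1r addrC.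
Qed.

(** The definition of weak derivatives, tested on the kernel, passes the derivatives
of the kernel to [u], each with a change of sign.  Replacing [g] by [g'] permits
a cutoff away from [x]. *)
Lemma mollify_weak (s : seq 'I_d) (D : set 'rV[R]_d) (u g g' : 'rV[R]_d -> R) h x :
  0 < h -> weak_partials D s u g -> (forall z, `|z - x| <= h -> D z) ->
  (forall z, `|z - x| <= h -> g z = g' z) ->
  mollify h (foldr (fun i m => mincr m i) m0 s) u x = (-1) ^+ size s * mollify h m0 g' x.
Proof.
move=> h0 wp xD gg'.
have := wp _ (test_function_mbump h0 xD).
have E m (f : 'rV[R]_d -> R) :
    \int[mu]_(z in D) (f z * mbump h m (z - x)) = mollify h m f x.
  rewrite Rintegral_mkcond /mollify; apply: eq_Rintegral => z _.
  rewrite patchE; case: ifPn => //; rewrite notin_setE => nD.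
  rewrite mbump_out_norm ?mulr0// ltW// ltNge; apply/negP => zx; exact/nD/xD.
rewrite partials_mbump E E => ->; congr (_ * _).
apply: eq_Rintegral => z _; have [zx|zx] := leP `|z - x| h.
  by rewrite gg'.
by rewrite mbump_out_norm ?mulr0// ltW.
Qed.

End mollify.

(** * The trace inequality *)
Section trace.
Context (R : realFieldType).

Definition qform n (q : 'I_n -> 'I_n -> R) (xi : 'I_n -> R) : R :=
  \sum_i \sum_j q i j * xi i * xi j.

Definition mdot n (q H : 'I_n -> 'I_n -> R) : R := \sum_i \sum_j q i j * H i j.

Lemma double_sum_recl n (F : 'I_n.+1 -> 'I_n.+1 -> R) :
  \sum_i \sum_j F i j = F ord0 ord0 + \sum_j (F ord0 (lift ord0 j) + F (lift ord0 j) ord0)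
    + \sum_i \sum_j F (lift ord0 i) (lift ord0 j).
Proof.
rewrite big_ord_recl big_ord_recl big_split/= -!addrA; congr (_ + (_ + _)).
rewrite -big_split/=; apply: eq_bigr => i _.
by rewrite big_ord_recl.
Qed.

Definition fcons n (t : R) (xi : 'I_n -> R) (i : 'I_n.+1) : R :=
  if unlift ord0 i is Some j then xi j else t.

Lemma fcons0 n t (xi : 'I_n -> R) : fcons t xi ord0 = t.
Proof. by rewrite /fcons unlift_none. Qed.

Lemma fconsS n t (xi : 'I_n -> R) j : fcons t xi (lift ord0 j) = xi j.
Proof. by rewrite /fcons liftK. Qed.

Lemma qform_fcons n (q : 'I_n.+1 -> 'I_n.+1 -> R) t xi :
  (forall i j, q i j = q j i) ->
  qform q (fcons t xi) = q ord0 ord0 * t ^+ 2 +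
    2 * t * (\sum_j q ord0 (lift ord0 j) * xi j) +
    qform (fun i j => q (lift ord0 i) (lift ord0 j)) xi.
Proof.
move=> qS; rewrite /qform double_sum_recl fcons0; congr (_ + _ + _).
- by rewrite expr2 mulrA.
- rewrite mulr_sumr; apply: eq_bigr => j _.
  by rewrite fconsS (qS _ ord0); ring.
- by apply: eq_bigr => i _; apply: eq_bigr => j _; rewrite !fconsS.
Qed.

Lemma sum_sqr_fcons n t (xi : 'I_n -> R) :
  \sum_i fcons t xi i ^+ 2 = t ^+ 2 + \sum_i xi i ^+ 2.
Proof.
rewrite big_ord_recl fcons0; congr (_ + _).
by apply: eq_bigr => i _; rewrite fconsS.
Qed.

Lemma qform_rank1 n (b xi : 'I_n -> R) :
  \sum_i \sum_j b i * b j * xi i * xi j = (\sum_j b j * xi j) ^+ 2.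
Proof.
rewrite expr2 mulr_suml; apply: eq_bigr => i _.
by rewrite mulr_sumr; apply: eq_bigr => j _; ring.
Qed.

(** Lagrange reduction: eliminating the first variable from the positive definite
[q] leaves its Schur complement [S'], which is bounded below by the same
[gamma], and the trace is that of the smaller matrices plus a multiple of the
value of [H] at the first row of [q]. *)
Lemma mdot_le0_sym n (q H : 'I_n -> 'I_n -> R) (gamma : R) : 0 < gamma ->
  (forall i j, q i j = q j i) -> (forall i j, H i j = H j i) ->
  (forall xi, gamma * \sum_i xi i ^+ 2 <= qform q xi) ->
  (forall xi, qform H xi <= 0) -> mdot q H <= 0.
Proof.
move=> gamma0; elim: n q H => [|n ih] q H qS HS qP HN.
  by rewrite /mdot big_ord0.
pose a := q ord0 ord0; pose b (j : 'I_n) := q ord0 (lift ord0 j).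
pose S (i j : 'I_n) := q (lift ord0 i) (lift ord0 j).
have a0 : 0 < a.
  have := qP (fcons 1 (fun=> 0)).
  rewrite sum_sqr_fcons qform_fcons// /qform !big1 => [| i _| i _| i _].
  - by rewrite expr1n mulr0 !addr0 !mulr1; exact: lt_le_trans.
  - by rewrite big1// => j _; rewrite mulr0.
  - by rewrite mulr0.
  - by rewrite expr0n.
have a1 : a != 0 by rewrite gt_eqF.
pose S' (i j : 'I_n) := S i j - b i * b j / a.
pose H' (i j : 'I_n) := H (lift ord0 i) (lift ord0 j).
have S'S i j : S' i j = S' j i by rewrite /S' /S qS [b i * _]mulrC.
have H'S i j : H' i j = H' j i by rewrite /H' HS.
have S'P xi : gamma * \sum_i xi i ^+ 2 <= qform S' xi.
  pose beta := \sum_j b j * xi j.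
  have := qP (fcons (- (beta / a)) xi).
  rewrite sum_sqr_fcons qform_fcons// -/a -/beta -/(qform S xi).
  have -> : qform S' xi = qform S xi - beta ^+ 2 / a.
    rewrite /qform -qform_rank1 mulr_suml -sumrB; apply: eq_bigr => i _.
    by rewrite mulr_suml -sumrB; apply: eq_bigr => j _; rewrite /S'; ring.
  have -> : a * (- (beta / a)) ^+ 2 + 2 * - (beta / a) * beta + qform S xi
    = qform S xi - beta ^+ 2 / a by field.
  have g2 : 0 <= gamma * (- (beta / a)) ^+ 2 by rewrite mulr_ge0 ?sqr_ge0// ltW.
  by rewrite mulrDr; apply: le_trans; rewrite lerDr.
have IH : mdot S' H' <= 0.
  apply: ih => // xi; have := HN (fcons 0 xi).
  by rewrite qform_fcons// expr0n/= !mulr0 mul0r !add0r.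
have := HN (fcons a b); rewrite qform_fcons// -/(qform H' b).
set Q := (X in X <= 0) => Q0.
have -> : mdot q H = mdot S' H' + a^-1 * Q.
  rewrite /mdot double_sum_recl.
  have -> : \sum_i \sum_j S' i j * H' i j = \sum_i \sum_j S i j * H' i j - a^-1 * qform H' b.
    rewrite mulr_sumr -sumrB; apply: eq_bigr => i _.
    by rewrite mulr_sumr -sumrB; apply: eq_bigr => j _; rewrite /S'; ring.
  have -> : \sum_(j < n) (q ord0 (lift ord0 j) * H ord0 (lift ord0 j) +
      q (lift ord0 j) ord0 * H (lift ord0 j) ord0) =
      2 * \sum_(j < n) H ord0 (lift ord0 j) * b j.
    by rewrite mulr_sumr; apply: eq_bigr => j _; rewrite (qS _ ord0) (HS _ ord0) /b; ring.
  by rewrite /Q -/a; move: (\sum_(j < n) _) (qform _ _) (\sum_i _) => X Y Z; field.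
have aQ : a^-1 * Q <= 0 by rewrite pmulr_rle0// invr_gt0.
by move: IH aQ; lra.
Qed.

(** Against the symmetric [H] only the symmetric part of [q] counts. *)
Lemma mdot_le0 n (q H : 'I_n -> 'I_n -> R) (gamma : R) : 0 < gamma ->
  (forall i j, H i j = H j i) ->
  (forall xi, gamma * \sum_i xi i ^+ 2 <= qform q xi) ->
  (forall xi, qform H xi <= 0) -> mdot q H <= 0.
Proof.
move=> gamma0 HS qP HN.
pose q' i j := (q i j + q j i) / 2.
have qT (F : 'I_n -> 'I_n -> R) : (forall i j, F i j = F j i) ->
    \sum_i \sum_j q j i * F i j = \sum_i \sum_j q i j * F i j.
  by move=> FS; rewrite exchange_big; apply: eq_bigr => i _; apply: eq_bigr => j _; rewrite FS.
have q'E (F : 'I_n -> 'I_n -> R) : (forall i j, F i j = F j i) ->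
    \sum_i \sum_j q' i j * F i j = \sum_i \sum_j q i j * F i j.
  move=> FS; transitivity (2^-1 * (\sum_i \sum_j q i j * F i j + \sum_i \sum_j q j i * F i j)).
    rewrite -big_split mulr_sumr; apply: eq_bigr => i _ /=.
    by rewrite -big_split mulr_sumr; apply: eq_bigr => j _ /=; rewrite /q'; ring.
  by rewrite qT//; field.
rewrite /mdot -q'E//; apply: (mdot_le0_sym gamma0) => //.
  by move=> i j; rewrite /q' addrC.
move=> xi; rewrite (le_trans (qP xi))// /qform.
under eq_bigr do under eq_bigr do rewrite -mulrA.
under [leRHS]eq_bigr do under eq_bigr do rewrite -mulrA.
by rewrite q'E// => i j; rewrite mulrC.
Qed.

End trace.

(** * Limsup sets, second-order conditions and integrable powers *)
Section limits.
Context (R : realType).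

(** In a set of finite measure, the limsup of sets of measure at least [c] has
measure at least [c], hence is not covered by a null set. *)
Lemma lim_sup_set_pos dT (T : measurableType dT) (mu : {measure set T -> \bar R})
    (A : nat -> set T) (K : set T) (c : R) (Z : set T) :
  0 < c -> measurable K -> (mu K < +oo)%E ->
  (forall j, measurable (A j)) -> (forall j, A j `<=` K) ->
  (forall j, (c%:E <= mu (A j))%E) -> mu.-negligible Z ->
  exists2 x, ~ Z x & forall J, exists2 j, (J <= j)%N & A j x.
Proof.
move=> c0 mK Koo mA AK cA [N [mN N0 ZN]].
have mU n : measurable (\bigcup_(k >= n) A k) by exact: bigcup_measurable.
have cv := @lim_sup_set_cvg _ _ _ mu A mA.
have {}cv : mu (\bigcup_(k >= n) A k) @[n --> \oo] --> mu (lim_sup_set A).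
  apply: cv; rewrite (le_lt_trans _ Koo)// le_measure ?inE//.
  by move=> x [j _ /AK].
have cL : (c%:E <= mu (lim_sup_set A))%E.
  apply: (cvge_ge _ cv); apply: nearW => n; apply: le_trans (cA n) _.
  rewrite le_measure ?inE//.
  by move=> x Ax; exists n => /=.
have [x [Lx nZx]] : exists x, lim_sup_set A x /\ ~ Z x.
  apply: contrapT => nx.
  have LN : lim_sup_set A `<=` N.
    by move=> x Lx; apply: ZN; apply: contrapT => nZx; apply: nx; exists x.
  have : (mu (lim_sup_set A) <= mu N)%E.
    rewrite le_measure ?inE//.
    apply: bigcap_measurable; first by exists 0%N.
    by move=> k _; exact: bigcup_measurable.
  by rewrite N0 => /(le_trans cL); rewrite lee_fin leNgt c0.
by exists x => // J; have [j /= Jj Ajx] := Lx J I; exists j.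
Qed.

(** If [c] were positive, [g1] would exceed [g1 0] right after [0] and, by the mean
value theorem, [g] would rise above its tangent. *)
Lemma second_order_max (g g1 : R -> R) (c rho : R) :
  (forall t : R, is_derive t 1 g (g1 t)) -> is_derive (0 : R) (1 : R) g1 c ->
  0 < rho -> (forall t, 0 < t < rho -> g t <= g 0 + t * g1 0) -> c <= 0.
Proof.
move=> dg [dg1 g1c] rho0 gle; rewrite leNgt; apply/negP => c0.
have := dg1; rewrite /derivable => /cvg_ex[/= l].
have lE : (fun h : R => h^-1 *: (g1 (h *: 1 + 0) - g1 0)) @ 0^' --> l -> l = c.
  by move=> hl; rewrite -g1c; apply/esym/cvg_lim.
move=> /[dup] /lE -> {l lE} cv.
have : \forall h \near (0 : R)^', 0 < h^-1 *: (g1 (h *: 1 + 0) - g1 0).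
  exact: (cvgr_gt _ cv).
move=> /nbhs_ballP[r /= r0 rP].
pose t := Num.min r rho / 2.
have m0 : 0 < Num.min r rho by rewrite lt_min r0.
have t0 : 0 < t by rewrite divr_gt0.
have tm : t < Num.min r rho by rewrite ltr_pdivrMr// ltr_pMr// ltr1n.
have cg : {within `[0, t], continuous g}.
  apply: continuous_subspaceT => s; apply/differentiable_continuous/derivable1_diffP.
  by have [] := dg s.
have [s] := MVT t0 (fun s _ => dg s) cg.
rewrite in_itv/= subr0 => /andP[s0 st] gE.
have := gle t; rewrite t0 (lt_le_trans tm) ?ge_min ?lexx ?orbT// => /(_ isT).
rewrite -lerBlDl gE mulrC ler_pM2l// leNgt => /negP; apply.
have := rP s; rewrite -ball_normE/= sub0r normrN gtr0_norm// => sP.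
have := sP _ _; rewrite /GRing.scale/= mulr1 addr0 pmulr_rgt0 ?invr_gt0// subr_gt0; apply.
  by rewrite (lt_trans st)// (lt_le_trans tm)// ge_min lexx.
by rewrite gt_eqF.
Qed.

Context (d : nat).
Local Notation mu := (lebesgue_rV R d).

Lemma compact_lebesgue_rV_lty (K : set 'rV[R]_d) : compact K -> (mu K < +oo)%E.
Proof.
move=> cK; have [r r0 rK] := compact_bound_rV cK.
apply: (@le_lt_trans _ _ (mu (cbox 0 r))).
  rewrite le_measure ?inE//; [exact: compact_measurable_rV|exact: measurable_cbox|].
  move=> x Kx i; rewrite in_itv/= mxE sub0r add0r -ler_norml.
  by rewrite (le_trans (coord_le_norm _ _))// ltW// rK.
by rewrite [ltLHS]lebesgue_cbox ?ltry// ltW.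
Qed.

(** On the compact set [K], [|f|^n <= 1 + |f|^p]. *)
Lemma Lfun_pow_integrable (F : 'rV[R]_d -> R) (K : set 'rV[R]_d) (p : R) (n : nat) :
  compact K -> 1 <= p -> n%:R <= p -> (0 < n)%N ->
  (F \* \1_K) \in Lfun mu p%:E ->
  mu.-integrable setT (EFin \o (fun x => `|(F \* \1_K) x| ^+ n)).
Proof.
move=> cK p1 np n0 LF; set f := F \* \1_K in LF *.
have intp := Lfun_integrable p1 LF.
have mf : measurable_fun setT f by move: LF; rewrite inE => /andP[/[!inE]/=].
have mK := compact_measurable_rV cK.
have int1 : mu.-integrable setT (EFin \o \1_K).
  apply/integrableP; split; first by apply/measurable_EFinP; exact: measurable_indic.
  under eq_integral do rewrite /= ger0_norm//.
  by rewrite integral_indic// setIT; exact: compact_lebesgue_rV_lty.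
apply: (le_integrable measurableT _ _ (integrableD measurableT int1 intp)).
  by apply/measurable_EFinP; apply: measurable_funX; exact: measurableT_comp.
move=> x _; rewrite /= lee_fin ger0_norm ?exprn_ge0// [leRHS]ger0_norm; last first.
  by rewrite addr_ge0 ?powR_ge0.
have [xK|xK] := boolP (x \in K); last first.
  have -> : f x = 0 by rewrite /f/= indicE (negbTE xK) mulr0.
  by rewrite normr0 expr0n gtn_eqF// addr_ge0 ?powR_ge0.
rewrite indicE xK/=; have [f1|f1] := leP `|f x| 1.
  by rewrite (@le_trans _ _ 1)// ?exprn_ile1// lerDl powR_ge0.
rewrite -powR_mulrn// (@le_trans _ _ (`|f x| `^ p))//; last by rewrite lerDr.
by apply: ler_powR => //; exact: ltW.
Qed.

End limits.

(** * Contact sets *)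
Section contact.
Context (R : realType) (d : nat).
Implicit Types (x z xi : 'rV[R]_d).
Variables (v : 'rV[R]_d -> R) (G : 'I_d -> 'rV[R]_d -> R)
  (H : 'I_d -> 'I_d -> 'rV[R]_d -> R).
Hypothesis dv : forall x xi (t : R),
  is_derive t (1 : R) (fun s : R => v (x + s *: xi)) (\sum_j xi ord0 j * G j (x + t *: xi)).
Hypothesis dG : forall i x xi (t : R),
  is_derive t (1 : R) (fun s : R => G i (x + s *: xi)) (\sum_j xi ord0 j * H i j (x + t *: xi)).
Hypothesis cv : continuous v.
Hypothesis cG : forall i, continuous (G i).
Variables (D C K : set 'rV[R]_d).
Hypotheses (oD : open D) (DC : D `<=` C) (KD : K `<=` D).

(** The upper contact set of the Alexandrov-Bakelman-Pucci method, restricted to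
slopes of size at most [eta]. *)
Definition contact (eta : R) : set 'rV[R]_d :=
  [set x | [/\ K x, forall z, C z -> v z <= v x + \sum_i G i x * (z - x) ord0 i &
    forall i, `|G i x| <= eta]].

Lemma closed_contact eta : closed K -> closed (contact eta).
Proof.
move=> clK.
rewrite (_ : contact eta = K `&`
  (\bigcap_(z in C) ((fun x => v z - (v x + \sum_i G i x * (z - x) ord0 i)) @^-1` [set t : R | t <= 0]))
  `&` \bigcap_(i in [set: 'I_d]) ((fun x => `|G i x|) @^-1` [set t : R | t <= eta])); last first.
  apply/seteqP; split => x.
    move=> [Kx vx Gx]; split; first split => //.
      by move=> z Cz /=; rewrite subr_le0; exact: vx.
    by move=> i _; exact: Gx.
  move=> [[Kx vx] Gx]; split => //.
    by move=> z Cz; rewrite -subr_le0; exact: vx.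
  by move=> i; exact: Gx.
apply: closedI; first apply: closedI => //.
  apply: closed_bigI => z _; apply: closed_comp; last exact: closed_le.
  move=> x _; apply: rV_continuousB; first exact: rV_continuous_cst.
  apply: rV_continuousD; first exact: cv.
  apply: rV_continuous_sum => i; apply: rV_continuousM; first exact: cG.
  rewrite (_ : (fun y : 'rV[R]_d => _) = (fun y => z ord0 i - y ord0 i)).
    by apply: rV_continuousB; [exact: rV_continuous_cst|exact: continuous_coord_rV].
  by apply/funext => y'; rewrite !mxE.
apply: closed_bigI => i _; apply: closed_comp; last exact: closed_le.
by move=> x _; apply: continuous_comp; [exact: cG|exact: norm_continuous].
Qed.

(** Among the affine functions of slope [p], the lowest one above [v] touches it on
[C].  The gap forces the touching point to lie in [K], hence in the interior,
where the gradient of [v] has to be [p]. *)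
Lemma contact_onto (eta r : R) xs : compact C -> C xs -> 0 <= eta ->
  (forall x, C x -> `|x| <= r) ->
  (forall x, C x -> ~ K x -> v x + 2 * r * d%:R * eta < v xs) ->
  forall p : 'rV[R]_d, (forall i, `|p ord0 i| <= eta) ->
    exists2 x, contact eta x & forall i, G i x = p ord0 i.
Proof.
move=> cC Cxs eta0 Cr gap p peta.
pose f x := v x - \sum_i p ord0 i * x ord0 i.
have cf : continuous f.
  apply: rV_continuousB; first exact: cv.
  apply: rV_continuous_sum => i.
  by apply: rV_continuousM; [exact: rV_continuous_cst|exact: continuous_coord_rV].
have [|x Cx xmax] := compact_EVT_max _ cC (continuous_subspaceT cf).
  by exists xs.
rewrite inE in Cx.
have {}xmax z : C z -> f z <= f x by move=> Cz; apply: xmax; rewrite inE.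
have Kx : K x.
  apply: contrapT => nKx; have := gap x Cx nKx; apply/negP; rewrite -leNgt.
  have := xmax _ Cxs; rewrite /f lerBlDr => /le_trans; apply.
  rewrite -addrA lerD2l addrC -sumrB.
  have -> : 2 * r * d%:R * eta = \sum_(i < d) (2 * r * eta).
    by rewrite sumr_const card_ord -mulr_natr; ring.
  apply: ler_sum => i _; rewrite -mulrBr (le_trans (ler_norm _))// normrM mulrC.
  apply: ler_pM => //.
  rewrite (le_trans (ler_normB _ _))// mulr2n mulrDl mul1r.
  by rewrite lerD// (le_trans (coord_le_norm _ _))// Cr.
have Gp i : G i x = p ord0 i.
  have /nbhs_ballP[e /= e0 eD] := open_nbhs_nbhs (conj oD (KD Kx)).
  pose xi : 'rV[R]_d := delta_mx ord0 i.
  have lE : (fun s : R => \sum_j p ord0 j * (x + s *: xi) ord0 j) =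
      cst (\sum_j p ord0 j * x ord0 j) + p ord0 i *: id.
    apply/funext => s; rewrite !fctE/=.
    under eq_bigr do rewrite !mxE mulrDr.
    rewrite big_split/=; congr (_ + _).
    rewrite (bigD1 i)//= !eqxx big1 ?addr0 ?mulr1// => j /negbTE ji.
    by rewrite ji !mulr0.
  have dl (t : R) : is_derive t (1 : R)
      (fun s : R => \sum_j p ord0 j * (x + s *: xi) ord0 j) (p ord0 i).
    rewrite lE; apply: is_derive_eq (is_deriveD (is_derive_cst _ _ _)
      (is_deriveZ (p ord0 i) (is_derive_id _ _))) _.
    by rewrite add0r [LHS]mulr1.
  have df (t : R) : is_derive t (1 : R) (fun s : R => f (x + s *: xi))
      (\sum_j xi ord0 j * G j (x + t *: xi) - p ord0 i).
    exact: is_deriveB (dv x xi t) (dl t).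
  have dfa (t : R) : derivable (fun s : R => f (x + s *: xi)) t 1 by have [] := df t.
  have df0 : is_derive (0 : R) (1 : R) (fun s : R => f (x + s *: xi)) (G i x - p ord0 i).
    apply: is_derive_eq (df 0) _; congr (_ - _).
    rewrite (bigD1 i)//= mxE !eqxx mul1r scale0r addr0 big1 ?addr0// => j /negbTE ji.
    by rewrite mxE ji andbF mul0r.
  have xiN : `|xi| <= 1.
    apply: rV_norm_le => // j; rewrite mxE; case: (_ && _); rewrite ?normr1 ?normr0//.
  have := @derive1_at_max R (fun s : R => f (x + s *: xi)) (- e) e 0 _ (fun t _ => dfa t) _ _.
  case.
  - by rewrite ge0_cp// ltW.
  - by rewrite in_itv/= oppr_lt0 e0.
  - move=> t; rewrite in_itv/= -ltr_norml => te.
    rewrite scale0r addr0; apply: xmax; apply: DC; apply: eD.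
    rewrite -ball_normE/= opprD addrA subrr add0r normrN normrZ.
    by rewrite (le_lt_trans _ te)// ler_piMr.
  move=> _; have [_ ->] := df0; move=> /eqP; rewrite subr_eq0 => /eqP; exact.
exists x => //; split => //.
  move=> z Cz; have := xmax z Cz; rewrite /f lerBlDr => /le_trans; apply.
  rewrite -addrA lerD2l addrC -sumrB; apply: ler_sum => i _.
  by rewrite Gp !mxE mulrBr.
by move=> i; rewrite Gp.
Qed.

(** On a line through a contact point, [v] stays below its tangent. *)
Lemma contact_second (eta : R) x : contact eta x ->
  forall xi : 'rV[R]_d, \sum_i \sum_j H i j x * xi ord0 i * xi ord0 j <= 0.
Proof.
move=> [Kx vx _] xi.
have /nbhs_ballP[e /= e0 eD] := open_nbhs_nbhs (conj oD (KD Kx)).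
pose rho := e / (`|xi| + 1).
have xi0 : 0 < `|xi| + 1 by rewrite ltr_wpDl.
have rho0 : 0 < rho by rewrite divr_gt0.
pose g1 (t : R) := \sum_j xi ord0 j * G j (x + t *: xi).
have dg1 : is_derive (0 : R) (1 : R) g1 (\sum_i \sum_j H i j x * xi ord0 i * xi ord0 j).
  have -> : g1 = \sum_j (xi ord0 j *: (fun t : R => G j (x + t *: xi))).
    by apply/funext => t; rewrite /g1 fct_sumE.
  have := is_derive_sum (fun j => is_deriveZ (xi ord0 j) (dG j x xi 0)).
  move=> /is_derive_eq; apply.
  apply: eq_bigr => i _; rewrite [LHS]mulr_sumr; apply: eq_bigr => j _.
  by rewrite scale0r addr0; ring.
apply: (second_order_max (dv x xi) dg1 rho0) => t /andP[t0 tr].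
rewrite /g1 scale0r !addr0.
have Cz : C (x + t *: xi).
  apply: DC; apply: eD; rewrite -ball_normE/= opprD addrA subrr add0r normrN normrZ.
  rewrite gtr0_norm// (@le_lt_trans _ _ (t * (`|xi| + 1)))//.
    by rewrite ler_pM2l// lerDl.
  by rewrite -ltr_pdivlMr.
rewrite (le_trans (vx _ Cz))// lerD2l mulr_sumr; apply: ler_sum => i _.
have -> : x + t *: xi - x = t *: xi by rewrite addrAC subrr add0r.
by rewrite mxE mulrCA [G i x * _]mulrC.
Qed.

End contact.

(** * A lower bound for the measure of contact sets *)
Section equi.
Context (R : realType) (d : nat).
Local Notation mu := (lebesgue_rV R d).
Local Notation m0 := (fun=> 0%N).
Local Notation k h x z := (mbump h (fun=> 0%N) (z - x)).
Implicit Types (x z : 'rV[R]_d).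

Lemma exprD_le_2 n (a b : R) : 0 <= a -> 0 <= b ->
  (a + b) ^+ n <= 2 ^+ n * (a ^+ n + b ^+ n).
Proof.
move=> a0 b0; pose c := Num.max a b.
have c0 : 0 <= c by rewrite le_max a0.
apply: (@le_trans _ _ ((2 * c) ^+ n)).
  rewrite lerXn2r ?nnegrE ?addr_ge0 ?mulr_ge0//.
  by rewrite mulr2n mulrDl mul1r lerD// le_max lexx ?orbT.
rewrite exprMn ler_wpM2l ?exprn_ge0// /c.
by have [ab|ab] := leP a b; rewrite ?lerDr ?lerDl exprn_ge0.
Qed.

Lemma expr_sum_le (I : finType) n (a : I -> R) : (0 < #|I|)%N -> (forall i, 0 <= a i) ->
  (\sum_i a i) ^+ n <= #|I|%:R ^+ n * \sum_i a i ^+ n.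
Proof.
move=> /card_gt0P[i0 _] a0; pose m := [arg max_(i > i0 | true) a i]%O.
have am i : a i <= a m by rewrite /m; case: arg_maxP => // j _; exact.
apply: (@le_trans _ _ ((#|I|%:R * a m) ^+ n)).
  rewrite lerXn2r ?nnegrE ?sumr_ge0 ?mulr_ge0//.
  by rewrite mulr_natl -sumr_const; apply: ler_sum.
rewrite exprMn ler_wpM2l ?exprn_ge0// (bigD1 m)//= lerDl.
by apply: sumr_ge0 => i _; rewrite exprn_ge0.
Qed.

(** Dominated convergence; through Jensen's inequality this makes the [n]-th powers
of all mollifications of [f] equi-integrable. *)
Lemma truncation_vanishes (f : 'rV[R]_d -> R) n (e : R) : 0 < e -> (0 < n)%N ->
  measurable_fun setT f -> (forall x, 0 <= f x) ->
  mu.-integrable setT (EFin \o (fun x => f x ^+ n)) ->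
  exists2 M : R, 0 <= M & (\int[mu]_x (Num.max (f x - M) 0 ^+ n)%:E <= e%:E)%E.
Proof.
move=> e0 n0 mf f0 intf.
pose F (j : nat) x := (Num.max (f x - j%:R) 0 ^+ n)%:E : \bar R.
have mF j : measurable_fun setT (F j).
  apply/measurable_EFinP; apply: measurable_funX; apply: measurable_maxr => //.
  exact: measurable_funB.
have F0 j x : (0 <= F j x)%E by rewrite lee_fin exprn_ge0// le_max lexx orbT.
have [] := @dominated_convergence _ _ R mu setT measurableT F (cst 0%E) (fun x => (f x ^+ n)%:E) mF.
- exact: measurable_cst.
- apply: aeW => x _; apply: cvg_near_cst; near=> j.
  rewrite /F (_ : Num.max _ _ = 0) ?expr0n ?gtn_eqF//.
  apply/max_idPr; rewrite subr_le0.
  near: j; exists (Num.truncn (f x)).+1 => // j /= fj.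
  have /andP[_ /ltW fx] := Num.Theory.truncn_itv (f0 x).
  by rewrite (le_trans fx)// ler_nat.
- exact: intf.
- apply: aeW => x j _; rewrite gee0_abs// lee_fin lerXn2r ?nnegrE ?le_max ?lexx ?orbT//.
  by rewrite ge_max f0 andbT gerBl.
move=> _ _; rewrite integral0 => /fine_cvgP[fF /cvgrPdist_le/(_ _ e0) cF].
near \oo => j; exists j%:R => //.
have fj : (\int[mu]_x F j x)%E \is a fin_num by near: j.
rewrite -/(F j _) -(fineK fj) lee_fin (le_trans (ler_norm _))//.
rewrite -normrN -sub0r.
by near: j; exact: cF.
Unshelve. all: by end_near. Qed.

(** On [A] the excess of [Phi] over a high level [B] is at most the mollification
of the excess of [f] over [M], whose [n]-th power has, uniformly in [h], an
integral too small to account for more than half of [c].  The other half is at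
most a constant times the measure of [A]. *)
Lemma mollify_sum_measure_lower (I : finType) (F : I -> 'rV[R]_d -> R) n (B0 c : R) :
  (0 < n)%N -> (0 < #|I|)%N -> 0 <= B0 -> 0 < c ->
  (forall i, mu.-integrable setT (EFin \o F i)) ->
  (forall i, mu.-integrable setT (EFin \o (fun x => `|F i x| ^+ n))) ->
  exists2 kappa : R, 0 < kappa &
    forall h (A : set 'rV[R]_d) (Phi : 'rV[R]_d -> R), 0 < h ->
      measurable A -> (mu A < +oo)%E -> measurable_fun setT Phi ->
      (forall x, 0 <= Phi x) ->
      (forall x, A x -> Phi x <= B0 + \sum_i `|mollify h m0 (F i) x|) ->
      (c%:E <= \int[mu]_(x in A) (Phi x ^+ n)%:E)%E -> (kappa%:E <= mu A)%E.
Proof.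
move=> n0 I0 B00 c0 intF intFn.
have mF i : measurable_fun setT (F i) by apply/measurable_EFinP; exact: measurable_int (intF i).
pose f x := \sum_i `|F i x|.
have mf : measurable_fun setT f by apply: measurable_sum => i; exact: measurableT_comp.
have f0 x : 0 <= f x by exact: sumr_ge0.
have intfn : mu.-integrable setT (EFin \o (fun x => f x ^+ n)).
  have intS : mu.-integrable setT (fun x => \sum_i (`|F i x| ^+ n)%:E)%E.
    exact: (integrable_sum measurableT _ (h := fun i x => (`|F i x| ^+ n)%:E) (fun i _ => intFn i)).
  apply: (le_integrable measurableT _ _ (integrableZl measurableT (#|I|%:R ^+ n) intS)).
    by apply/measurable_EFinP; exact: measurable_funX.
  move=> x _; rewrite /= sumEFin -EFinM/= lee_fin.
  rewrite ger0_norm ?exprn_ge0// (le_trans _ (ler_norm _))//.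
  exact: expr_sum_le.
(* The factor [2 ^+ n] compensates that of [exprD_le_2]. *)
pose e := c / (2 * 2 ^+ n).
have e0 : 0 < e by rewrite divr_gt0// mulr_gt0// exprn_gt0.
have [M M0 IM] := truncation_vanishes e0 n0 mf f0 intfn.
pose B := B0 + M + 1.
have Bgt0 : 0 < B by rewrite ltr_wpDl// addr_ge0.
pose kappa := c / (2 * (2 ^+ n * B ^+ n)).
have BB : 0 < 2 ^+ n * B ^+ n by rewrite mulr_gt0// exprn_gt0.
exists kappa => [|h A Phi h0 mA Aoo mPhi Phi0 PhiA cPhi].
  by rewrite divr_gt0// mulr_gt0.
pose fM x := Num.max (f x - M) 0.
have fM0 x : 0 <= fM x by rewrite /fM le_max lexx orbT.
have mfM : measurable_fun setT fM.
  by apply: measurable_maxr => //; exact: measurable_funB.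
have mfMn : measurable_fun setT (fun z => fM z ^+ n) by exact: measurable_funX.
have fM0n x : 0 <= fM x ^+ n by rewrite exprn_ge0.
have mk (g : 'rV[R]_d -> R) x : measurable_fun setT g -> measurable_fun setT (fun z => (g z * k h x z)%:E).
  by move=> mg; apply/measurable_EFinP; apply: measurable_funM => //; exact: measurable_mbump_shift.
have mk2 : measurable_fun setT (fun x => \int[mu]_z (fM z ^+ n * k h x z)%:E)%E.
  apply: (measurable_fun_fubini_tonelli_F
     (fun p : 'rV[R]_d * 'rV[R]_d => (fM p.2 ^+ n * k h p.1 p.2)%:E)).
    apply/measurable_EFinP; apply: measurable_funM; last exact: measurable_mbump_sub.
    exact: (measurableT_comp mfMn).
  by move=> p; rewrite lee_fin mulr_ge0 ?mbump0_ge0.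
have k0 x : (0 <= \int[mu]_z (fM z ^+ n * k h x z)%:E)%E.
  by apply: integral_ge0 => z _; rewrite lee_fin mulr_ge0 ?mbump0_ge0.
have PhiE x : A x -> ((Phi x ^+ n)%:E <=
    (2 ^+ n * B ^+ n)%:E + (2 ^+ n)%:E * \int[mu]_z (fM z ^+ n * k h x z)%:E)%E.
  move=> Ax; pose a := Num.max (Phi x - B) 0.
  have a0 : 0 <= a by rewrite /a le_max lexx orbT.
  have sumle : ((\sum_i `|mollify h m0 (F i) x|)%:E <= M%:E + \int[mu]_z (fM z * k h x z)%:E)%E.
    apply: (@le_trans _ _ (\int[mu]_z (f z * k h x z)%:E)%E).
      rewrite -sumEFin; apply: (@le_trans _ _ (\sum_i \int[mu]_z (`|F i z| * k h x z)%:E)%E).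
        by apply: lee_sum => i _; apply: mollify_norm_le => //; exact: integrable_mul_mbump.
      rewrite -ge0_integral_sum//; last 2 first.
      - by move=> i; apply: mk; exact: measurableT_comp.
      - by move=> i z _; rewrite lee_fin norm_kernel_ge0.
      rewrite le_eqVlt; apply/orP; left; apply/eqP; apply: eq_integral => z _.
      by rewrite sumEFin mulr_suml.
    rewrite -[X in (X + _)%E](integral_kernel x h0 M0) -ge0_integralD//; last 4 first.
    - by move=> z _; rewrite lee_fin mulr_ge0 ?mbump0_ge0.
    - by apply: mk; exact: measurable_cst.
    - by move=> z _; rewrite lee_fin mulr_ge0 ?mbump0_ge0.
    - exact: mk.
    apply: ge0_le_integral => //.
    - by move=> z _; rewrite lee_fin mulr_ge0 ?mbump0_ge0.
    - exact: mk.
    - by apply: emeasurable_funD; apply: mk => //; exact: measurable_cst.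
    move=> z _; rewrite -EFinD lee_fin -mulrDl; apply: ler_wpM2r; first exact: mbump0_ge0.
    by rewrite /fM -lerBlDl le_max lexx.
  have aI : (a%:E <= \int[mu]_z (fM z * k h x z)%:E)%E.
    rewrite /a; have [_|_] := leP (Phi x - B) 0.
      by apply: integral_ge0 => z _; rewrite lee_fin mulr_ge0 ?mbump0_ge0.
    rewrite -(@leeD2lE _ M%:E)// (le_trans _ sumle)// -EFinD lee_fin.
    by have := PhiA x Ax; rewrite /B; lra.
  have := kernel_jensen n h0 a0 mfM fM0 aI => aIn.
  apply: (@le_trans _ _ ((2 ^+ n * B ^+ n)%:E + (2 ^+ n)%:E * (a ^+ n)%:E)%E); last first.
    by rewrite leeD2l// lee_wpmul2l// lee_fin exprn_ge0.
  rewrite -EFinM -EFinD lee_fin -mulrDr (le_trans _ (exprD_le_2 _ (ltW Bgt0) a0))//.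
  rewrite lerXn2r ?nnegrE ?addr_ge0 ?(ltW Bgt0)//.
  by rewrite -lerBlDl /a le_max lexx.
have H : (c%:E <= (2 ^+ n * B ^+ n)%:E * mu A + (c / 2)%:E)%E.
  apply: (le_trans cPhi).
  apply: (@le_trans _ _ (\int[mu]_(x in A) ((2 ^+ n * B ^+ n)%:E +
      (2 ^+ n)%:E * \int[mu]_z (fM z ^+ n * k h x z)%:E))%E).
    apply: ge0_le_integral => //.
    - by move=> x _; rewrite lee_fin exprn_ge0.
    - by apply: measurable_funTS; apply/measurable_EFinP; exact: measurable_funX.
    - apply: measurable_funTS; apply: emeasurable_funD; first exact: measurable_cst.
      exact: measurable_funeM.
  rewrite ge0_integralD//; last 3 first.
  - by move=> x _; rewrite lee_fin ltW.
  - by move=> x _; rewrite mule_ge0// lee_fin exprn_ge0.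
  - by apply: measurable_funTS; exact: measurable_funeM.
  rewrite [X in (X + _)%E](_ : _ = (2 ^+ n * B ^+ n)%:E * mu A)%E; last exact: integral_cst.
  rewrite leeD2l// ge0_integralZl//; last exact: measurable_funTS.
  apply: (@le_trans _ _ ((2 ^+ n)%:E * \int[mu]_x \int[mu]_z (fM z ^+ n * k h x z)%:E)%E).
    apply: lee_wpmul2l; first by rewrite lee_fin exprn_ge0.
    exact: ge0_subset_integral.
  rewrite (@integral_kernel_swap _ _ h (fun z => fM z ^+ n))//.
  apply: (@le_trans _ _ ((2 ^+ n)%:E * e%:E)%E).
    by apply: lee_wpmul2l; [rewrite lee_fin exprn_ge0|exact: IM].
  rewrite -EFinM lee_fin /e le_eqVlt; apply/orP; left; apply/eqP; field.
  by rewrite expf_neq0.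
have fA : mu A \is a fin_num by rewrite ge0_fin_numE.
move: H; rewrite -(fineK fA) -EFinM -EFinD !lee_fin => H.
rewrite /kappa ler_pdivrMr; last by rewrite mulr_gt0.
by move: H; rewrite [X in _ -> _ <= X]mulrC -mulrA; lra.
Qed.

End equi.

(** * A contact point in the limit *)
Section contact_point.
Context (R : realType) (d : nat).
Local Notation mu := (lebesgue_rV R d).
Local Notation m0 := (fun=> 0%N).
Local Notation k h x z := (mbump h (fun=> 0%N) (z - x)).
Local Notation h_ n := (n.+1%:R^-1)%R.
Implicit Types (x z xi : 'rV[R]_d).

Lemma le_of_eps (a b c : R) : 0 <= c -> (forall e, 0 < e -> a <= b + e * c) -> a <= b.
Proof.
move=> c0 abe; apply/ler_addgt0Pr => e e0.
have c1 : 0 < c + 1 by rewrite ltr_wpDl.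
apply: (le_trans (abe (e / (c + 1)) (divr_gt0 e0 c1))).
by rewrite lerD2l mulrAC -mulrA ler_piMr ?(ltW e0)// ler_pdivrMr ?mul1r ?lerDl.
Qed.

Lemma strict_gap (a a' b b' w w' e t : R) : 0 < e -> `|a - b| <= e / 8 ->
  `|a' - b'| <= e / 8 -> t <= e / 2 -> b + w + e <= b' + w' -> a + w + t < a' + w'.
Proof. by rewrite !ler_norml => e0 /andP[? ?] /andP[? ?]; lra. Qed.

Lemma contact_limit (a a' b b' p p' e c : R) : `|a' - a| <= e -> `|b' - b| <= e ->
  a' <= b' + p' -> p' <= p + e * c -> a <= b + p + e * (2 + c).
Proof. by rewrite !ler_norml => /andP[? ?] /andP[? ?] ? ?; lra. Qed.

(** Markov's inequality for the sum of the local oscillations. *)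
Lemma osc_exceptional_set (I : finType) (g : I -> 'rV[R]_d -> R) (kappa e : R) :
  (forall i, measurable_fun setT (g i)) -> (forall i, osc_vanishes (g i)) ->
  0 < kappa -> 0 < e ->
  \forall n \near \oo, exists B : set 'rV[R]_d, [/\ measurable B,
    (mu B <= kappa%:E)%E &
    forall x, ~ B x -> forall i, (\int[mu]_z (`|g i z - g i x| * k (h_ n) x z)%:E < e%:E)%E].
Proof.
move=> mg vg kappa0 e0.
pose N : R := #|I|%:R + 1.
have N0 : 0 < N by rewrite ltr_wpDl.
pose e1 := kappa * e / N.
have e10 : 0 < e1 by rewrite divr_gt0// mulr_gt0.
have osc_small : \forall n \near \oo, forall i, (osc (h_ n) (g i) <= e1%:E)%E.
  by apply: filter_forall => i; exact: vg.
apply: filterS osc_small => n osc_small.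
pose G i x := (\int[mu]_z (`|g i z - g i x| * k (h_ n) x z)%:E)%E.
have mG i : measurable_fun setT (G i) by exact: measurable_osc2.
have G0 i x : (0 <= G i x)%E by apply: integral_ge0 => z _; rewrite lee_fin norm_kernel_ge0.
pose E x := (\sum_i G i x)%E.
have mE : measurable_fun setT E by apply: emeasurable_sum.
have E0 x : (0 <= E x)%E by apply: sume_ge0.
pose B := setT `&` [set x | (e%:E <= `|E x|)%E].
exists B; split.
- by apply: emeasurable_fun_c_infty => //; exact: measurableT_comp.
- have := @le_integral_abse _ _ _ mu setT measurableT E e mE e0.
  rewrite (eq_integral E); last by move=> x _; rewrite gee0_abs.
  rewrite ge0_integral_sum; [|exact: measurableT|exact: mG|by move=> i x _; exact: G0].
  move=> H; rewrite -(@lee_pmul2l _ e%:E)// ?lte_fin//.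
  apply: (le_trans H); apply: (@le_trans _ _ (\sum_(i in I) e1%:E)%E).
    by apply: lee_sum => i _; exact: osc_small.
  rewrite sumEFin -EFinM lee_fin sumr_const /e1 -mulr_natl.
  rewrite mulrA ler_pdivrMr// mulrC [e * kappa]mulrC ler_wpM2l//.
    by rewrite mulr_ge0// ltW.
  by rewrite /N lerDl.
- move=> x nBx i; rewrite ltNge; apply/negP => eG; apply: nBx; split => //=.
  rewrite gee0_abs// (le_trans eG)// /E (bigD1 i)//= leeDl//.
  exact: sume_ge0.
Qed.

Lemma mollify_uniform (C : set 'rV[R]_d) (u : 'rV[R]_d -> R) (M e : R) : compact C ->
  continuous u -> (forall x, `|u x| <= M) -> 0 < e ->
  \forall n \near \oo, forall x, C x -> `|mollify (h_ n) m0 u x - u x| <= e.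
Proof.
move=> cC cu uM e0; have [s s0 sP] := compact_unif_continuous cC cu e0.
near=> n => x Cx.
apply: (mollify_near (M := M)) => //.
- exact: measurable_fun_continuous_rV.
- exact: ltW.
move=> z zx; apply: sP => //; rewrite (le_trans zx)// ltW//.
by near: n; exact: (near_infty_natSinv_lt (PosNum s0)).
Unshelve. all: by end_near. Qed.

Variables (D : set 'rV[R]_d) (u : 'rV[R]_d -> R) (M p : R)
  (Du : 'I_d -> 'rV[R]_d -> R) (D2u : 'I_d -> 'I_d -> 'rV[R]_d -> R).
Hypotheses (d0 : (0 < d)%N) (oD : open D)
  (cu : continuous u) (uM : forall x, `|u x| <= M) (dp : d%:R < p)
  (uW : W2p_loc D p u Du D2u).
Variables (w : 'rV[R]_d -> R) (Dw : 'I_d -> 'rV[R]_d -> R)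
  (D2w : 'I_d -> 'I_d -> 'rV[R]_d -> R).
Hypotheses (dw : forall x xi (t : R),
    is_derive t (1 : R) (fun s : R => w (x + s *: xi)) (\sum_j xi ord0 j * Dw j (x + t *: xi)))
  (dDw : forall i x xi (t : R),
    is_derive t (1 : R) (fun s : R => Dw i (x + s *: xi)) (\sum_j xi ord0 j * D2w i j (x + t *: xi)))
  (cw : continuous w) (cDw : forall i, continuous (Dw i))
  (cD2w : forall i j, continuous (D2w i j)) (sw : forall i j x, D2w i j x = D2w j i x).
Variables (K : set 'rV[R]_d) (xs : 'rV[R]_d) (delta eta r : R).
Hypotheses (cK : compact K) (KD : K `<=` D) (Dxs : closure D xs) (delta0 : 0 < delta)
  (gap : forall x, closure D x -> ~ K x -> u x + w x + delta <= u xs + w xs)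
  (eta0 : 0 < eta) (Dr : forall x, closure D x -> `|x| <= r)
  (eta_small : 2 * r * d%:R * eta <= delta / 2).

Let C := closure D.

Let cC : compact C.
Proof. exact: compact_closure_le Dr. Qed.

Let mu_ : measurable_fun setT u.
Proof. exact: measurable_fun_continuous_rV. Qed.

Let v x := u x + w x.
(* The mollified function, its gradient and its Hessian. *)
Let vh h x := mollify h m0 u x + w x.
Let Gh h i x := - mollify h (mincr m0 i) u x + Dw i x.
Let Hh h i j x := mollify h (mincr (mincr m0 i) j) u x + D2w i j x.

Let dvh h x xi (t : R) : 0 < h ->
  is_derive t (1 : R) (fun s : R => vh h (x + s *: xi)) (\sum_j xi ord0 j * Gh h j (x + t *: xi)).
Proof.
move=> h0; apply: is_derive_eq (is_deriveD (is_derive_mollify m0 x xi t h0 mu_ uM) (dw x xi t)) _.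
by rewrite -big_split; apply: eq_bigr => j _; rewrite /= -mulrDr.
Qed.

Let dGh h i x xi (t : R) : 0 < h ->
  is_derive t (1 : R) (fun s : R => Gh h i (x + s *: xi)) (\sum_j xi ord0 j * Hh h i j (x + t *: xi)).
Proof.
move=> h0; apply: is_derive_eq (is_deriveD (is_deriveN
  (is_derive_mollify (mincr m0 i) x xi t h0 mu_ uM)) (dDw i x xi t)) _.
rewrite -sumrN -big_split; apply: eq_bigr => j _.
by rewrite /= mulrN opprK -mulrDr.
Qed.

Let cvh h : 0 < h -> continuous (vh h).
Proof. by move=> h0; apply: rV_continuousD; [exact: continuous_mollify h0 mu_ uM|exact: cw]. Qed.

Let cGh h i : 0 < h -> continuous (Gh h i).
Proof.
move=> h0; apply: rV_continuousD; last exact: cDw.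
rewrite (_ : (fun x => _) = (fun x => 0 - mollify h (mincr m0 i) u x)); last first.
  by apply/funext => x; rewrite sub0r.
by apply: rV_continuousB; [exact: rV_continuous_cst|exact: continuous_mollify h0 mu_ uM].
Qed.

Let cHh h i j : 0 < h -> continuous (Hh h i j).
Proof. by move=> h0; apply: rV_continuousD; [exact: continuous_mollify h0 mu_ uM|exact: cD2w]. Qed.

(** The contact sets of the mollified functions have measure bounded below, while
their derivatives converge outside sets of smaller measure.  A point common to
infinitely many of the remaining sets, and outside [Z], inherits the contact
inequality, the bound on the slope and the sign of the Hessian; it also
inherits the symmetry of the Hessian, which weak derivatives only have almost
everywhere. *)
Theorem contact_point (Z : set 'rV[R]_d) : mu.-negligible Z ->
  exists x, [/\ K x, ~ Z x,
    forall z, C z -> v z <= v x + \sum_i (Du i x + Dw i x) * (z - x) ord0 i,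
    forall i, `|Du i x + Dw i x| <= eta &
    (forall i j, D2u i j x = D2u j i x) /\
    forall xi, \sum_i \sum_j (D2u i j x + D2w i j x) * xi ord0 i * xi ord0 j <= 0].
Proof.
move=> nZ.
have [rho [K' [rho0 cK' K'D KK']]] := compact_fatten cK oD KD.
have KK'x x : K x -> K' x by move=> Kx; apply: KK' Kx _; rewrite subrr normr0 ltW.
have p1 : 1 <= p by rewrite (le_trans _ (ltW dp))// ler1n.
have [_ uW1 uW2] := uW.
pose F (ij : 'I_d * 'I_d) := D2u ij.1 ij.2 \* \1_K'.
pose P (i : 'I_d) := Du i \* \1_K'.
have LF ij : F ij \in Lfun mu p%:E by have [LF _] := uW2 ij.1 ij.2; exact: LF.
have LP i : P i \in Lfun mu p%:E by have [LP _] := uW1 i; exact: LP.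
have mLfun f : f \in Lfun mu p%:E -> measurable_fun setT f.
  by rewrite inE => /andP[/[!inE]/=].
have Lint g : g \* \1_K' \in Lfun mu p%:E -> mu.-integrable setT (EFin \o (g \* \1_K')).
  move=> Lg; have p1' : 1%N%:R <= p by [].
  apply: (le_integrable measurableT _ _ (Lfun_pow_integrable cK' p1 p1' isT Lg)).
    by apply/measurable_EFinP; exact: mLfun.
  by move=> x _; rewrite /= lee_fin expr1 normr_id.
have intF ij : mu.-integrable setT (EFin \o F ij) by apply: Lint; exact: LF.
have intP i : mu.-integrable setT (EFin \o P i) by apply: Lint; exact: LP.
have [r' r'0 K'r'] := compact_bound_rV cK'.
pose Q : set 'rV[R]_d := ball 0 r'.
have oQ : open Q by exact: ball_open.
have Qoo : (mu Q < +oo)%E.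
  apply: (@le_lt_trans _ _ (mu (cbox 0 r'))); last by rewrite [ltLHS]lebesgue_cbox ?ltry// ltW.
  rewrite le_measure ?inE//; [exact: open_measurable_mx|exact: measurable_cbox|].
  move=> x; rewrite /Q -ball_normE/= sub0r normrN => xr' i.
  by rewrite in_itv/= mxE sub0r add0r -ler_norml (le_trans (coord_le_norm _ _))// ltW.
have zero_out g x : ~ Q x -> (g \* \1_K') x = 0 :> R.
  move=> Qx; rewrite /= indicE memNset ?mulr0// => K'x; apply: Qx.
  by rewrite /Q -ball_normE/= sub0r normrN; exact: K'r'.
have vanish g : g \* \1_K' \in Lfun mu p%:E -> osc_vanishes (g \* \1_K').
  move=> Lg; apply: (osc_vanishes_integrable oQ Qoo); [|exact: mLfun|exact: zero_out].
  apply: (integrableS measurableT (open_measurable_mx oQ) (@subsetT _ _)); exact: Lint.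
have vF ij : osc_vanishes (F ij) by apply: vanish; exact: LF.
have vP i : osc_vanishes (P i) by apply: vanish; exact: LP.
(* On [K], at small scales, the derivatives of the mollification are the
   mollifications of the weak derivatives cut off outside [K']. *)
have GhE h i x : 0 < h -> h <= rho -> K x -> Gh h i x = mollify h m0 (P i) x + Dw i x.
  move=> h0 hrho Kx; congr (_ + _).
  have xD z : `|z - x| <= h -> K' z by move=> zx; apply: KK' Kx _; exact: le_trans zx hrho.
  have [_ wp] := uW1 i.
  rewrite (mollify_weak (g' := P i) h0 wp)//= ?expr1 ?mulN1r ?opprK//.
    by move=> z /xD/K'D.
  by move=> z /xD K'z; rewrite /P/= indicE mem_set// mulr1.
have HhE h i j x : 0 < h -> h <= rho -> K x ->
    Hh h i j x = mollify h m0 (F (i, j)) x + D2w i j x.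
  move=> h0 hrho Kx; congr (_ + _).
  have xD z : `|z - x| <= h -> K' z by move=> zx; apply: KK' Kx _; exact: le_trans zx hrho.
  have [_ wp] := uW2 i j.
  rewrite mincrC (mollify_weak (s := [:: i; j]) (g' := F (i, j)) h0 wp)//=.
  - by rewrite expr2 mulrN1 opprK mul1r.
  - by move=> z /xD/K'D.
  - by move=> z /xD K'z; rewrite /F/= indicE mem_set// mulr1.
have clK : closed K by apply: compact_closed => //; exact: norm_hausdorff.
pose Gam n := contact (vh (h_ n)) (Gh (h_ n)) C K eta.
have hn0 n : 0 < h_ n :> R by rewrite invr_gt0.
have cGam n : compact (Gam n).
  apply: (subclosed_compact _ cK); last by move=> x [].
  apply: closed_contact => //; [exact: cvh|by move=> i; exact: cGh].
have mGam n : measurable (Gam n) by exact: compact_measurable_rV.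
have Gamoo n : (mu (Gam n) < +oo)%E by exact: (compact_lebesgue_rV_lty (cGam n)).
pose Phi n x := \sum_i \sum_j `|Hh (h_ n) i j x|.
have cPhi n : continuous (Phi n).
  apply: rV_continuous_sum => i; apply: rV_continuous_sum => j x.
  by apply: continuous_comp; [exact: cHh|exact: norm_continuous].
have Phi0 n x : 0 <= Phi n x by apply: sumr_ge0 => i _; exact: sumr_ge0.
have [B0 B00 B0P] : exists2 B0 : R, 0 <= B0 & forall x, K x -> \sum_i \sum_j `|D2w i j x| <= B0.
  have cf : continuous (fun x => \sum_i \sum_j `|D2w i j x|).
    apply: rV_continuous_sum => i; apply: rV_continuous_sum => j x.
    by apply: continuous_comp; [exact: cD2w|exact: norm_continuous].
  have [[x0 Kx0]|nK] := pselect (K !=set0); last first.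
    by exists 0 => // x Kx; exfalso; apply: nK; exists x.
  have [|c _ cmax] := compact_EVT_max _ cK (continuous_subspaceT cf); first by exists x0.
  exists (\sum_i \sum_j `|D2w i j c|) => [|x Kx].
    by apply: sumr_ge0 => i _; exact: sumr_ge0.
  by apply: cmax; rewrite inE.
have dd : (0 < #|{: 'I_d * 'I_d}|)%N by rewrite card_prod card_ord muln_gt0 d0.
have intFn ij : mu.-integrable setT (EFin \o (fun x => `|F ij x| ^+ d)).
  by apply: (Lfun_pow_integrable cK' p1 (ltW dp) d0); exact: LF.
have eta_d : 0 < eta ^+ d by rewrite exprn_gt0.
have [kappa kappa0 kappaP] :=
  mollify_sum_measure_lower d0 dd B00 eta_d intF intFn.
(* The slopes cover a fixed cube at all small scales, which keeps the contact
   sets large. *)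
have Gam_large : \forall n \near \oo, (kappa%:E <= mu (Gam n))%E.
  have delta8 : 0 < delta / 8 by rewrite divr_gt0.
  have unif := mollify_uniform cC cu uM delta8.
  near=> n.
  have hrho : h_ n <= rho by rewrite ltW//; near: n; exact: (near_infty_natSinv_lt (PosNum rho0)).
  have un x : C x -> `|mollify (h_ n) m0 u x - u x| <= delta / 8 by move: x; near: n; exact: unif.
  have onto : forall q : 'rV[R]_d, (forall i, `|q ord0 i| <= eta) ->
      exists2 x, Gam n x & forall i, Gh (h_ n) i x = q ord0 i.
    apply: (@contact_onto _ _ (vh (h_ n)) (Gh (h_ n)) _ _ D C K oD (@subset_closure _ D) KD eta r xs) => //.
    + by move=> x xi t; exact: dvh.
    + exact: cvh.
    + exact: ltW.
    move=> x Cx nKx; have := gap Cx nKx.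
    exact: strict_gap delta0 (un x Cx) (un xs Dxs) eta_small.
  apply: (kappaP (h_ n) (Gam n) (Phi n)) => //.
  + exact: measurable_fun_continuous_rV.
  + move=> x [Kx _ _]; rewrite addrC.
    apply: (@le_trans _ _ (\sum_i \sum_j (`|mollify (h_ n) m0 (F (i, j)) x| + `|D2w i j x|))).
      apply: ler_sum => i _; apply: ler_sum => j _.
      by rewrite HhE// ler_normD.
    under eq_bigr do rewrite big_split/=.
    rewrite big_split/= lerD ?B0P// pair_bigA/=.
    by rewrite le_eqVlt; apply/orP; left; apply/eqP; apply: eq_bigr => -[].
  have := area_bound (fun i x xi t => @dGh _ i x xi t (hn0 n)) (fun i j => @cHh _ i j (hn0 n))
    (cGam n) (ltW eta0) onto.
  by rewrite exprMn EFinM lee_pmul2l// lte_fin exprn_gt0.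
pose I := ('I_d * 'I_d + 'I_d)%type.
pose g (i : I) := match i with inl ij => F ij | inr j => P j end.
have mg i : measurable_fun setT (g i).
  by case: i => [ij|j]; apply: mLfun; [exact: LF|exact: LP].
have vg i : osc_vanishes (g i) by case: i => [ij|j]; [exact: vF|exact: vP].
have intg i : mu.-integrable setT (EFin \o g i) by case: i => [ij|j]; [exact: intF|exact: intP].
have kappa2 : 0 < kappa / 2 by rewrite divr_gt0.
(* At accuracy [1 / (j + 1)]: a scale, and a set outside which all weak
   derivatives are approximated by their mollifications. *)
have good j : exists nB : nat * set 'rV[R]_d, [/\ measurable nB.2 /\ (mu nB.2 <= (kappa / 2)%:E)%E,
    h_ nB.1 <= rho, (kappa%:E <= mu (Gam nB.1))%E,
    forall x, C x -> `|mollify (h_ nB.1) m0 u x - u x| <= h_ j &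
    forall x, ~ nB.2 x -> forall i, (\int[mu]_z (`|g i z - g i x| * k (h_ nB.1) x z)%:E < (h_ j)%:E)%E].
  have : \forall n \near \oo, exists B : set 'rV[R]_d, [/\ measurable B /\ (mu B <= (kappa / 2)%:E)%E,
      h_ n <= rho, (kappa%:E <= mu (Gam n))%E,
      forall x, C x -> `|mollify (h_ n) m0 u x - u x| <= h_ j &
      forall x, ~ B x -> forall i, (\int[mu]_z (`|g i z - g i x| * k (h_ n) x z)%:E < (h_ j)%:E)%E].
    apply: filterS3 (filterI (near_infty_natSinv_lt (PosNum rho0)) Gam_large)
      (mollify_uniform cC cu uM (hn0 j)) (osc_exceptional_set mg vg kappa2 (hn0 j)).
    by move=> n /= [n1 n2] n3 [B [mB B1 B2]]; exists B; split => //; exact: ltW.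
  by move=> [n _ /(_ n (leqnn n))[B nB]]; exists (n, B).
have [nB nBP] := choice good.
pose A j := Gam (nB j).1 `\` (nB j).2.
have mA j : measurable (A j) by apply: measurableD => //; have [[]] := nBP j.
have AK j : A j `<=` K by move=> x [[]].
have kA j : ((kappa / 2)%:E <= mu (A j))%E.
  have [[mB Bk] _ kG _ _] := nBP j.
  have : (mu (Gam (nB j).1) <= mu (A j) + mu (nB j).2)%E.
    apply: (@le_trans _ _ (mu (A j `|` (nB j).2))).
      rewrite le_measure ?inE//; first exact: measurableU.
      by move=> x Gx; have [Bx|nBx] := pselect ((nB j).2 x); [right|left].
    exact: measureU2.
  move=> /(le_trans kG) kle.
  rewrite -(@leeD2rE _ (kappa / 2)%:E)// -EFinD -splitr (le_trans kle)//.
  exact: leeD2l.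
have [x nZx xA] := lim_sup_set_pos kappa2 (compact_measurable_rV cK)
  (compact_lebesgue_rV_lty cK) mA AK kA nZ.
have Kx : K x by have [j _ [[]]] := xA 0%N.
(* The point [x] is a contact point at arbitrarily small scales. *)
have xP e : 0 < e -> exists h, [/\ 0 < h, contact (vh h) (Gh h) C K eta x,
    forall z, C z -> `|vh h z - v z| <= e, forall i, `|Gh h i x - (Du i x + Dw i x)| <= e &
    forall i j, `|Hh h i j x - (D2u i j x + D2w i j x)| <= e].
  move=> e0; have [J _ JP] := near_infty_natSinv_lt (PosNum e0).
  have [j Jj [Gx nBx]] := xA J; have /ltW je := JP _ Jj; rewrite /= in je.
  have [_ hrho _ uh gh] := nBP j.
  exists (h_ (nB j).1); split => // [z Cz|i|i i'].
  - by rewrite /vh /v opprD addrACA subrr addr0 (le_trans (uh _ Cz)).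
  - rewrite GhE// opprD addrACA subrr addr0 (le_trans _ je)//.
    rewrite (_ : Du i x = P i x); last by rewrite /P/= indicE mem_set ?mulr1//; exact: KK'x.
    rewrite -lee_fin (le_trans (mollify_dist_le (hn0 _) (mg (inr i))
      (integrable_mul_mbump _ _ _ (intg (inr i)))))//.
    by rewrite ltW//; exact: gh nBx (inr i).
  - rewrite HhE// opprD addrACA subrr addr0 (le_trans _ je)//.
    rewrite (_ : D2u i i' x = F (i, i') x); last by rewrite /F/= indicE mem_set ?mulr1//; exact: KK'x.
    rewrite -lee_fin (le_trans (mollify_dist_le (hn0 _) (mg (inl (i, i')))
      (integrable_mul_mbump _ _ _ (intg (inl (i, i'))))))//.
    by rewrite ltW//; exact: gh nBx (inl (i, i')).
exists x; split => //.
- move=> z Cz; have Cx : C x by apply: subset_closure; exact: KD.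
  apply: (@le_of_eps _ _ (2 + \sum_i `|(z - x) ord0 i|)).
    by rewrite addr_ge0// sumr_ge0.
  move=> e e0; have [h [h0 [_ vx _] vv Ge _]] := xP e e0.
  have sumle : \sum_i Gh h i x * (z - x) ord0 i <=
      \sum_i (Du i x + Dw i x) * (z - x) ord0 i + e * \sum_i `|(z - x) ord0 i|.
    rewrite mulr_sumr -big_split; apply: ler_sum => i _ /=.
    rewrite -lerBlDl -mulrBl (le_trans (ler_norm _))// normrM ler_wpM2r//; exact: Ge.
  exact: contact_limit (vv z Cz) (vv x Cx) (vx z Cz) sumle.
- move=> i; apply: (@le_of_eps _ _ 1 ler01) => e e0; rewrite mulr1.
  have [h [h0 [_ _ Gx] _ Ge _]] := xP e e0.
  rewrite -(subrK (Gh h i x) (Du i x + Dw i x)) addrC (le_trans (ler_normD _ _))// lerD//.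
  by rewrite distrC; exact: Ge.
split=> [i j|xi].
  suff : D2u i j x + D2w i j x = D2u j i x + D2w j i x.
    by move=> E; apply: (@addIr _ (D2w i j x)); rewrite E sw.
  apply/eqP; rewrite -subr_eq0 -normr_le0.
  apply: (@le_of_eps _ _ 2) => // e e0; rewrite add0r.
  have [h [h0 _ _ _ He]] := xP e e0.
  have E : Hh h i j x = Hh h j i x by rewrite /Hh mincrC sw.
  rewrite -(subrK (Hh h i j x) (D2u i j x + D2w i j x)) {2}E -addrA mulr2n mulrDr mulr1.
  rewrite (le_trans (ler_normD _ _))// lerD//.
  by rewrite distrC.
apply: (@le_of_eps _ _ (\sum_i \sum_j `|xi ord0 i| * `|xi ord0 j|)).
  by apply: sumr_ge0 => i _; apply: sumr_ge0 => j _; rewrite mulr_ge0.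
move=> e e0; have [h [h0 Gx _ _ He]] := xP e e0.
have := contact_second (fun x xi t => @dvh _ x xi t h0) (fun i x xi t => @dGh _ i x xi t h0)
  oD (@subset_closure _ D) KD Gx xi.
move=> H0; rewrite -(lerD2l (\sum_i \sum_j Hh h i j x * xi ord0 i * xi ord0 j)).
rewrite addrCA; apply: lerD => //.
rewrite mulr_sumr -big_split; apply: ler_sum => i _ /=.
rewrite mulr_sumr -big_split; apply: ler_sum => j _ /=.
rewrite -lerBlDl -!mulrA -mulrBl (le_trans (ler_norm _))// normrM [leLHS]mulrC [leRHS]mulrC.
rewrite normrM ler_wpM2l ?mulr_ge0//.
by rewrite distrC.
Unshelve. all: by end_near.
Qed.

End contact_point.

(** * Jumps and the barrier *)
Section support.
Context (R : realType) (d : nat) (nu : {measure set 'rV[R]_d -> \bar R}).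

(** The complement of the support is the union of countably many null balls with
rational centres. *)
Lemma measure_support_ae : {ae nu, forall y, measure_support nu y}.
Proof.
pose B (qk : 'rV[rat]_d * nat) : set 'rV[R]_d :=
  ball (map_mx ratr qk.1 : 'rV[R]_d) qk.2.+1%:R^-1.
pose F k := if unpickle k is Some qk then
  if nu (B qk) == 0%E then B qk else set0 else set0.
have nF k : nu.-negligible (F k).
  rewrite /F; case: unpickle => [qk|]; last exact: negligible_set0.
  case: ifPn => [/eqP nB|_]; last exact: negligible_set0.
  apply/negligibleP; last exact: nB.
  by apply: open_measurable_mx; exact: ball_open.
apply: negligibleS (negligible_bigcup nF) => y /= ny.
have [U [oU Uy nU]] : exists U, [/\ open U, U y & nu U = 0%E].
  apply: contrapT => H; apply: ny => U oU Uy; rewrite lt0e measure_ge0 andbT.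
  by apply/eqP => nU; apply: H; exists U.
move: (Uy); rewrite (open_rV_bigcup oU) => -[qk /= qkU By].
exists (pickle qk) => //; rewrite /F pickleK ifT//.
apply/eqP/le_anti; rewrite measure_ge0 andbT -nU le_measure ?inE//.
  by apply: open_measurable_mx; exact: ball_open.
exact: open_measurable_mx.
Qed.

(** The integral is at most that of the positive part, so that an upper bound
follows even if [f] has a divergent negative part. *)
Lemma integral_le_on_support (f g : 'rV[R]_d -> R) (kappa : R) :
  measurable_fun setT f -> measurable_fun setT g -> (forall y, 0 <= g y) ->
  0 <= kappa -> (forall y, measure_support nu y -> f y <= kappa * g y) ->
  (\int[nu]_y (f y)%:E <= kappa%:E * \int[nu]_y (g y)%:E)%E.
Proof.
move=> mf mg g0 k0 fg.
apply: (@le_trans _ _ (\int[nu]_y ((fun z => (f z)%:E)^\+ y))%E).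
  by rewrite integralE; apply: geeDl; rewrite leeNl oppe0 integral_ge0.
rewrite -ge0_integralZl_EFin//; last first.
- exact/measurable_EFinP.
- by move=> y _; rewrite lee_fin.
apply: ae_ge0_le_integral => //.
- by apply: measurable_funepos; exact/measurable_EFinP.
- by move=> y _; rewrite mule_ge0// lee_fin.
- by apply/measurable_EFinP; exact: measurable_funM.
apply: filterS measure_support_ae => y sy _.
by rewrite funeposE ge_max -EFinM !lee_fin fg//= mulr_ge0.
Qed.

End support.

Section jump_integrand.
Context (R : realType) (d : nat).
Implicit Types (x y : 'rV[R]_d).

Lemma sqnorm_ge0 y : 0 <= sqnorm y.
Proof. by apply: sumr_ge0 => i _; exact: sqr_ge0. Qed.

Lemma sqr_coord_le y i : y ord0 i ^+ 2 <= sqnorm y.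
Proof. by rewrite /sqnorm (bigD1 i)//= lerDl sumr_ge0// => j _; exact: sqr_ge0. Qed.

Lemma coord_div_le y i : `|y ord0 i| / (1 + sqnorm y) <= 2^-1.
Proof.
have s0 := sqnorm_ge0 y; have ys := sqr_coord_le y i.
rewrite ler_pdivrMr ?ltr_wpDr// -(ler_pM2l (@ltr0n R 2)) mulrA mulfV// mul1r.
rewrite (le_trans _ (_ : 1 + `|y ord0 i| ^+ 2 <= _))//; last first.
  by rewrite lerD2l real_normK ?num_real.
have := sqr_ge0 (`|y ord0 i| - 1); move: `|_| => t; lra.
Qed.

Lemma coord_sum_le x y (eta : R) : (forall i, `|x ord0 i| <= eta) ->
  `|\sum_i y ord0 i * x ord0 i| <= d%:R * eta * `|y|.
Proof.
move=> xeta; rewrite (le_trans (ler_norm_sum _ _ _))//.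
rewrite (le_trans (ler_sum _ (fun i _ => _ : _ <= eta * `|y|)))//.
  by move=> i _; rewrite normrM mulrC ler_pM// coord_le_norm.
by rewrite sumr_const card_ord -[leLHS]mulr_natl mulrA.
Qed.

Lemma coord_sum_div_le x y (eta : R) : (forall i, `|x ord0 i| <= eta) ->
  `|\sum_i y ord0 i * x ord0 i| / (1 + sqnorm y) <= d%:R * eta / 2.
Proof.
move=> xeta; have s1 : 0 < 1 + sqnorm y by rewrite ltr_wpDr// sqnorm_ge0.
apply: (@le_trans _ _ (\sum_(i < d) 2^-1 * eta)).
  apply: (@le_trans _ _ (\sum_i `|y ord0 i * x ord0 i| / (1 + sqnorm y))).
    rewrite -mulr_suml ler_wpM2r ?ler_norm_sum// invr_ge0; exact: ltW.
  apply: ler_sum => i _; rewrite normrM mulrAC ler_pM ?divr_ge0 ?(ltW s1)//.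
  exact: coord_div_le.
by rewrite sumr_const card_ord -[leLHS]mulr_natl mulrCA mulrC.
Qed.

(** For small jumps the bound [1 - exp t <= - t] cancels the compensator to first
order; for large ones the compensator is bounded, as [|a| <= (1 + s) / 2]. *)
Lemma barrier_jump_le (lam W a s : R) : 0 <= lam -> 0 <= W -> a ^+ 2 <= s ->
  W - W * expR (lam * a) + a * (lam * W) / (1 + s) <= (1 + lam) * W * Num.min 1 s.
Proof.
move=> l0 W0 as_.
have s0 : 0 <= s := le_trans (sqr_ge0 a) as_.
have s1 : 0 < 1 + s by rewrite ltr_wpDr.
rewrite [leLHS](_ : _ = W * (1 - expR (lam * a) + lam * (a / (1 + s)))); last by ring.
rewrite [(1 + lam) * W]mulrC -mulrA ler_wpM2l//.
have [s_1|s_1] := leP 1 s.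
  have e0 := expR_ge0 (lam * a).
  have : lam * (a / (1 + s)) <= lam * 1.
    rewrite ler_wpM2l// ler_pdivrMr// mul1r; nra.
  by lra.
have e1 := expR_ge1Dx (lam * a).
have : lam * (a / (1 + s)) - lam * a <= lam * s.
  rewrite -mulrBr ler_wpM2l// -(ler_pM2r s1) mulrBl divfK ?gt_eqF//.
  by nra.
by lra.
Qed.

(** [P] is the pairing of the jump with the gradient of [v], and [a * (lam * W)]
with that of the barrier.  The increment of [u] is bounded by the contact
inequality at the landing point; the first-order terms then cancel up to the
factor [s / (1 + s)]. *)
Lemma jump_inside_le (lam W a s u0 u1 P Q : R) : 0 <= lam -> 0 <= W -> a ^+ 2 <= s ->
  `|P| <= Q -> u1 + W * expR (lam * a) <= u0 + W + P ->
  u1 - u0 - (P - a * (lam * W)) / (1 + s) <= (Q + (1 + lam) * W) * Num.min 1 s.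
Proof.
move=> l0 W0 as_ PQ uv; have := barrier_jump_le l0 W0 as_.
have s0 : 0 <= s := le_trans (sqr_ge0 a) as_.
have s1 : 0 < 1 + s by rewrite ltr_wpDr.
have Q0 : 0 <= Q by rewrite (le_trans _ PQ).
have : P - P / (1 + s) <= Q * Num.min 1 s.
  rewrite [leLHS](_ : _ = P * (s / (1 + s))); last by field; rewrite gt_eqF.
  rewrite (le_trans (ler_norm _))// normrM ler_pM//.
  rewrite ger0_norm ?divr_ge0 ?(ltW s1)// le_min ler_pdivrMr// mul1r lerDr ler01/=.
  by rewrite ler_pdivrMr// ler_peMr// lerDl.
move: (Num.min 1 s) => t; rewrite mulrBl; lra.
Qed.

(** The loss of [g / 4] at a jump out of the domain exceeds the compensator,
whatever the size of the jump. *)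
Lemma jump_outside_le (lam W a s u0 u1 P Q g t : R) : 0 <= lam -> 0 <= W -> 0 <= t ->
  `|a| / (1 + s) <= 2^-1 -> `|P| / (1 + s) <= Q / 2 -> 0 <= s -> 0 <= Q -> Q <= g / 8 ->
  lam * W <= g / 8 -> u1 - u0 <= - (g / 4) ->
  u1 - u0 - (P - a * (lam * W)) / (1 + s) <= (Q + (1 + lam) * W) * t.
Proof.
move=> l0 W0 t0 as_ Ps s0 Q0 Qg Wg ug.
have s1 : 0 < 1 + s by rewrite ltr_wpDr.
apply: (@le_trans _ _ 0); last by rewrite mulr_ge0// addr_ge0// mulr_ge0// addr_ge0.
have : - (P / (1 + s)) <= Q / 2.
  by rewrite (le_trans _ Ps)// (le_trans (ler_norm _))// normrN normrM [`|_^-1|]gtr0_norm// invr_gt0.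
have : a / (1 + s) * (lam * W) <= 2^-1 * (lam * W).
  rewrite ler_wpM2r ?mulr_ge0// (le_trans _ as_)//.
  by rewrite (le_trans (ler_norm _))// normrM [`|_^-1|]gtr0_norm// invr_gt0.
rewrite mulrBl [a * _ / _]mulrAC; lra.
Qed.

End jump_integrand.

Section barrier.
Context (R : realType) (d : nat) (i0 : 'I_d).
Implicit Types (x xi : 'rV[R]_d).

Definition barrier (eps lam : R) x : R := eps * expR (lam * x ord0 i0).

Lemma is_derive_barrier eps lam x xi (t : R) :
  is_derive t (1 : R) (fun s : R => barrier eps lam (x + s *: xi))
    (xi ord0 i0 * (lam * barrier eps lam (x + t *: xi))).
Proof.
have da : is_derive t (1 : R) (fun s : R => lam * (x + s *: xi) ord0 i0) (lam * xi ord0 i0).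
  have -> : (fun s : R => lam * (x + s *: xi) ord0 i0) =
      (cst (lam * x ord0 i0) + (lam * xi ord0 i0) *: id).
    by apply/funext => s; rewrite !mxE mulrDr (mulrC s) mulrA.
  apply: is_derive_eq (is_deriveD (is_derive_cst (lam * x ord0 i0) t 1)
    (is_deriveZ (lam * xi ord0 i0) (is_derive_id t 1))) _.
  by rewrite add0r /GRing.scale/= mulr1.
apply: is_derive_eq (is_deriveZ eps (@is_derive1_comp _ expR _ t _ _ (is_derive_expR _) da)) _.
by rewrite /barrier /GRing.scale/=; ring.
Qed.


Lemma continuous_barrier eps lam : continuous (barrier eps lam).
Proof.
apply: rV_continuousM; first exact: rV_continuous_cst.
move=> x; apply: (@continuous_comp _ _ _ (fun x : 'rV[R]_d => lam * x ord0 i0)).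
  by apply: rV_continuousM; [exact: rV_continuous_cst|exact: continuous_coord_rV].
exact: continuous_expR.
Qed.

(** The Hessian of [u] is a nonpositive matrix minus the Hessian of the barrier,
and the latter contributes at least [gamma * lam ^+ 2 * W] to the trace. *)
Lemma local_operator_le (q : 'I_d -> 'I_d -> 'rV[R]_d -> R) (b : 'I_d -> 'rV[R]_d -> R)
    Du D2u x (gamma B eta lam W : R) : 0 < gamma -> 0 <= W -> 0 <= lam ->
  (forall xi, gamma * sqnorm xi <= \sum_i \sum_j q i j x * xi ord0 i * xi ord0 j) ->
  (forall i, `|b i x| <= B) ->
  (forall i, `|Du i x + (i == i0)%:R * (lam * W)| <= eta) ->
  (forall i j, D2u i j x = D2u j i x) ->
  (forall xi, \sum_i \sum_j (D2u i j x + (i == i0)%:R * (j == i0)%:R * (lam ^+ 2 * W)) *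
     xi ord0 i * xi ord0 j <= 0) ->
  local_operator q b Du D2u x <=
    (B * lam - gamma * lam ^+ 2 / 2) * W + d%:R * (B * eta).
Proof.
move=> gamma0 W0 lam0 ell bB Deta sD2 nD2.
pose E (i j : 'I_d) : R := (i == i0)%:R * (j == i0)%:R * (lam ^+ 2 * W).
have rvE (v : 'I_d -> R) i : (\row_i v i) ord0 i = v i by rewrite mxE.
have neg : mdot (fun i j => q i j x) (fun i j => D2u i j x + E i j) <= 0.
  apply: (mdot_le0 gamma0).
  - by move=> i j; rewrite sD2 /E [(i == i0)%:R * _]mulrC.
  - move=> xi; have := ell (\row_i xi i); rewrite /sqnorm /qform.
    under eq_bigr do rewrite rvE.
    by under [X in _ <= X -> _]eq_bigr do under eq_bigr do rewrite !rvE.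
  - move=> xi; have := nD2 (\row_i xi i); rewrite /qform.
    by under [X in X <= _ -> _]eq_bigr do under eq_bigr do rewrite !rvE.
have q0 : gamma <= q i0 i0 x.
  have := ell (delta_mx ord0 i0); rewrite /sqnorm (bigD1 i0)//= big1 => [|i ne]; last first.
    by rewrite mxE (negbTE ne) andbF expr0n.
  rewrite mxE !eqxx expr1n addr0 mulr1 (bigD1 i0)//= (bigD1 i0)//= !mxE !eqxx !mulr1.
  rewrite big1 ?addr0; last by move=> j ne; rewrite !mxE (negbTE ne) mulr0.
  by rewrite big1 ?addr0// => i ne; rewrite big1// => j _; rewrite !mxE (negbTE ne) mulr0 mul0r.
have trE : mdot (fun i j => q i j x) E = q i0 i0 x * (lam ^+ 2 * W).
  rewrite /mdot (bigD1 i0)//= (bigD1 i0)//= /E !eqxx !mul1r.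
  rewrite big1 ?addr0; last by move=> j ne; rewrite (negbTE ne) mulr0 mul0r mulr0.
  by rewrite big1 ?addr0// => i ne; rewrite big1// => j _; rewrite (negbTE ne) !mul0r mulr0.
have trD : \sum_i \sum_j q i j x * D2u i j x <= - (gamma * (lam ^+ 2 * W)).
  move: neg; rewrite (_ : mdot _ _ = \sum_i \sum_j q i j x * D2u i j x + q i0 i0 x * (lam ^+ 2 * W)).
    rewrite -subr_ge0 sub0r opprD => H; rewrite -subr_ge0.
    rewrite (le_trans H)// addrC lerD2r lerN2.
    by rewrite ler_wpM2r// mulr_ge0 ?exprn_ge0.
  rewrite -trE /mdot -big_split; apply: eq_bigr => i _ /=.
  by rewrite -big_split; apply: eq_bigr => j _; rewrite /= mulrDr.
have drift : \sum_i b i x * Du i x <= d%:R * (B * eta) + B * (lam * W).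
  pose p i := Du i x + (i == i0)%:R * (lam * W).
  rewrite (eq_bigr (fun i => b i x * p i - b i x * ((i == i0)%:R * (lam * W)))); last first.
    by move=> i _; rewrite -mulrBr addrK.
  rewrite sumrB lerD//.
    apply: (@le_trans _ _ (\sum_(i < d) B * eta)).
      apply: ler_sum => i _; rewrite (le_trans (ler_norm _))// normrM ler_pM//; exact: Deta.
    by rewrite sumr_const card_ord -[leLHS]mulr_natl.
  rewrite (bigD1 i0)//= eqxx mul1r big1 ?addr0; last by move=> i ne; rewrite (negbTE ne) mul0r mulr0.
  rewrite -mulNr ler_wpM2r ?mulr_ge0// (le_trans _ (bB i0))//.
  by rewrite -normrN ler_norm.
rewrite /local_operator; lra.
Qed.

End barrier.

(** * The maximum principle *)
Section core.
Context (R : realType) (d : nat).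
Implicit Types (x y z xi : 'rV[R]_d).

(** The second-order gain is quadratic in [lam], while drift and jumps cost a
multiple of [1 + lam], and the slope of size [eta] less than the barrier. *)
Lemma strict_generator_bound (B lam gamma W Lam Q eta w0 : R) :
  B * lam + (1 + lam) * Lam + 1 <= gamma * lam ^+ 2 / 2 -> 0 < w0 -> w0 <= W ->
  d%:R * (B * eta) + Q * Lam < w0 ->
  (B * lam - gamma * lam ^+ 2 / 2) * W + d%:R * (B * eta) + (Q + (1 + lam) * W) * Lam < 0.
Proof.
move=> lamP w00 w0W etaP.
have W0 : 0 < W by rewrite (lt_le_trans w00).
have : (B * lam + (1 + lam) * Lam + 1) * W <= gamma * lam ^+ 2 / 2 * W by rewrite ler_pM2r.
rewrite !mulrBl !mulrDl mul1r; move: (gamma * _ / 2) => G.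
rewrite -(mulrA _ Lam W) (mulrC Lam) !mulrA; lra.
Qed.

Lemma gradient_choice (g w1 r B Lam : R) : (0 < d)%N -> 0 < g -> 0 < w1 ->
  0 <= r -> 0 <= B -> 0 <= Lam ->
  exists eta, [/\ 0 < eta, d%:R * eta * (2 * r) <= g / 8 &
    d%:R * (B * eta) + d%:R * eta * (2 * r) * Lam < w1].
Proof.
move=> d0 g0 w10 r0 B0 Lam0.
have dR : 0 < d%:R :> R by rewrite ltr0n.
have L0 : 0 <= 2 * r * Lam by rewrite !mulr_ge0.
pose T := 16 * r + B + 2 * r * Lam + 1.
have T0 : 0 < T by rewrite ltr_wpDl// !addr_ge0// mulr_ge0.
pose eta := Num.min g w1 / (d%:R * T).
have m0 : 0 < Num.min g w1 by rewrite lt_min g0.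
have eta0 : 0 < eta by rewrite divr_gt0// mulr_gt0.
have etaT : d%:R * eta * T = Num.min g w1.
  by rewrite /eta; field; rewrite !gt_eqF.
exists eta; split => //.
  have : d%:R * eta * (16 * r) <= g.
    apply: (@le_trans _ _ (d%:R * eta * T)); last by rewrite etaT ge_min lexx.
    apply: ler_wpM2l; first by rewrite mulr_ge0// ltW.
    by rewrite /T -!addrA lerDl !addr_ge0.
  by move: (d%:R * eta) => t; lra.
apply: (@lt_le_trans _ _ (d%:R * eta * T)); last by rewrite etaT ge_min lexx orbT.
rewrite (_ : _ + _ = d%:R * eta * (B + 2 * r * Lam)); last by ring.
have de0 : 0 < d%:R * eta by rewrite mulr_gt0.
rewrite (ltr_pM2l de0) /T -!addrA ltr_wpDl ?mulr_ge0//.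
by rewrite ltrD2l ltrDl.
Qed.

Lemma slope_choice (B lam gamma Lam : R) : 0 < gamma -> 0 <= Lam -> 1 <= lam ->
  gamma * lam = gamma + 2 * (B + 2 * Lam + 1) ->
  B * lam + (1 + lam) * Lam + 1 <= gamma * lam ^+ 2 / 2.
Proof.
move=> gamma0 Lam0 lam1 E; rewrite expr2 mulrA E.
have : 0 <= Lam * (lam - 1) by rewrite mulr_ge0// subr_ge0.
have : 0 <= gamma * lam by rewrite mulr_ge0 ?(ltW gamma0)// (le_trans ler01).
lra.
Qed.

Variables (q : 'I_d -> 'I_d -> 'rV[R]_d -> R) (b : 'I_d -> 'rV[R]_d -> R)
  (N : R.-ker 'rV[R]_d ~> 'rV[R]_d).
Hypotheses (d_gt0 : (0 < d)%N) (b_bounded : forall i, bounded_fun (b i))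
  (q_elliptic : locally_elliptic q)
  (N_bounded : (ereal_sup
     [set \int[N x]_y (Num.min 1 (sqnorm y))%:E | x in setT] < +oo)%E).
Variables (D : set 'rV[R]_d) (c u : 'rV[R]_d -> R).
Hypotheses (D_open : open D) (D_bounded : bounded_set D)
  (u_subsolution : subsolution q b N D c u).

Lemma bounded_fun_le (f : 'rV[R]_d -> R) : bounded_fun f ->
  exists2 M, 0 <= M & forall x, `|f x| <= M.
Proof.
move=> [M [_ Mf]]; exists (`|M| + 1) => [|x]; first by rewrite addr_ge0.
by apply: Mf => //; rewrite (le_lt_trans (ler_norm M))// ltrDl.
Qed.

(** Bony's argument at the level [m], by contradiction.  Asking for [c * u >= 0]
only above the level covers both [c >= 0] with [m >= 0] and [c = 0] with any
[m]. *)
Lemma maximum_principle_level (m : R) :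
  (forall y, ((jump_range N D `\` D) `|` (closure D `\` interior D)) y -> u y <= m) ->
  (forall x, D x -> m < u x -> 0 <= c x * u x) ->
  forall x, D x -> u x <= m.
Proof.
move=> uE cu0 xs Dxs; rewrite leNgt; apply/negP => uxs.
have [cu bu [p [Du [D2u [dp uW usub]]]]] := u_subsolution.
have [M M0 uM] := bounded_fun_le bu.
have [r r1 rP] := closure_bound D_bounded.
pose C := closure D.
have cC : compact C := compact_closure_le rP.
have DC : D `<=` C by exact: subset_closure.
have [gamma gamma0 ell] := q_elliptic cC.
have [B B0 bB] : exists2 B, 0 <= B & forall i x, `|b i x| <= B.
  have /choice[F FP] i : exists F, 0 <= F /\ forall x, `|b i x| <= F.
    by have [F F0 FP] := bounded_fun_le (b_bounded i); exists F.
  exists (\sum_i F i) => [|i x]; first by apply: sumr_ge0 => i _; have [] := FP i.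
  rewrite (bigD1 i)//= (le_trans ((FP i).2 x))// lerDl sumr_ge0// => j _.
  by have [] := FP j.
have [Lam Lam0 NL] : exists2 Lam : R, 0 <= Lam &
    forall x, (\int[N x]_y (Num.min 1 (sqnorm y))%:E <= Lam%:E)%E.
  move: (N_bounded); set S := ereal_sup _ => Soo.
  have leS x : (\int[N x]_y (Num.min 1 (sqnorm y))%:E <= S)%E.
    by apply: ereal_sup_ubound; exists x.
  have S0 : (0 <= S)%E.
    apply: le_trans (leS 0); apply: integral_ge0 => y _.
    by rewrite lee_fin le_min ler01 sqnorm_ge0.
  have fS : S \is a fin_num by rewrite ge0_fin_numE.
  by exists (fine S) => [|x]; [exact: fine_ge0|rewrite fineK].
pose g := u xs - m; have g0 : 0 < g by rewrite subr_gt0.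
pose i0 := Ordinal d_gt0.
(* Large enough for the second-order gain of the barrier to win; see
   [slope_choice]. *)
pose lam := 1 + 2 * (B + 2 * Lam + 1) / gamma.
have lam1 : 1 <= lam.
  by rewrite lerDl divr_ge0 ?(ltW gamma0)// mulr_ge0// !addr_ge0// mulr_ge0.
have lamP : B * lam + (1 + lam) * Lam + 1 <= gamma * lam ^+ 2 / 2.
  have lamE : gamma * lam = gamma + 2 * (B + 2 * Lam + 1).
    by rewrite /lam; field; rewrite gt_eqF.
  exact: slope_choice lamE.
(* Small enough for the barrier and its gradient to stay below [g / 8]. *)
pose eps := g / (8 * (1 + lam) * expR (lam * r)).
have lam0 : 0 <= lam by rewrite (le_trans ler01).
have lam10 : 0 < 1 + lam by rewrite ltr_wpDr.
have eps0 : 0 < eps by rewrite divr_gt0// !mulr_gt0 ?expR_gt0.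
pose w := barrier i0 eps lam.
have w0 x : 0 < w x by rewrite mulr_gt0// expR_gt0.
have wg x : C x -> (1 + lam) * w x <= g / 8.
  move=> Cx; rewrite (_ : _ * w x = g / 8 * (expR (lam * x ord0 i0) / expR (lam * r))).
    rewrite ler_piMr ?divr_ge0 ?(ltW g0)// ler_pdivrMr ?expR_gt0// mul1r ler_expR.
    by rewrite ler_wpM2l// (le_trans _ (rP x Cx))// (le_trans (ler_norm _))// coord_le_norm.
  by rewrite /w /barrier /eps; field; rewrite !gt_eqF ?expR_gt0.
(* A lower bound of the barrier on [C]. *)
pose w1 := eps * expR (- (lam * r)).
have w10 : 0 < w1 by rewrite mulr_gt0// expR_gt0.
have w1w x : C x -> w1 <= w x.
  move=> Cx; rewrite ler_pM2l// ler_expR -mulrN ler_wpM2l// lerNl.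
  by rewrite (le_trans _ (rP x Cx))// (le_trans (ler_norm _))// normrN coord_le_norm.
have r0 : 0 <= r by rewrite (le_trans ler01).
have [eta [eta0 Qg etaQ]] := gradient_choice d_gt0 g0 w10 r0 B0 Lam0.
set Q := d%:R * eta * (2 * r) in Qg etaQ.
have Q0 : 0 <= Q by rewrite !mulr_ge0// ltW.
pose Dw (i : 'I_d) x := (i == i0)%:R * (lam * w x).
pose D2w (i j : 'I_d) x := (i == i0)%:R * (j == i0)%:R * (lam ^+ 2 * w x).
pose K := C `&` [set x | m + g / 2 <= u x + w x].
have cw : continuous w by exact: continuous_barrier.
have wsmall x : C x -> w x <= g / 8.
  by move=> Cx; rewrite (le_trans _ (wg x Cx))// ler_peMl ?(ltW (w0 x))// lerDl.
have cK : compact K.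
  apply: (subclosed_compact _ cC); last by move=> x [].
  apply: closedI; first exact: closed_closure.
  apply: (@closed_comp _ _ (fun x => u x + w x) [set t : R | m + g / 2 <= t]).
    by move=> x _; exact: rV_continuousD.
  exact: closed_ge.
have KD : K `<=` D.
  move=> x [Cx /= vx]; apply: contrapT => nDx.
  have : u x <= m.
    by apply: uE; right; split => // /interior_subset.
  by have := wsmall x Cx; move: g0 vx; move: (u x) (w x) => s t; lra.
have dw x xi (t : R) : is_derive t (1 : R) (fun s : R => w (x + s *: xi))
    (\sum_j xi ord0 j * Dw j (x + t *: xi)).
  apply: is_derive_eq (is_derive_barrier i0 eps lam x xi t) _.
  rewrite (bigD1 i0)//= /Dw eqxx mul1r big1 ?addr0// => i ne.
  by rewrite (negbTE ne) mul0r mulr0.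
have dDw i x xi (t : R) : is_derive t (1 : R) (fun s : R => Dw i (x + s *: xi))
    (\sum_j xi ord0 j * D2w i j (x + t *: xi)).
  rewrite (_ : (fun s : R => _) = ((i == i0)%:R * lam) *: (fun s : R => w (x + s *: xi))); last first.
    by apply/funext => s; rewrite /Dw mulrA.
  apply: is_derive_eq (is_deriveZ _ (is_derive_barrier i0 eps lam x xi t)) _.
  rewrite (bigD1 i0)//= /D2w eqxx mulr1 big1 ?addr0// => [|j ne].
    by rewrite -/w; move: (w _) => W; rewrite /GRing.scale/=; ring.
  by rewrite (negbTE ne) mulr0 mul0r mulr0.
have cDw i : continuous (Dw i).
  apply: rV_continuousM; first exact: rV_continuous_cst.
  by apply: rV_continuousM => //; exact: rV_continuous_cst.
have cD2w i j : continuous (D2w i j).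
  apply: rV_continuousM; first exact: rV_continuous_cst.
  by apply: rV_continuousM => //; exact: rV_continuous_cst.
have sD2w i j x : D2w i j x = D2w j i x by rewrite /D2w [(i == i0)%:R * _]mulrC.
have g20 : 0 < g / 2 by rewrite divr_gt0.
have gap x : closure D x -> ~ K x -> u x + w x + g / 2 <= u xs + w xs.
  move=> Cx nKx; have : u x + w x < m + g / 2 by rewrite ltNge; apply/negP => H; exact: nKx.
  have := w0 xs; rewrite /g; move: (u x) (w x) (u xs) (w xs); move=> t1 t2 t3 t4; lra.
have eta_small : 2 * r * d%:R * eta <= g / 2 / 2.
  rewrite (_ : _ * eta = Q); last by rewrite /Q -mulrA mulrC.
  by rewrite (le_trans Qg)// -mulrA -invfM ler_pM2l// lef_pV2 ?posrE//; lra.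
have [x [Kx nZx vx petax [sD2 nD2]]] := contact_point d_gt0 D_open cu uM dp uW dw dDw cw cDw cD2w
  sD2w cK KD (DC _ Dxs) g20 gap eta0 rP eta_small usub.
have Cx := DC _ (KD _ Kx); have Dx := KD _ Kx.
have {}usub : (- levy_operator q b N u Du D2u x + (c x * u x)%:E <= 0)%E.
  by apply: contrapT => H; apply: nZx => /(_ Dx).
have uxg : m + g / 4 <= u x.
  case: Kx => _ /=; have := wsmall x Cx; move: (u x) (w x) g0; move=> t1 t2; lra.
have local : local_operator q b Du D2u x <=
    (B * lam - gamma * lam ^+ 2 / 2) * w x + d%:R * (B * eta).
  apply: (@local_operator_le _ _ i0 q b Du D2u x gamma B eta lam (w x) gamma0 (ltW (w0 x)) lam0) => //.
  by move=> xi; exact: ell.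
pose P y := \sum_i y ord0 i * (\row_i (Du i x + Dw i x)) ord0 i.
have PE y : \sum_i (y ord0 i * Du i x) / (1 + sqnorm y) =
    (P y - y ord0 i0 * (lam * w x)) / (1 + sqnorm y).
  rewrite -mulr_suml; congr (_ / _); rewrite /P.
  under [X in _ = X - _]eq_bigr do rewrite mxE mulrDr.
  rewrite big_split/= [X in _ = _ + X - _](bigD1 i0)//= [X in _ = _ + (_ + X) - _]big1.
    by rewrite addr0 /Dw eqxx mul1r addrK.
  by move=> i ne; rewrite /Dw (negbTE ne) mul0r mulr0.
(* Jumps that land in [D] and jumps that land in the exterior set. *)
have jump y : measure_support (N x) y ->
    u (x + y) - u x - \sum_i (y ord0 i * Du i x) / (1 + sqnorm y) <=
    (Q + (1 + lam) * w x) * Num.min 1 (sqnorm y).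
  move=> sy; rewrite PE.
  have eta_row i : `|(\row_i (Du i x + Dw i x)) ord0 i| <= eta by rewrite mxE.
  have [Dxy|nDxy] := pselect (D (x + y)).
    have y2 : `|y| <= 2 * r.
      rewrite (_ : y = (x + y) - x); last by rewrite addrAC subrr add0r.
      by rewrite (le_trans (ler_normB _ _))// mulr_natl mulr2n lerD ?rP//; exact: DC.
    apply: jump_inside_le => //; [exact: ltW|exact: sqr_coord_le|..].
      rewrite (le_trans (coord_sum_le y eta_row))// /Q.
      by rewrite ler_wpM2l// mulr_ge0// ltW.
    have := vx _ (DC _ Dxy); rewrite (_ : x + y - x = y); last by rewrite addrAC subrr add0r.
    rewrite (_ : w (x + y) = w x * expR (lam * y ord0 i0)); last first.
      by rewrite /w /barrier mxE mulrDr expRD mulrA.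
    move=> /le_trans; apply; rewrite lerD2l /P le_eqVlt; apply/orP; left; apply/eqP.
    by apply: eq_bigr => i _; rewrite mxE mulrC.
  apply: (@jump_outside_le _ lam (w x) (y ord0 i0) (sqnorm y) (u x) (u (x + y)) (P y) Q g).
  - exact: lam0.
  - exact: ltW.
  - by rewrite le_min ler01 sqnorm_ge0.
  - exact: coord_div_le.
  - rewrite (le_trans (coord_sum_div_le y eta_row))// ler_wpM2r ?invr_ge0// /Q.
    rewrite ler_peMr ?mulr_ge0 ?(ltW eta0)//.
    by rewrite (le_trans r1)// ler_peMl// ler1n.
  - exact: sqnorm_ge0.
  - exact: Q0.
  - exact: Qg.
  - apply: le_trans (wg x Cx); rewrite ler_wpM2r ?(ltW (w0 x))//.
    by rewrite lerDr.
  - have : u (x + y) <= m.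
      by apply: uE; left; split => //; exists x => //; exists y.
    by move: uxg; move: (u x) (u (x + y)); move=> t1 t2; lra.
have cs : continuous (@sqnorm R d).
  apply: rV_continuous_sum => i; apply: rV_continuousM; exact: continuous_coord_rV.
have mjump : measurable_fun setT (fun y =>
    u (x + y) - u x - \sum_i (y ord0 i * Du i x) / (1 + sqnorm y)).
  apply: measurable_fun_continuous_rV; apply: rV_continuousB.
    apply: rV_continuousB; last exact: rV_continuous_cst.
    move=> y; apply: (@continuous_comp _ _ _ (fun y : 'rV[R]_d => x + y)); last exact: cu.
    rewrite (_ : (fun y => x + y) = (fun y => y - (- x))); first exact: continuous_rV_subr.
    by apply/funext => z; rewrite opprK addrC.
  apply: rV_continuous_sum => i; apply: rV_continuousM.
    by apply: rV_continuousM; [exact: continuous_coord_rV|exact: rV_continuous_cst].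
  move=> y; apply: (@continuous_comp _ _ _ (fun y : 'rV[R]_d => 1 + sqnorm y)).
    by apply: rV_continuousD => //; exact: rV_continuous_cst.
  by apply: inv_continuous; rewrite gt_eqF// ltr_wpDr// sqnorm_ge0.
have mmin : measurable_fun setT (fun y : 'rV[R]_d => Num.min 1 (sqnorm y)).
  by apply: measurable_minr => //; exact: measurable_fun_continuous_rV.
have QW0 : 0 <= Q + (1 + lam) * w x by rewrite addr_ge0// mulr_ge0// ltW.
have min0 (y : 'rV[R]_d) : 0 <= Num.min 1 (sqnorm y) by rewrite le_min ler01 sqnorm_ge0.
have jump_le : (jump_operator N u Du x <= ((Q + (1 + lam) * w x) * Lam)%:E)%E.
  rewrite (le_trans (integral_le_on_support mjump mmin min0 QW0 jump))//.
  by rewrite EFinM lee_wpmul2l// lee_fin.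
have levy_lt0 : (levy_operator q b N u Du D2u x < 0)%E.
  have local' : ((local_operator q b Du D2u x)%:E <=
    ((B * lam - gamma * lam ^+ 2 / 2) * w x + d%:R * (B * eta))%:E)%E by rewrite lee_fin.
  rewrite /levy_operator (le_lt_trans (leeD local' jump_le))//.
  by rewrite -EFinD lte_fin; exact: (strict_generator_bound lamP w10 (w1w x Cx) etaQ).
have cux : (0 <= (c x * u x)%:E)%E.
  by rewrite lee_fin cu0// (lt_le_trans _ uxg)// ltrDl divr_gt0.
have : (- levy_operator q b N u Du D2u x <= 0)%E by rewrite (le_trans _ usub)// leeDl.
by rewrite leeNl oppe0 leNgt levy_lt0.
Qed.

End core.

(** Otherwise the closure would be open, and a coordinate, which has a maximum on
the compact closure, could still be increased there. *)
Lemma boundary_nonempty (R : realType) (d : nat) (D : set 'rV[R]_d) :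
  (0 < d)%N -> open D -> bounded_set D -> D !=set0 ->
  (closure D `\` interior D) !=set0.
Proof.
move=> d0 oD bD [x0 Dx0]; apply: contrapT => nE.
have CD : closure D `<=` interior D by move=> x Cx; apply: contrapT => nx; apply: nE; exists x.
have [r _ rP] := closure_bound bD.
have cC := compact_closure_le rP.
pose i := Ordinal d0.
have cf : continuous (fun x : 'rV[R]_d => x ord0 i) by exact: continuous_coord_rV.
have [|x Cx xmax] := compact_EVT_max _ cC (continuous_subspaceT cf).
  by exists x0; exact: subset_closure.
rewrite inE in Cx; have /nbhs_ballP[e /= e0 eD] := CD x Cx.
pose z := x + (e / 2) *: delta_mx ord0 i.
have : closure D z.
  apply: subset_closure; apply: eD; rewrite -ball_normE/= /z opprD addrA subrr sub0r normrN.
  rewrite (@le_lt_trans _ _ (e / 2))// ?ltr_pdivrMr ?ltr_pMr ?ltr1n//.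
  apply: rV_norm_le => [|j]; first by rewrite divr_ge0// ltW.
  rewrite !mxE/=; case: (j == i); rewrite ?mulr1 ?mulr0 ?normr0 ?divr_ge0 ?(ltW e0)//.
  by rewrite ger0_norm// divr_ge0// ltW.
move=> /mem_set/xmax; rewrite !mxE !eqxx mulr1 leNgt ltrDl divr_gt0//.
Qed.

Theorem proposition3p1 (R : realType) (d : nat) (d_gt0 : (0 < d)%N)
  (q : 'I_d -> 'I_d -> 'rV[R]_d -> R) (b : 'I_d -> 'rV[R]_d -> R)
  (N : R.-ker 'rV[R]_d ~> 'rV[R]_d)
  (q_measurable : forall i j, measurable_fun setT (q i j))
  (q_bounded : forall i j, bounded_fun (q i j))
  (b_measurable : forall i, measurable_fun setT (b i))
  (b_bounded : forall i, bounded_fun (b i))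
  (q_elliptic : locally_elliptic q)
  (N_sigma_finite : forall x, sigma_finite setT (N x))
  (N_bounded : (ereal_sup
     [set \int[N x]_y (Num.min 1 (sqnorm y))%:E | x in setT] < +oo)%E)
  (D : set 'rV[R]_d) (D_open : open D) (D_bounded : bounded_set D)
  (c : 'rV[R]_d -> R) (c_ge0 : forall x, D x -> 0 <= c x)
  (c_bounded : [bounded c x | x in D]) (c_measurable : measurable_fun D c)
  (u : 'rV[R]_d -> R) (u_subsolution : subsolution q b N D c u) :
  let E := (jump_range N D `\` D) `|` (closure D `\` interior D) in
  (ereal_sup [set (u x)%:E | x in D] <=
   ereal_sup [set (Num.max (u y) 0)%:E | y in E])%E /\
  ((forall x, D x -> c x = 0) ->
   (ereal_sup [set (u x)%:E | x in D] <=
    ereal_sup [set (u y)%:E | y in E])%E).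
Proof.
move=> E.
(* Both bounds are instances of this one, for [f = max (u, 0)] and [f = u]. *)
have level (f : 'rV[R]_d -> R) : (forall y, u y <= f y) ->
    (forall m : R, (forall y, E y -> f y <= m) -> forall x, D x -> m < u x -> 0 <= c x * u x) ->
    (ereal_sup [set (u x)%:E | x in D] <= ereal_sup [set (f y)%:E | y in E])%E.
  move=> uf cuf; apply: ge_ereal_sup => _ [x Dx <-].
  have [y0 Ey0] : E !=set0.
    have [|y Ey] := boundary_nonempty d_gt0 D_open D_bounded; first by exists x.
    by exists y; right.
  have fS y : E y -> ((f y)%:E <= ereal_sup [set (f y)%:E | y in E])%E.
    by move=> Ey; apply: ereal_sup_ubound; exists y.
  move: (ereal_sup _) fS => [m| |] fS; last 2 first.
  - exact: leey.
  - by have := fS _ Ey0.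
  have fm y : E y -> f y <= m by move=> /fS; rewrite lee_fin.
  rewrite lee_fin; apply: (maximum_principle_level d_gt0 b_bounded q_elliptic N_bounded
    D_open D_bounded u_subsolution _ (cuf m fm)) Dx => y Ey.
  exact: le_trans (uf y) (fm y Ey).
split=> [|c0]; apply: level.
- by move=> y; rewrite le_max lexx.
- move=> m fm x Dx mx; rewrite mulr_ge0 ?c_ge0//.
  have [|y Ey] := boundary_nonempty d_gt0 D_open D_bounded; first by exists x.
  by rewrite (le_trans _ (ltW mx))// (le_trans _ (fm y _)) ?le_max ?lexx ?orbT//; right.
- by [].
- by move=> m fm x Dx mx; rewrite c0// mul0r.
Qed.
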